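(* Let $K\ge 2$, let $\mathcal{X}_1,\dots,\mathcal{X}_K$ be Euclidean vector spaces, and let $X=(X_1,\dots,X_K)$ be a random vector with values in $\mathcal{X}=\mathcal{X}_1\times\cdots\times\mathcal{X}_K$, $q=\dim\mathcal{X}$, distribution $\mathbb{P}_X$ and covariance operator $V=\mathbb{E}(X\otimes X)$. Assume: for all $k$, $\mathbb{E}(X_k)=0$, $\mathbb{E}(\Vert X_k\Vert_k^2)<+\infty$ and $V_k=I_k$ (the identity of $\mathcal{X}_k$); and $\mathbb{P}_X$ is an elliptically contoured distribution with density $f_X(x)=(\det V)^{-1/2}h(\langle x,V^{-1}x\rangle_{\mathcal{X}})$, where $h:[0,+\infty[\to[0,+\infty[$ has a strictly negative derivative $h'$. Let $0<\gamma<1$. Then $$\sup_{x\in\mathcal{X}}\Vert\mathrm{IF}(x;T_\gamma,\mathbb{P}_X)\Vert_\infty\le\frac{\sigma_\gamma^{-2}}{2|\kappa_0|}K(K-1)\big(\Vert V\Vert_\infty+1\big)\Vert V^{1/2}\Vert_\infty^2\,r^2(\gamma),$$ where $\mathrm{IF}(x;T_\gamma,\mathbb{P}_X)$ is the influence function of $\mathbb{T}_{1,\gamma}$ at $\mathbb{P}_X$ and $\Vert A\Vert_\infty=\sup_{x\in\mathcal{X}\setminus\{0\}}\Vert Ax\Vert_{\mathcal{X}}/\Vert x\Vert_{\mathcal{X}}$.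
   Context: Euclidean vector spaces are finite-dimensional real inner product spaces; $\langle\cdot,\cdot\rangle_k$, $\Vert\cdot\Vert_k$ are the inner product and norm of $\mathcal{X}_k$, and $\mathcal{X}$ carries $\langle\alpha,\beta\rangle_{\mathcal{X}}=\sum_k\langle\alpha_k,\beta_k\rangle_k$ with norm $\Vert\cdot\Vert_{\mathcal{X}}$. The tensor product $x\otimes y$ is the linear map $h\mapsto\langle x,h\rangle y$; $A^*$ is the adjoint of $A$. $\tau_k:\mathcal{X}\to\mathcal{X}_k$, $\alpha\mapsto\alpha_k$, is the canonical projection. $V_{k\ell}=\mathbb{E}(X_\ell\otimes X_k)=\tau_kV\tau_\ell^*$, $V_k=V_{kk}$. $\mathcal{L}(\mathcal{X})$ is the space of linear maps from $\mathcal{X}$ to itself, and $f,g:\mathcal{L}(\mathcal{X})\to\mathcal{L}(\mathcal{X})$ are $$f(A)=\sum_{k=1}^K\tau_k^*\tau_kA\tau_k^*\tau_k,\qquad g(A)=\sum_{k=1}^K\sum_{\ell\ne k}\tau_k^*\tau_kA\tau_\ell^*\tau_\ell .$$ The number $r(\gamma)$ is determined by $\frac{2\pi^{q/2}}{\Gamma(q/2)}\int_0^{r(\gamma)}t^{q-1}h(t^2)\,dt=\gamma$; $E_\gamma=\{x\in\mathcal{X}:\langle x,V^{-1}x\rangle_{\mathcal{X}}\le r^2(\gamma)\}$. The functional related to the minimum covariance determinant (MCD) estimator of $V$ is $$\mathbb{V}_{1,\gamma}(\mathbb{P})=\frac1\gamma\int_{E_\gamma}(x-M_{\mathbb{P}}(E_\gamma))\otimes(x-M_{\mathbb{P}}(E_\gamma))\,d\mathbb{P}(x),\qquad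 M_{\mathbb{P}}(B)=\frac1\gamma\int_Bx\,d\mathbb{P}(x),$$ and it satisfies $\mathbb{V}_{1,\gamma}(\mathbb{P}_X)=\sigma_\gamma^2V$ with $\sigma_\gamma^2=\frac{2\pi^{q/2}}{\gamma\,q\,\Gamma(q/2)}\int_0^{r(\gamma)}t^{q+1}h(t^2)\,dt$. Set $\mathbb{T}_{1,\gamma}(\mathbb{P})=f(\mathbb{V}_{1,\gamma}(\mathbb{P}))^{-1/2}g(\mathbb{V}_{1,\gamma}(\mathbb{P}))f(\mathbb{V}_{1,\gamma}(\mathbb{P}))^{-1/2}$, $T_\gamma=\mathbb{T}_{1,\gamma}(\mathbb{P}_X)$ and $$\kappa_0=\frac{\pi^{q/2}}{(q+2)\Gamma(q/2+1)}\int_0^{r(\gamma)}t^{q+3}h'(t^2)\,dt .$$ The influence function of a functional $S$ at $\mathbb{P}$ is $\mathrm{IF}(x;S,\mathbb{P})=\lim_{\varepsilon\downarrow0}\varepsilon^{-1}\big(S((1-\varepsilon)\mathbb{P}+\varepsilon\delta_x)-S(\mathbb{P})\big)$, with $\delta_x$ the Dirac measure at $x$; $\mathrm{IF}(x;T_\gamma,\mathbb{P}_X)$ means $\mathrm{IF}(x;\mathbb{T}_{1,\gamma},\mathbb{P}_X)$. *)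

(* Defs.v *)
From HB Require Import structures.
From mathcomp Require Import all_boot all_order all_algebra.
From mathcomp Require Import all_classical all_reals all_analysis.

Set Implicit Arguments.
Unset Strict Implicit.
Unset Printing Implicit Defensive.
Import Order.TTheory GRing.Theory Num.Theory.
Import numFieldNormedType.Exports.
Import VectorInternalTheory.

Local Open Scope classical_set_scope.
Local Open Scope ring_scope.

(* A Euclidean space is a [vectType R] with an inner product of type
   [{dot V for idfun}], i.e. a positive definite symmetric bilinear form. *)

Section Euclidean.
Context {R : realType}.

Definition enorm (V : vectType R) (ip : {dot V for idfun}) (x : V) : R :=
  Num.sqrt (ip x x).

Definition eopen (V : vectType R) (ip : {dot V for idfun}) : set (set V) :=
  [set A | forall x, A x ->
     exists2 e : R, 0 < e & forall y, enorm ip (y - x) < e -> A y].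

Definition tensor (U W : vectType R) (ipU : {dot U for idfun}) (x : U) (y : W)
    : 'Hom(U, W) :=
  linfun (fun h => ipU x h *: y).

Definition adjoint (U W : vectType R) (ipU : {dot U for idfun})
    (ipW : {dot W for idfun}) (A : 'Hom(U, W)) : 'Hom(W, U) :=
  xget 0 [set B : 'Hom(W, U) | forall x y, ipW (A x) y = ipU x (B y)].

(* The default value 0 is only reached when [A] is not self-adjoint and
   positive semidefinite; otherwise the square root is unique. *)
Definition psd_sqrt (V : vectType R) (ip : {dot V for idfun}) (A : 'End(V))
    : 'End(V) :=
  xget 0 [set S : 'End(V) | [/\ forall x y, ip (S x) y = ip x (S y),
                                forall x, 0 <= ip x (S x) &
                                (S \o S)%VF = A]].

Definition opnorm (V : vectType R) (ip : {dot V for idfun}) (A : 'End(V)) : R :=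
  sup [set enorm ip (A x) / enorm ip x | x in [set x | x != 0]].

Definition lfun_det (V : vectType R) (A : 'End(V)) : R :=
  \det (passmx.mxof (vbasis {:V}) (vbasis {:V}) A).

Definition onb (V : vectType R) (ip : {dot V for idfun})
    : (\dim {:V}).-tuple V :=
  xget (vbasis {:V}) [set b : (\dim {:V}).-tuple V |
    forall i j, ip (tnth b i) (tnth b j) = (i == j)%:R].

(* The coordinates of the integral are the integrals of the coordinates; the
   value does not depend on the basis as soon as these are integrable. *)
Definition vintegral d (T : measurableType d) (mu : {measure set T -> \bar R})
    (V : vectType R) (D : set T) (F : T -> V) : V :=
  \sum_(i < \dim {:V})
    (\int[mu]_(t in D) coord (vbasis {:V}) i (F t)) *: (vbasis {:V})`_i.

End Euclidean.

(* The inner products are a parameter of the type because they determine the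
   Borel sigma-algebra that it carries. *)
Definition eprod (R : realType) (K : nat) (E : 'I_K -> vectType R)
    (ip : forall k, {dot (E k) for idfun}) : Type :=
  {dffun forall k : 'I_K, E k}.

Section Product.
Context {R : realType} {K : nat} {E : 'I_K -> vectType R}.
Variable ip : forall k, {dot (E k) for idfun}.

Local Notation prodE := (eprod ip).

HB.instance Definition _ := Choice.on prodE.

Definition proj (k : 'I_K) (x : prodE) : E k :=
  (x : {dffun forall k : 'I_K, E k}) k.

Definition eprod_of (x : forall k, E k) : prodE :=
  [ffun k => x k] : {dffun forall k : 'I_K, E k}.

Lemma proj_of x k : proj k (eprod_of x) = x k.
Proof. by rewrite /proj /eprod_of ffunE. Qed.

Lemma eprodP (x y : prodE) : (forall k, proj k x = proj k y) -> x = y.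
Proof. by move=> xy; apply/ffunP. Qed.

Definition eprod_add (x y : prodE) := eprod_of (fun k => proj k x + proj k y).
Definition eprod_opp (x : prodE) := eprod_of (fun k => - proj k x).
Definition eprod_scale (a : R) (x : prodE) := eprod_of (fun k => a *: proj k x).

Fact eprod_addA : associative eprod_add.
Proof. by move=> x y z; apply: eprodP => k; rewrite !proj_of addrA. Qed.
Fact eprod_addC : commutative eprod_add.
Proof. by move=> x y; apply: eprodP => k; rewrite !proj_of addrC. Qed.
Fact eprod_add0 : left_id (eprod_of (fun=> 0)) eprod_add.
Proof. by move=> x; apply: eprodP => k; rewrite !proj_of add0r. Qed.
Fact eprod_addN : left_inverse (eprod_of (fun=> 0)) eprod_opp eprod_add.
Proof. by move=> x; apply: eprodP => k; rewrite !proj_of addNr. Qed.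

HB.instance Definition _ := GRing.isZmodule.Build prodE
  eprod_addA eprod_addC eprod_add0 eprod_addN.

Fact eprod_scaleA a b x : eprod_scale a (eprod_scale b x) = eprod_scale (a * b) x.
Proof. by apply: eprodP => k; rewrite !proj_of scalerA. Qed.
Fact eprod_scale1 : left_id 1 eprod_scale.
Proof. by move=> x; apply: eprodP => k; rewrite !proj_of scale1r. Qed.
Fact eprod_scaleDr : right_distributive eprod_scale +%R.
Proof. by move=> a x y; apply: eprodP => k; rewrite !proj_of scalerDr. Qed.
Fact eprod_scaleDl x : {morph eprod_scale^~ x : a b / a + b}.
Proof. by move=> a b; apply: eprodP => k; rewrite !proj_of scalerDl. Qed.

HB.instance Definition _ := GRing.Zmodule_isLmodule.Build R prodE
  eprod_scaleA eprod_scale1 eprod_scaleDr eprod_scaleDl.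

Fact proj_is_linear k : linear (proj k).
Proof. by move=> a x y; rewrite !proj_of. Qed.

HB.instance Definition _ k :=
  GRing.isLinear.Build R prodE (E k) _ (proj k) (proj_is_linear k).

Fact eprod_vect_iso : Vector.axiom (\sum_k dim (E k)) prodE.
Proof.
exists (fun x : prodE => \mxrow_k v2r (proj k x)).
  by move=> a x y; apply/rowP => j; rewrite !mxE proj_is_linear linearP !mxE.
exists (fun r => eprod_of (fun k => r2v (submxrow r k))) => [x|r].
  by apply: eprodP => k; rewrite proj_of mxrowK v2rK.
by apply/mxrowP => k; rewrite mxrowK proj_of r2vK.
Qed.

HB.instance Definition _ := Lmodule_hasFinDim.Build R prodE eprod_vect_iso.

Definition eprod_dot (x y : prodE) : R := \sum_k ip k (proj k x) (proj k y).

Fact eprod_dot_bilinear :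
  bilinear_for (GRing.Scale.Law.clone _ _ *%R _)
    (GRing.Scale.Law.clone _ _ (idfun \; *%R) _) eprod_dot.
Proof.
split=> [z|z] a x y; rewrite /eprod_dot /= mulr_sumr -big_split /=;
  apply: eq_bigr => k _; rewrite linearP.
- by rewrite linearDl linearZl_LR.
- by rewrite linearDr linearZr_LR.
Qed.

HB.instance Definition _ := bilinear_isBilinear.Build R prodE prodE R
  *%R (idfun \; *%R) eprod_dot eprod_dot_bilinear.

Fact eprod_dot_sym (x y : prodE) :
  eprod_dot x y = (-1) ^+ false * idfun (eprod_dot y x).
Proof.
rewrite expr0 mul1r; apply: eq_bigr => k _.
by rewrite [LHS](@hermitian_subproof _ _ _ _ (ip k)) expr0 mul1r.
Qed.

HB.instance Definition _ :=
  isHermitianSesquilinear.Build R prodE false idfun eprod_dot eprod_dot_sym.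

Fact eprod_dot_gt0 (x : prodE) : x != 0 -> 0 < eprod_dot x x.
Proof.
move=> x0; have ge0 k : 0 <= ip k (proj k x) (proj k x).
  have [->|/neq0_dnorm_gt0/ltW//] := eqVneq (proj k x) 0.
  by rewrite linear0r.
rewrite lt_neqAle sumr_ge0 ?andbT 1?eq_sym//.
apply: contra x0 => /eqP /psumr_eq0P xx0; apply/eqP/eprodP => k.
rewrite [RHS]linear0; apply/eqP; apply: contraT => /(@neq0_dnorm_gt0 _ _ _ (ip k)).
by rewrite xx0 ?ltxx.
Qed.

HB.instance Definition _ := isDotProduct.Build R prodE eprod_dot eprod_dot_gt0.

HB.instance Definition _ := isPointed.Build prodE 0.

HB.instance Definition _ := Measurable.copy prodE
  (g_sigma_algebraType (eopen (eprod_dot : {dot prodE for idfun}))).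

End Product.

Section LebesgueTuple.
Context {R : realType}.
Local Notation mR := (measurableTypeR R).

Definition tcons n (p : mR * n.-tuple mR) : n.+1.-tuple mR :=
  [the n.+1.-tuple mR of p.1 :: p.2].

Fact measurable_tcons n : measurable_fun [set: mR * n.-tuple mR] (@tcons n).
Proof. exact: measurable_cons. Qed.

Section Succ.
Variables (n : nat) (mu : {sigma_finite_measure set (n.-tuple mR) -> \bar R}).

Definition lebesgue_succ : set (n.+1.-tuple mR) -> \bar R :=
  pushforward (@lebesgue_measure R \x mu)%E (@tcons n).

Let pf : {measure set (n.+1.-tuple mR) -> \bar R} :=
  measure_function_pushforward__canonical__measure_function_Measure
    (@lebesgue_measure R \x mu)%E (@measurable_tcons n).

Let lebesgue_succ0 : lebesgue_succ set0 = 0%E.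
Proof. exact: (measure0 pf). Qed.
Let lebesgue_succ_ge0 A : (0 <= lebesgue_succ A)%E.
Proof. exact: (measure_ge0 pf). Qed.
Let lebesgue_succ_sigma_additive : semi_sigma_additive lebesgue_succ.
Proof. exact: (@measure_semi_sigma_additive _ _ _ pf). Qed.

HB.instance Definition _ := isMeasure.Build _ _ _ lebesgue_succ
  lebesgue_succ0 lebesgue_succ_ge0 lebesgue_succ_sigma_additive.

Let lebesgue_succ_sigma_finite : sigma_finite setT lebesgue_succ.
Proof.
have [F FT Foo] : sigma_finite setT (@lebesgue_measure R \x mu)%E.
  have /sigma_finiteP[F [TF ndF Foo]] := sigma_finiteT (@lebesgue_measure R).
  have /sigma_finiteP[G [TG ndG Goo]] := sigma_finiteT mu.
  exists (fun k => F k `*` G k).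
    rewrite -setXTT TF TG predeqE => -[x y]; split.
      move=> [/= [i _ Fix] [j _ Gjy]]; exists (maxn i j) => //; split.
      - by move: x Fix; exact/subsetPset/ndF/leq_maxl.
      - by move: y Gjy; exact/subsetPset/ndG/leq_maxr.
    by move=> [i _ []/= ? ?]; split; exists i.
  move=> k; have [mF ?] := Foo k; have [mG ?] := Goo k.
  split; first exact: measurableX.
  by rewrite product_measure1E// lte_mul_pinfty// ge0_fin_numE.
pose u (t : n.+1.-tuple mR) : mR * n.-tuple mR :=
  (thead t, [tuple of behead t]).
have mu_ : measurable_fun setT u.
  apply: measurable_fun_pair; [exact: measurable_tnth | exact: measurable_behead].
have uK p : u (tcons p) = p.
  by case: p => x t; congr pair; exact/val_inj.
exists (fun i => u @^-1` F i); first by rewrite -preimage_bigcup -FT.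
move=> i; split; first by rewrite -[X in measurable X]setTI; exact: mu_ (Foo i).1.
rewrite /lebesgue_succ /pushforward.
rewrite (_ : _ @^-1` _ = F i); first exact: (Foo i).2.
by apply/seteqP; split=> p /=; rewrite uK.
Qed.

HB.instance Definition _ := Measure_isSigmaFinite.Build _ _ _ lebesgue_succ
  lebesgue_succ_sigma_finite.

End Succ.

Fixpoint lebesgue_tuple (n : nat)
    : {sigma_finite_measure set (n.-tuple mR) -> \bar R} :=
  match n with
  | 0 => dirac ([tuple] : 0.-tuple mR)
  | n'.+1 => lebesgue_succ (lebesgue_tuple n')
  end.

End LebesgueTuple.

(* Image of the Lebesgue measure of R^q under an isometry R^q -> X; it does not
   depend on the chosen orthonormal basis. *)
Definition lebesgue_eprod {R : realType} {K : nat} {E : 'I_K -> vectType R}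
    (ip : forall k, {dot (E k) for idfun}) : set (eprod ip) -> \bar R :=
  let b := onb (eprod_dot (ip := ip)) in
  pushforward (lebesgue_tuple (\dim {: eprod ip}))
    (fun t => \sum_i (tnth t i : R) *: tnth b i).
Arguments lebesgue_eprod {R K E} ip _.

Section Influence.
Context {R : realType} {d : measure_display} {T : measurableType d}.

Fact max0_ge0 (a : R) : 0 <= Num.max 0 a.
Proof. by rewrite le_max lexx. Qed.

(* The clipping is only there to make the weights nonnegative for every [e];
   for [0 <= e <= 1] this is the mixture (1 - e) P + e delta_x. *)
Definition contaminate (P : {measure set T -> \bar R}) (x : T) (e : R)
    : {measure set T -> \bar R} :=
  measure_add (mscale (NngNum (max0_ge0 (1 - e))) P)
              (mscale (NngNum (max0_ge0 e)) (dirac x)).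

Definition is_influence (V : vectType R) (ip : {dot V for idfun})
    (S : {measure set T -> \bar R} -> 'End(V)) (P : {measure set T -> \bar R})
    (x : T) (A : 'End(V)) : Prop :=
  opnorm ip (e^-1 *: (S (contaminate P x e) - S P) - A) @[e --> 0^'+] --> (0 : R).

Definition influence (V : vectType R) (ip : {dot V for idfun})
    (S : {measure set T -> \bar R} -> 'End(V)) (P : {measure set T -> \bar R})
    (x : T) : 'End(V) :=
  xget 0 [set A | is_influence ip S P x A].

End Influence.

Section MCD.
Context {R : realType} {K : nat} {E : 'I_K -> vectType R}.
Variable ip : forall k, {dot (E k) for idfun}.

Local Notation prodE := (eprod ip).
Local Notation dot := (eprod_dot (ip := ip)).

Definition tau (k : 'I_K) : 'Hom(prodE, E k) := linfun (proj (ip := ip) k).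

Definition tau_adj (k : 'I_K) : 'Hom(E k, prodE) := adjoint dot (ip k) (tau k).

Definition diag_part (A : 'End(prodE)) : 'End(prodE) :=
  \sum_k (tau_adj k \o tau k \o A \o tau_adj k \o tau k)%VF.

Definition offdiag_part (A : 'End(prodE)) : 'End(prodE) :=
  \sum_k \sum_(l | l != k) (tau_adj k \o tau k \o A \o tau_adj l \o tau l)%VF.

(* [V^-1] is the generalized inverse of [lfun]s, the inverse when [V] is
   invertible. *)
Definition ellipsoid (V : 'End(prodE)) (r : R) : set prodE :=
  [set x | dot x ((V^-1)%VF x) <= r ^+ 2].

Definition trimmed_mean (g : R) (B : set prodE)
    (P : {measure set prodE -> \bar R}) : prodE :=
  g^-1 *: vintegral P B (fun x => x).

(* The region [B] is fixed: it does not vary with [P]. *)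
Definition mcd_cov (g : R) (B : set prodE) (P : {measure set prodE -> \bar R})
    : 'End(prodE) :=
  let m := trimmed_mean g B P in
  g^-1 *: vintegral P B (fun x => tensor dot (x - m) (x - m)).

(* The operator of multiple-set linear canonical analysis built on [mcd_cov]. *)
Definition mcd_lca (g : R) (B : set prodE) (P : {measure set prodE -> \bar R})
    : 'End(prodE) :=
  let F := ((psd_sqrt dot (diag_part (mcd_cov g B P)))^-1)%VF in
  (F \o offdiag_part (mcd_cov g B P) \o F)%VF.

Definition elliptical_density (P : {measure set prodE -> \bar R})
    (V : 'End(prodE)) (h : R -> R) : Prop :=
  forall A : set prodE, measurable A ->
    P A = (\int[lebesgue_eprod ip]_(x in A)
            (lfun_det V `^ (- 2^-1) * h (dot x ((V^-1)%VF x)))%:E)%E.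

End MCD.

Section Radial.
Context {R : realType}.

Definition Gamma (a : R) : R :=
  \int[lebesgue_measure]_(t in `]0, +oo[) (t `^ (a - 1) * expR (- t)).

(* One-sided at the origin. *)
Definition has_derivative_on_nonneg (h h' : R -> R) : Prop :=
  forall t, 0 <= t ->
    (s - t)^-1 * (h s - h t) @[s --> within [set s | 0 <= s] t^'] --> h' t.

Definition radial_mass (q : nat) (h : R -> R) (r : R) : R :=
  2 * pi `^ (q%:R / 2) / Gamma (q%:R / 2) *
  \int[lebesgue_measure]_(t in `[0, r]) (t ^+ q.-1 * h (t ^+ 2)).

Definition sigma2 (q : nat) (h : R -> R) (g r : R) : R :=
  2 * pi `^ (q%:R / 2) / (g * q%:R * Gamma (q%:R / 2)) *
  \int[lebesgue_measure]_(t in `[0, r]) (t ^+ q.+1 * h (t ^+ 2)).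

Definition kappa0 (q : nat) (h' : R -> R) (r : R) : R :=
  pi `^ (q%:R / 2) / ((q%:R + 2) * Gamma (q%:R / 2 + 1)) *
  \int[lebesgue_measure]_(t in `[0, r]) (t ^+ (q + 3) * h' (t ^+ 2)).

End Radial.

(* Main.v *)
Require Import Defs.
From HB Require Import structures.
From mathcomp Require Import all_boot all_order all_algebra.
From mathcomp Require Import all_classical all_reals all_analysis.
From mathcomp Require Import perm measurable_realfun ring lra.

Set Implicit Arguments.
Unset Strict Implicit.
Unset Printing Implicit Defensive.
Import Order.TTheory GRing.Theory Num.Theory.
Import numFieldNormedType.Exports.
Local Open Scope classical_set_scope.
Local Open Scope ring_scope.

(* Contaminating P_X by t delta_a, the truncated covariance over the fixed
   ellipsoid E is (1 - t) sigma^2 V + w(t) a (x) a, with w(t) = c t + o(t) and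
   c = 1_E(a) / gamma: the mean of P_X over E vanishes by symmetry, and its
   second moment there is gamma sigma^2 V because the whitened law is radial.
   Since f(V) = 1, the square root and the inverse are differentiated at a
   scalar operator, and
     IF(a) = (c / sigma^2) (g(aa) - (f(aa) g(V) + g(V) f(aa)) / 2),  aa = a (x) a.
   On E one has |a|^2 <= |V^(1/2)|^2 r^2, and g has at most K (K - 1) nonzero
   blocks, so it remains to see that 1 / gamma <= 1 / (2 |kappa_0|).  This
   follows from 2 |kappa_0| <= gamma sigma^2, an integration by parts in which
   h' need not be integrable (Fatou's lemma on difference quotients of h gives
   the inequality), and from sigma^2 <= 1: truncating to E lowers the mean of
   <X, V^-1 X>, whose expectation is q. *)

(** * Inner products and orthonormal families *)

(** [influence] and [psd_sqrt] are chosen values with a default, so the derivative must be shown to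
    exist in operator norm, and to be unique, before anything is bounded. At a scalar operator this
    costs little: S^2 - s^2 = (S + s)(S - s) with S >= 0 controls the root, and an explicit
    resolvent expansion controls the inverse. The other obstacle is to match the constants pi^(q/2)
    / Gamma(q/2) with Lebesgue measure on an abstract product. No surface measure appears: dilations
    give the volume C s^q of balls, hence the law of the norm. Computing the Gaussian integral once
    through this law and once by layers expresses both Gamma(q/2) and Gamma(q/2 + 1) through C.
    Rotation invariance of Lebesgue measure serves twice: it allows the eigenbasis of V as
    coordinate system, and it lets reflections and transpositions of the whitened coordinates
    determine the moments over E. Invertibility of V comes from the density itself, which would
    vanish identically if det V were 0. *)

Section LinearMaps.
Context {R : realType} {U W : vectType R} (f : 'Hom(U, W)).

Lemma lfunZ a x : f (a *: x) = a *: f x. Proof. exact: linearZ. Qed.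
Lemma lfunD x y : f (x + y) = f x + f y. Proof. exact: linearD. Qed.
Lemma lfunB x y : f (x - y) = f x - f y. Proof. exact: linearB. Qed.

End LinearMaps.

Section Tensor.
Context {R : realType} (U W : vectType R) (ipU : {dot U for idfun}).

Definition tensor_fun (u : U) (w : W) (v : U) : W := ipU u v *: w.

Fact tensor_fun_linear u w : linear (tensor_fun u w).
Proof.
by move=> a x y; rewrite /tensor_fun linearDr linearZr_LR /= scalerDl scalerA.
Qed.

HB.instance Definition _ (u : U) (w : W) :=
  GRing.isLinear.Build R U W _ (tensor_fun u w) (tensor_fun_linear u w).

Lemma tensorE (u : U) (w : W) v : tensor ipU u w v = ipU u v *: w.
Proof. exact: (lfunE (tensor_fun u w)). Qed.

End Tensor.

Section InnerProduct.
Context {R : realType} {V : vectType R} (ip : {dot V for idfun}).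
Implicit Types (x y z : V) (A B : 'End(V)).

Lemma dotC x y : ip x y = ip y x.
Proof. by rewrite [LHS](@hermitian_subproof _ _ _ _ ip) expr0 mul1r. Qed.

Lemma dot0l x : ip 0 x = 0. Proof. exact: linear0l. Qed.
Lemma dot0r x : ip x 0 = 0. Proof. exact: linear0r. Qed.
Lemma dotDl x y z : ip (x + y) z = ip x z + ip y z. Proof. exact: linearDl. Qed.
Lemma dotDr x y z : ip z (x + y) = ip z x + ip z y. Proof. exact: linearDr. Qed.
Lemma dotNl x y : ip (- x) y = - ip x y. Proof. exact: linearNl. Qed.
Lemma dotNr x y : ip y (- x) = - ip y x. Proof. exact: linearNr. Qed.
Lemma dotBl x y z : ip (x - y) z = ip x z - ip y z.
Proof. by rewrite dotDl dotNl. Qed.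
Lemma dotBr x y z : ip z (x - y) = ip z x - ip z y.
Proof. by rewrite dotDr dotNr. Qed.
Lemma dotZl a x y : ip (a *: x) y = a * ip x y. Proof. exact: linearZl_LR. Qed.
Lemma dotZr a x y : ip y (a *: x) = a * ip y x. Proof. exact: linearZr_LR. Qed.
Lemma dot_suml I (r : seq I) (Q : pred I) (F : I -> V) y :
  ip (\sum_(i <- r | Q i) F i) y = \sum_(i <- r | Q i) ip (F i) y.
Proof. exact: linear_sumlz. Qed.
Lemma dot_sumr I (r : seq I) (Q : pred I) (F : I -> V) y :
  ip y (\sum_(i <- r | Q i) F i) = \sum_(i <- r | Q i) ip y (F i).
Proof. exact: linear_sumr. Qed.

Lemma dot_gt0 x : x != 0 -> 0 < ip x x. Proof. exact: neq0_dnorm_gt0. Qed.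

Lemma dot_ge0 x : 0 <= ip x x.
Proof. by have [->|/dot_gt0/ltW//] := eqVneq x 0; rewrite dot0l. Qed.

Lemma dot_eq0 x : (ip x x == 0) = (x == 0).
Proof.
have [->|/dot_gt0 x0] := eqVneq x 0; first by rewrite dot0l eqxx.
by apply/negbTE; rewrite gt_eqF.
Qed.

Lemma dot_ext x y : (forall z, ip x z = ip y z) -> x = y.
Proof.
move=> xy; apply/eqP; rewrite -subr_eq0 -dot_eq0 dotBl.
by rewrite xy subrr.
Qed.

Lemma enorm_ge0 x : 0 <= enorm ip x. Proof. exact: sqrtr_ge0. Qed.

Lemma enorm_sq x : enorm ip x ^+ 2 = ip x x.
Proof. by rewrite sqr_sqrtr ?dot_ge0. Qed.

Lemma enorm0 : enorm ip 0 = 0. Proof. by rewrite /enorm dot0l sqrtr0. Qed.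

Lemma enorm_eq0 x : (enorm ip x == 0) = (x == 0).
Proof. by rewrite -dot_eq0 -enorm_sq expf_eq0. Qed.

Lemma enorm_gt0 x : x != 0 -> 0 < enorm ip x.
Proof. by rewrite -enorm_eq0 lt_neqAle enorm_ge0 andbT eq_sym. Qed.

Lemma enormZ a x : enorm ip (a *: x) = `|a| * enorm ip x.
Proof. by rewrite /enorm dotZl dotZr mulrA -expr2 sqrtrM ?sqr_ge0// sqrtr_sqr. Qed.

Lemma enormN x : enorm ip (- x) = enorm ip x.
Proof. by rewrite /enorm dotNl dotNr opprK. Qed.

Lemma enorm_le x c : 0 <= c -> ip x x <= c ^+ 2 -> enorm ip x <= c.
Proof. by move=> c0; rewrite -enorm_sq ler_pXn2r// nnegrE ?enorm_ge0. Qed.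

(** The leading coefficient may have any sign, because below it is <B y, y> for a [y] on which [B]
    need not be known to be positive. *)
Lemma quadratic_discriminant (a b c : R) :
  (forall t, 0 <= a + 2 * b * t + c * t ^+ 2) -> b ^+ 2 <= a * c.
Proof.
move=> q; have a0 : 0 <= a by move: (q 0); lra.
have [c0|c0] := lerP c 0.
  suff b0 : b = 0.
    have [c1|c1] := eqVneq c 0; first by rewrite b0 c1 expr0n mulr0.
    have {}c1 : c < 0 by rewrite lt_neqAle c1.
    rewrite b0 expr0n /= leNgt; apply/negP => ac.
    (* With c < 0 <= a the value at this point is c - a + a^2 / c < 0. *)
    have := q (1 - a / c); rewrite b0 mulr0 mul0r addr0.
    have -> : c * (1 - a / c) ^+ 2 = c - 2 * a + a * (a / c).
      by field; rewrite lt_eqF.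
    have : a * (a / c) <= 0 by rewrite mulr_ge0_le0// mulr_ge0_le0// invr_le0 ltW.
    lra.
  apply/eqP; apply: contraT => b0.
  (* The linear term becomes -(a + 1) and the quadratic one is at most 0, so the value is at most
     -1. *)
  have := q (- (a + 1) / (2 * b)).
  have -> : 2 * b * (- (a + 1) / (2 * b)) = - (a + 1) by field.
  have : c * (- (a + 1) / (2 * b)) ^+ 2 <= 0 by rewrite mulr_le0_ge0 ?sqr_ge0.
  lra.
have := q (- b / c).
have -> : a + 2 * b * (- b / c) + c * (- b / c) ^+ 2 = a - b ^+ 2 / c.
  by field; rewrite gt_eqF.
by rewrite subr_ge0 ler_pdivrMr.
Qed.

(** The form <B u, u> is nonnegative only where [W] holds: in the spectral theorem positivity is
    known only on the orthogonal complement of the eigenvectors already found. *)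
Lemma psd_CauchySchwarz B (W : V -> Prop) x y :
  (forall u v, ip (B u) v = ip u (B v)) ->
  (forall t, W (x + t *: y)) -> (forall u, W u -> 0 <= ip (B u) u) ->
  ip (B x) y ^+ 2 <= ip (B x) x * ip (B y) y.
Proof.
move=> sB Wxy pB; apply: quadratic_discriminant => t.
have := pB _ (Wxy t).
have -> : B (x + t *: y) = B x + t *: B y by rewrite linearD linearZ.
rewrite !dotDl !dotDr !dotZl !dotZr.
rewrite (sB y x) (dotC y); lra.
Qed.

Lemma CauchySchwarz_dot x y : `|ip x y| <= enorm ip x * enorm ip y.
Proof.
rewrite -(ler_pXn2r (n := 2))// ?nnegrE ?mulr_ge0 ?enorm_ge0//.
rewrite real_normK ?num_real// exprMn !enorm_sq.
have := @psd_CauchySchwarz \1%VF (fun=> True) x y; rewrite !id_lfunE; apply => //.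
- by move=> u v; rewrite !id_lfunE.
- by move=> u _; rewrite id_lfunE dot_ge0.
Qed.

Lemma le_dot_enorm x y : ip x y <= enorm ip x * enorm ip y.
Proof. exact: le_trans (ler_norm _) (CauchySchwarz_dot x y). Qed.

Lemma enormD x y : enorm ip (x + y) <= enorm ip x + enorm ip y.
Proof.
apply: enorm_le; first by rewrite addr_ge0 ?enorm_ge0.
rewrite !dotDl !dotDr sqrrD !enorm_sq (dotC y x).
have := le_dot_enorm x y; lra.
Qed.

Lemma enorm_sum I (r : seq I) (Q : pred I) (F : I -> V) :
  enorm ip (\sum_(i <- r | Q i) F i) <= \sum_(i <- r | Q i) enorm ip (F i).
Proof.
apply: (big_rec2 (fun u c => enorm ip u <= c)); first by rewrite enorm0.
by move=> i u c _ uc; apply: le_trans (enormD _ _) _; rewrite lerD2l.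
Qed.

Lemma enormB_ge x y : enorm ip x - enorm ip y <= enorm ip (x + y).
Proof. by rewrite lerBlDr -{1}(addrK y x) -(enormN y) enormD. Qed.

Lemma enorm_le_dual x c : 0 <= c ->
  (forall y, `|ip x y| <= c * enorm ip y) -> enorm ip x <= c.
Proof.
move=> c0 xc; have [->|x0] := eqVneq x 0; first by rewrite enorm0.
rewrite -(ler_pM2r (enorm_gt0 x0)) -expr2 enorm_sq.
exact: le_trans (ler_norm _) (xc x).
Qed.

Definition orthonormal_seq (s : seq V) :=
  forall i j, (i < size s)%N -> (j < size s)%N -> ip s`_i s`_j = (i == j)%:R.

Lemma orthonormal_seq_free s : orthonormal_seq s -> free s.
Proof.
move=> os; rewrite -[s]/(tval (in_tuple s)); apply/freeP => k k0 i.
have := congr1 (ip s`_i) k0; rewrite dot0r dot_sumr (bigD1 i)//=.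
rewrite dotZr os// eqxx mulr1 big1 ?addr0// => j ji.
by rewrite dotZr os// eq_sym (negbTE ji : (j : nat) == i = false) mulr0.
Qed.

Lemma orthonormal_seq_rcons s x : orthonormal_seq s -> ip x x = 1 ->
  (forall i, (i < size s)%N -> ip s`_i x = 0) -> orthonormal_seq (rcons s x).
Proof.
move=> os x1 sx i j; rewrite size_rcons !ltnS !nth_rcons.
rewrite leq_eqVlt => /orP[/eqP ->|ri]; rewrite ?ltnn ?eqxx ?ri;
    rewrite leq_eqVlt => /orP[/eqP ->|rj]; rewrite ?ltnn ?eqxx ?rj//.
- by rewrite dotC sx// gtn_eqF.
- by rewrite sx// ltn_eqF.
- exact: os.
Qed.

Definition orthoproj (s : seq V) : 'End(V) :=
  \sum_(i < size s) tensor ip s`_i s`_i.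

Lemma orthoprojE s x : orthoproj s x = \sum_(i < size s) ip s`_i x *: s`_i.
Proof. by rewrite sum_lfunE; apply: eq_bigr => i _; rewrite tensorE. Qed.

Lemma orthoproj_ortho s x i : orthonormal_seq s -> (i < size s)%N ->
  ip s`_i (x - orthoproj s x) = 0.
Proof.
move=> os si; rewrite dotBr orthoprojE dot_sumr (bigD1 (Ordinal si))//=.
rewrite dotZr os// eqxx mulr1 big1 ?addr0 ?subrr// => j ji.
by rewrite dotZr os// eq_sym (negbTE ji : (j : nat) == i = false) mulr0.
Qed.

(** A Gram-Schmidt step: the span of [s] is too small to be the whole space, and a vector outside it
    minus its projection is normalised. *)
Lemma orthonormal_seq_extend s : orthonormal_seq s -> (size s < \dim {:V})%N ->
  exists2 x, ip x x = 1 & forall i, (i < size s)%N -> ip s`_i x = 0.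
Proof.
move=> os sn; have /subvPn[x _ xs] : ~~ ({:V} <= << s >>)%VS.
  apply/negP => /dimvS; rewrite leqNgt => /negP; apply.
  exact: leq_ltn_trans (dim_span s) sn.
have y0 : x - orthoproj s x != 0.
  apply: contra xs; rewrite subr_eq0 => /eqP ->; rewrite orthoprojE.
  by apply: memv_suml => i _; rewrite memvZ// memv_span// mem_nth.
exists ((enorm ip (x - orthoproj s x))^-1 *: (x - orthoproj s x)) => [|i si].
  by rewrite dotZl dotZr mulrA -expr2 exprVn enorm_sq mulVf// dot_eq0.
by rewrite dotZr orthoproj_ortho// mulr0.
Qed.

(** One induction serves twice: with [Q] trivial it yields an orthonormal basis, with [Q] the
    property of being an eigenvector it yields the spectral theorem. *)
Lemma orthonormal_complete (Q : V -> Prop) :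
  (forall s, orthonormal_seq s -> (forall i, (i < size s)%N -> Q s`_i) ->
    (size s < \dim {:V})%N -> exists x,
    [/\ Q x, ip x x = 1 & forall i, (i < size s)%N -> ip s`_i x = 0]) ->
  exists e : (\dim {:V}).-tuple V,
    (forall i j, ip (tnth e i) (tnth e j) = (i == j)%:R) /\
    forall i, Q (tnth e i).
Proof.
move=> step.
have H k : (k <= \dim {:V})%N -> exists s, [/\ size s = k, orthonormal_seq s &
    forall i, (i < size s)%N -> Q s`_i].
  elim: k => [|k IH] kn; first by exists [::].
  have [s [sk os Qs]] := IH (ltnW kn).
  have [|x [Qx x1 sx]] := step s os Qs; first by rewrite sk.
  exists (rcons s x); split; first by rewrite size_rcons sk.
    exact: orthonormal_seq_rcons.
  move=> i; rewrite size_rcons nth_rcons ltnS leq_eqVlt => /orP[/eqP ->|si].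
    by rewrite ltnn eqxx.
  by rewrite si; exact: Qs.
have [s [/eqP sn os Qs]] := H _ (leqnn _).
exists (Tuple sn); split => [i j|i]; rewrite !(tnth_nth 0)/=.
  by rewrite os// (eqP sn).
by apply: Qs; rewrite (eqP sn).
Qed.

End InnerProduct.

(** * The spectral theorem *)

Section OrthonormalBasis.
Context {R : realType} {V : vectType R} (ip : {dot V for idfun}).
Implicit Types (x y z : V) (A B : 'End(V)).
Local Notation n := (\dim {:V}).

Definition orthonormal_basis (e : n.-tuple V) :=
  forall i j, ip (tnth e i) (tnth e j) = (i == j)%:R.

Lemma onbP : orthonormal_basis (onb ip).
Proof.
rewrite /onb; apply: (@xgetPex _ _ [set b | orthonormal_basis b]).
have [|e [oe _]] := @orthonormal_complete _ _ ip (fun=> True).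
  move=> s os _ sn; have [x x1 sx] := orthonormal_seq_extend os sn.
  by exists x.
by exists e.
Qed.

Section Coordinates.
Variable e : n.-tuple V.
Hypothesis oe : orthonormal_basis e.

Lemma orthonormal_basis_basis : basis_of {:V} e.
Proof.
rewrite basisEfree size_tuple leqnn subvf !andbT.
apply: (@orthonormal_seq_free _ _ ip) => i j; rewrite size_tuple => ni nj.
by have := oe (Ordinal ni) (Ordinal nj); rewrite !(tnth_nth 0).
Qed.

Lemma coord_orthonormal x i : coord e i x = ip (tnth e i) x.
Proof.
rewrite {2}(coord_basis orthonormal_basis_basis (memvf x)).
rewrite dot_sumr (bigD1 i)//= big1 => [|j ji].
  by rewrite dotZr -tnth_nth oe eqxx mulr1 addr0.
by rewrite dotZr -tnth_nth oe eq_sym (negbTE ji) mulr0.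
Qed.

Lemma orthonormal_expand x : x = \sum_i ip (tnth e i) x *: tnth e i.
Proof.
rewrite [LHS](coord_basis orthonormal_basis_basis (memvf x)).
by apply: eq_bigr => i _; rewrite coord_orthonormal (tnth_nth 0).
Qed.

Lemma dot_expand x y : ip x y = \sum_i ip (tnth e i) x * ip (tnth e i) y.
Proof.
rewrite {1}(orthonormal_expand x) dot_suml.
by apply: eq_bigr => i _; rewrite dotZl.
Qed.

Lemma enorm_tnth i : enorm ip (tnth e i) = 1.
Proof. by rewrite /enorm oe eqxx sqrtr1. Qed.

End Coordinates.

Lemma linear_bounded (U : vectType R) (ipU : {dot U for idfun})
    (f : 'Hom(V, U)) :
  exists2 c : R, 0 < c & forall x, enorm ipU (f x) <= c * enorm ip x.
Proof.
pose c := \sum_(i < n) enorm ipU (f (tnth (onb ip) i)).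
have c0 : 0 <= c by apply: sumr_ge0 => i _; exact: enorm_ge0.
exists (c + 1) => [|x]; first by rewrite ltr_wpDl.
apply: (@le_trans _ _ (c * enorm ip x)); last first.
  by rewrite ler_wpM2r ?enorm_ge0// lerDl.
rewrite {1}(orthonormal_expand onbP x) linear_sum /=.
apply: le_trans (enorm_sum _ _ _ _) _; rewrite /c mulr_suml.
apply: ler_sum => i _; rewrite lfunZ enormZ mulrC ler_wpM2l ?enorm_ge0//.
by apply: le_trans (CauchySchwarz_dot _ _ _) _; rewrite (enorm_tnth onbP) mul1r.
Qed.

End OrthonormalBasis.

Section Spectral.
Context {R : realType} {V : vectType R} (ip : {dot V for idfun}).
Implicit Types (x y z : V) (A B : 'End(V)).
Local Notation n := (\dim {:V}).

Definition self_adjoint A := forall x y, ip (A x) y = ip x (A y).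

Let rayleigh A (s : seq V) : set R :=
  [set ip (A x) x | x in [set x | ip x x = 1 /\
                          forall i, (i < size s)%N -> ip s`_i x = 0]].

(* If [lam - A], with [lam] the supremum of the Rayleigh quotient on the
   orthogonal complement [W] of [s], were injective on [W] it would be bounded
   below there, so that <(lam - A) x, x> would be bounded away from 0 on unit
   vectors, contradicting the choice of [lam]. *)
Lemma next_eigenvector A s : self_adjoint A -> orthonormal_seq ip s ->
  (forall i, (i < size s)%N -> exists l, A s`_i = l *: s`_i) ->
  (size s < n)%N ->
  exists x, [/\ exists l, A x = l *: x, ip x x = 1 &
                forall i, (i < size s)%N -> ip s`_i x = 0].
Proof.
move=> sA os es sn.
have [x0 x01 sx0] := orthonormal_seq_extend os sn.
have [a a0 Aa] := linear_bounded ip ip A.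
pose W x := forall i, (i < size s)%N -> ip s`_i x = 0.
have unit_norm x : ip x x = 1 -> enorm ip x = 1.
  by move=> x1; rewrite /enorm x1 sqrtr1.
have hs : has_sup (rayleigh A s).
  split; first by exists (ip (A x0) x0), x0.
  exists a => _ [x [/unit_norm x1 _] <-].
  by apply: le_trans (le_dot_enorm _ _ _) _; rewrite x1 mulr1; have := Aa x; rewrite x1 mulr1.
pose lam := sup (rayleigh A s).
pose B : 'End(V) := lam *: \1%VF - A.
have BE x : B x = lam *: x - A x.
  by rewrite add_lfunE opp_lfunE scale_lfunE id_lfunE.
have sB : self_adjoint B.
  by move=> x y; rewrite !BE dotBl dotBr dotZl dotZr sA.
have WB x : W x -> W (B x).
  move=> Wx i si; rewrite -sB BE; have [l ->] := es i si.
  by rewrite -scalerBl dotZl Wx// mulr0.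
have pB x : W x -> 0 <= ip (B x) x.
  move=> Wx; have [->|x1] := eqVneq x 0; first by rewrite dot0r.
  have e0 := enorm_gt0 ip x1.
  have : ip (A ((enorm ip x)^-1 *: x)) ((enorm ip x)^-1 *: x) <= lam.
    apply: ub_le_sup; first exact: hs.2.
    exists ((enorm ip x)^-1 *: x) => //; split.
      by rewrite dotZl dotZr mulrA -expr2 exprVn enorm_sq mulVf// dot_eq0.
    by move=> i si; rewrite dotZr Wx// mulr0.
  rewrite lfunZ dotZl dotZr mulrA -expr2 exprVn mulrC.
  rewrite ler_pdivrMr ?exprn_gt0// enorm_sq BE dotBl dotZl subr_ge0.
  by [].
have [[x [Wx x1 Bx]]|inj] := pselect (exists x, [/\ W x, x != 0 & B x = 0]).
  exists ((enorm ip x)^-1 *: x); split.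
  - exists lam; rewrite lfunZ scalerA mulrC -scalerA; congr (_ *: _).
    by apply/esym/eqP; rewrite -subr_eq0 -BE Bx.
  - by rewrite dotZl dotZr mulrA -expr2 exprVn enorm_sq mulVf// dot_eq0.
  - by move=> i si; rewrite dotZr Wx// mulr0.
exfalso; pose P := orthoproj ip s.
(* [B'] is [B] on the complement of [s] and the identity on its span. Injectivity of [B] on the
   complement thus becomes injectivity on the whole space, and the inverse is bounded like any
   linear map. *)
pose B' : 'End(V) := (B \o (\1 - P) + P)%VF.
have B'E x : B' x = B (x - P x) + P x.
  by rewrite add_lfunE comp_lfunE add_lfunE opp_lfunE id_lfunE.
have WP x : W (x - P x) by move=> i si; exact: orthoproj_ortho.
have PW x : W x -> P x = 0.
  by move=> Wx; rewrite /P orthoprojE big1// => i _; rewrite Wx ?scale0r.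
have k0 : lker B' == 0%VS.
  apply/lker0P => x y /eqP; rewrite -subr_eq0 -lfunB => /eqP.
  have [z zE] : exists z, z = x - y by exists (x - y).
  rewrite -zE B'E => Bz.
  have Pz : P z = 0.
    rewrite /P orthoprojE big1// => i _.
    suff -> : ip s`_i z = 0 by rewrite scale0r.
    have : ip s`_i (B (z - P z) + P z) = 0 by rewrite Bz dot0r.
    rewrite dotDr WB ?add0r// => Pzi.
    by rewrite -(subrK (P z) z) dotDr WP// add0r.
  apply/eqP; rewrite -subr_eq0 -zE; apply: contraT => z0; exfalso; apply: inj.
  exists z; split => //; first by rewrite -[z]subr0 -Pz; exact: WP.
  by move: Bz; rewrite Pz subr0 addr0.
have [c c0 Bc] := linear_bounded ip ip (B'^-1)%VF.
have [b b0 Bb] := linear_bounded ip ip B.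
have low x : W x -> enorm ip x <= c * enorm ip (B x).
  move=> Wx; rewrite -{1}(lker0_lfunK k0 x) B'E PW// subr0 addr0.
  exact: Bc.
(* Cauchy-Schwarz for the form of [B], applied to x and B x: |B x|^4 <= <B x, x> <B B x, B x> <= b
   <B x, x> |B x|^2. *)
have sq x : W x -> ip (B x) (B x) <= b * ip (B x) x.
  move=> Wx; have [->|Bx] := eqVneq (B x) 0; first by rewrite !dot0l mulr0.
  have := @psd_CauchySchwarz _ _ ip B W x (B x) sB.
  have Wt t : W (x + t *: B x).
    by move=> i si; rewrite dotDr dotZr Wx// WB// mulr0 addr0.
  move=> /(_ Wt pB); rewrite expr2.
  have : ip (B (B x)) (B x) <= b * ip (B x) (B x).
    apply: le_trans (le_dot_enorm _ _ _) _; rewrite -enorm_sq expr2 mulrA.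
    by rewrite ler_wpM2r ?enorm_ge0// Bb.
  have := dot_gt0 ip Bx; move: (pB _ Wx); set p := ip _ _; set q := ip _ _.
  set w := ip _ _ => p0 q0 wq qpw.
  rewrite -(ler_pM2r q0) (le_trans qpw)// -mulrA [b * _]mulrC -mulrA ler_wpM2l//.
  by rewrite mulrC.
(* A unit x in the complement satisfies 1 <= c^2 |B x|^2 <= c^2 b <B x, x>, while the supremum
   provides one with <B x, x> below this number. *)
have d0 : 0 < (c ^+ 2 * b)^-1 by rewrite invr_gt0 mulr_gt0 ?exprn_gt0.
have [_ [x [x1 Wx] <-]] := sup_adherent d0 hs; rewrite -/lam => Ax.
have : ip (B x) x < (c ^+ 2 * b)^-1.
  by rewrite BE dotBl dotZl x1 mulr1 ltrBlDr -ltrBlDl.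
apply/negP; rewrite -leNgt -[leLHS]mul1r ler_pdivrMr ?mulr_gt0 ?exprn_gt0//.
rewrite -x1 -enorm_sq; apply: (@le_trans _ _ ((c * enorm ip (B x)) ^+ 2)).
  by rewrite ler_pXn2r ?nnegrE ?mulr_ge0 ?enorm_ge0 ?low// ltW.
rewrite exprMn enorm_sq mulrCA ler_wpM2l ?sqr_ge0//.
by rewrite mulrC sq.
Qed.

Lemma spectral A : self_adjoint A ->
  exists (e : n.-tuple V) (d : 'I_n -> R),
    orthonormal_basis ip e /\ forall i, A (tnth e i) = d i *: tnth e i.
Proof.
move=> sA.
have [|e [oe ev]] := @orthonormal_complete _ _ ip
    (fun x => exists l, A x = l *: x).
  by move=> s os es sn; exact: next_eigenvector.
by have [d dE] := choice ev; exists e, d.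
Qed.

Definition psd A := self_adjoint A /\ forall x, 0 <= ip x (A x).

Lemma psd_sqrtP A : psd A ->
  psd (psd_sqrt ip A) /\ forall x, psd_sqrt ip A (psd_sqrt ip A x) = A x.
Proof.
move=> [sA pA]; rewrite /psd_sqrt; set S := xget _ _.
suff : [set S : 'End(V) | [/\ forall x y, ip (S x) y = ip x (S y),
    forall x, 0 <= ip x (S x) & (S \o S)%VF = A]] S.
  by move=> [sS pS SS]; split => // x; rewrite -comp_lfunE SS.
apply: xgetPex; have [e [d [oe Ae]]] := spectral sA.
have d0 i : 0 <= d i.
  by have := pA (tnth e i); rewrite Ae dotZr oe eqxx mulr1.
(* The root that is diagonal in an eigenbasis; its existence is what makes the choice in [psd_sqrt]
   meaningful. *)
pose T : 'End(V) := \sum_i Num.sqrt (d i) *: tensor ip (tnth e i) (tnth e i).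
have TE x : T x = \sum_i (Num.sqrt (d i) * ip (tnth e i) x) *: tnth e i.
  by rewrite sum_lfunE; apply: eq_bigr => i _; rewrite scale_lfunE tensorE scalerA.
have Te i : T (tnth e i) = Num.sqrt (d i) *: tnth e i.
  rewrite TE (bigD1 i)//= oe eqxx mulr1 big1 ?addr0// => j ji.
  by rewrite oe (negbTE ji) mulr0 scale0r.
exists T; split => [x y|x|].
- rewrite !TE dot_suml dot_sumr; apply: eq_bigr => i _.
  by rewrite dotZl dotZr (dotC _ x); ring.
- rewrite TE dot_sumr sumr_ge0// => i _.
  by rewrite dotZr (dotC _ x) -mulrA mulr_ge0 ?sqrtr_ge0// -expr2 sqr_ge0.
- apply/lfunP => x; rewrite comp_lfunE [x](orthonormal_expand oe) !linear_sum /=.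
  apply: eq_bigr => i _; rewrite !lfunZ Te Ae lfunZ Te.
  by rewrite [X in _ *: X]scalerA -expr2 sqr_sqrtr.
Qed.

End Spectral.

(** * Operator norm, adjoint, determinant *)

Section OperatorNorm.
Context {R : realType} {V : vectType R} (ip : {dot V for idfun}).
Implicit Types (x y z : V) (A B : 'End(V)).

Let quotients A : set R :=
  [set enorm ip (A x) / enorm ip x | x in [set x | x != 0]].

Let has_ubound_quotients A : has_ubound (quotients A).
Proof.
have [c c0 Ac] := linear_bounded ip ip A.
by exists c => _ [x x0 <-]; rewrite ler_pdivrMr ?enorm_gt0.
Qed.

Lemma le_opnorm A x : enorm ip (A x) <= opnorm ip A * enorm ip x.
Proof.
have [->|x0] := eqVneq x 0; first by rewrite linear0 enorm0 mulr0.
rewrite -ler_pdivrMr ?enorm_gt0//.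
by apply: ub_le_sup; [exact: has_ubound_quotients|exists x].
Qed.

Lemma opnorm_le A c : 0 <= c ->
  (forall x, enorm ip (A x) <= c * enorm ip x) -> opnorm ip A <= c.
Proof.
(* In the zero space there are no quotients, and the supremum of the empty set is 0. *)
move=> c0 Ac; have [[a Qa]|Q0] := pselect (quotients A !=set0).
  apply: ge_sup; first by exists a.
  by move=> _ [x x0 <-]; rewrite ler_pdivrMr ?enorm_gt0.
rewrite /opnorm; move: Q0 => /set0P/negP; rewrite negbK => /eqP.
by rewrite /quotients => ->; rewrite sup0.
Qed.

Lemma opnorm_ge0 A : 0 <= opnorm ip A.
Proof.
have [[a [x x0 _]]|Q0] := pselect (quotients A !=set0).
  apply: (@le_trans _ _ (enorm ip (A x) / enorm ip x)).
    by rewrite divr_ge0 ?enorm_ge0.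
  by apply: ub_le_sup; [exact: has_ubound_quotients|exists x].
rewrite /opnorm; move: Q0 => /set0P/negP; rewrite negbK => /eqP.
by rewrite /quotients => ->; rewrite sup0.
Qed.

Lemma opnorm_le_dual A c : 0 <= c ->
  (forall x y, `|ip (A x) y| <= c * enorm ip x * enorm ip y) -> opnorm ip A <= c.
Proof.
move=> c0 Ac; apply: opnorm_le => // x; apply: enorm_le_dual => [|y] //.
by rewrite mulr_ge0 ?enorm_ge0.
Qed.

Lemma opnorm_eq0 A : opnorm ip A = 0 -> A = 0.
Proof.
move=> A0; apply/lfunP => x; apply/eqP; rewrite zero_lfunE -(enorm_eq0 ip).
by rewrite eq_le enorm_ge0 andbT (le_trans (le_opnorm A x))// A0 mul0r.
Qed.

Lemma opnorm0 : opnorm ip 0 = 0.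
Proof.
apply/eqP; rewrite eq_le opnorm_ge0 andbT; apply: opnorm_le => // x.
by rewrite zero_lfunE enorm0 mul0r.
Qed.

Lemma opnormD A B : opnorm ip (A + B) <= opnorm ip A + opnorm ip B.
Proof.
apply: opnorm_le => [|x]; first by rewrite addr_ge0 ?opnorm_ge0.
rewrite add_lfunE mulrDl (le_trans (enormD _ _ _))//.
by rewrite lerD ?le_opnorm.
Qed.

Lemma opnormZ_le a A : opnorm ip (a *: A) <= `|a| * opnorm ip A.
Proof.
apply: opnorm_le => [|x]; first by rewrite mulr_ge0 ?opnorm_ge0.
by rewrite scale_lfunE enormZ -mulrA ler_wpM2l ?le_opnorm.
Qed.

Lemma opnormN A : opnorm ip (- A) = opnorm ip A.
Proof.
apply/eqP; rewrite eq_le; apply/andP; split.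
  by have := opnormZ_le (-1) A; rewrite scaleN1r normrN1 mul1r.
by have := opnormZ_le (-1) (- A); rewrite scaleN1r opprK normrN1 mul1r.
Qed.

Lemma opnorm_comp A B : opnorm ip (A \o B)%VF <= opnorm ip A * opnorm ip B.
Proof.
apply: opnorm_le => [|x]; first by rewrite mulr_ge0 ?opnorm_ge0.
rewrite comp_lfunE (le_trans (le_opnorm A _))// -mulrA.
by rewrite ler_wpM2l ?opnorm_ge0 ?le_opnorm.
Qed.

Lemma opnorm_sum I (r : seq I) (Q : pred I) (F : I -> 'End(V)) :
  opnorm ip (\sum_(i <- r | Q i) F i) <= \sum_(i <- r | Q i) opnorm ip (F i).
Proof.
apply: (big_rec2 (fun u c => opnorm ip u <= c)); first by rewrite opnorm0.
by move=> i u c _ uc; apply: le_trans (opnormD _ _) _; rewrite lerD2l.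
Qed.

End OperatorNorm.

Section Adjoint.
Context {R : realType} {U W : vectType R}.
Variables (ipU : {dot U for idfun}) (ipW : {dot W for idfun}).

Lemma adjointP (A : 'Hom(U, W)) x y :
  ipW (A x) y = ipU x (adjoint ipU ipW A y).
Proof.
rewrite /adjoint; set B := xget _ _.
suff : [set B : 'Hom(W, U) | forall x y, ipW (A x) y = ipU x (B y)] B by exact.
apply: xgetPex; pose e := onb ipU.
exists (\sum_i tensor ipW (A (tnth e i)) (tnth e i)) => u w.
rewrite {1}(orthonormal_expand (onbP ipU) u) linear_sum /= dot_suml.
rewrite sum_lfunE dot_sumr; apply: eq_bigr => i _.
by rewrite lfunZ dotZl tensorE dotZr mulrC (dotC _ u).
Qed.

End Adjoint.

Section Determinant.
Context {R : realType} {V : vectType R} (ip : {dot V for idfun}).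

(** [lfun_det] is taken in the basis [vbasis]. The change-of-basis matrix [P] satisfies P M =
    diag(d) P and is invertible, so det P cancels. *)
Lemma lfun_det_eigenbasis (A : 'End(V)) (e : (\dim {:V}).-tuple V) d :
  orthonormal_basis ip e -> (forall i, A (tnth e i) = d i *: tnth e i) ->
  lfun_det A = \prod_i d i.
Proof.
move=> oe Ae; rewrite /lfun_det; set b := vbasis _; set M := passmx.mxof _ _ _.
have bb : basis_of {:V} b by exact: vbasisP.
have be := orthonormal_basis_basis oe.
pose P := \matrix_(i, j) coord b j (tnth e i).
pose Q := \matrix_(i, j) coord e j (tnth b i).
have PQ : P *m Q = 1%:M.
  apply/matrixP => i j; rewrite !mxE.
  transitivity (coord e j (tnth e i)); last first.
    by rewrite (coord_orthonormal oe) oe eq_sym.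
  rewrite [in RHS](coord_basis bb (memvf (tnth e i))) linear_sum /=.
  by apply: eq_bigr => k _; rewrite !mxE linearZ /= !(tnth_nth 0).
have Pu : P \in unitmx by case/mulmx1_unit : PQ.
have rowP_ i : row i P = passmx.rVof b (tnth e i).
  by apply/rowP => j; rewrite !mxE.
have PM : P *m M = diag_mx (\row_i d i) *m P.
  apply/row_matrixP => i; rewrite row_mul rowP_ passmx.mul_mxof.
  rewrite passmx.rVofK// Ae row_mul row_diag_mx -scalemxAl -rowE rowP_ !mxE.
  by apply/rowP => j; rewrite !mxE linearZ.
apply: (@mulfI _ (\det P)); first by rewrite -unitfE -unitmxE.
rewrite -det_mulmx PM det_mulmx det_diag mulrC; congr (_ * _).
by apply: eq_bigr => i _; rewrite mxE.
Qed.

End Determinant.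

Section SqrtNearScalar.
Context {R : realType} {V : vectType R} (ip : {dot V for idfun}).
Variables (s : R) (s0 : 0 < s) (S B : 'End(V)).
Hypotheses (pS : psd ip S) (SS : forall x, S (S x) = B x).
Let D : 'End(V) := S - s *: \1%VF.
Let C : 'End(V) := B - s ^+ 2 *: \1%VF.

Let DE x : D x = S x - s *: x.
Proof. by rewrite add_lfunE opp_lfunE scale_lfunE id_lfunE. Qed.

Let CE x : C x = B x - s ^+ 2 *: x.
Proof. by rewrite add_lfunE opp_lfunE scale_lfunE id_lfunE. Qed.

(** The factorisation S^2 - s^2 = (S + s)(S - s), valid since a scalar commutes with [S]. *)
Let CD x : C x = S (D x) + s *: D x.
Proof.
by rewrite CE !DE lfunB lfunZ SS scalerBr scalerA -expr2 addrA subrK.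
Qed.

(** Positivity of [S] gives <(S + s) y, y> >= s |y|^2, so S + s expands norms at least by s. *)
Lemma sqrt_near_scalar : opnorm ip D <= s^-1 * opnorm ip C.
Proof.
apply: opnorm_le => [|x]; first by rewrite mulr_ge0 ?opnorm_ge0 ?invr_ge0 ?ltW.
have -> : s^-1 * opnorm ip C * enorm ip x = s^-1 * (opnorm ip C * enorm ip x).
  by rewrite mulrA.
rewrite ler_pdivlMl//; apply: le_trans (le_opnorm ip C x).
rewrite CD; move: (D x) => y.
have [->|y0] := eqVneq y 0; first by rewrite enorm0 mulr0 enorm_ge0.
rewrite -(ler_pM2r (enorm_gt0 ip y0)).
apply: le_trans (le_dot_enorm ip _ y).
rewrite -mulrA -expr2 enorm_sq dotDl dotZl lerDr dotC.
exact: pS.2.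
Qed.

(** From (s + D)^2 = B. By the previous bound D^2 is of second order in [C], so this is the
    first-order expansion of the root. *)
Lemma sqrt_expansion : D = (2 * s)^-1 *: (C - (D \o D)%VF).
Proof.
have lE c (F G : 'End(V)) x : (c *: (F - (G \o G)%VF)) x = c *: (F x - G (G x)).
  by rewrite scale_lfunE add_lfunE opp_lfunE comp_lfunE.
apply/lfunP => x; rewrite lE.
have -> : C x - D (D x) = (2 * s) *: D x.
  rewrite CD [D (D x)]DE; set u := S _; set v := s *: _.
  by rewrite addrAC opprB addrCA subrr addr0 mulr_natl mulr2n scalerDl.
by rewrite scalerA mulVf ?scale1r// mulf_neq0// gt_eqF.
Qed.

End SqrtNearScalar.

(** * One-sided derivatives of operator-valued functions *)

Section OneSidedDerivative.
Context {R : realType} {V : vectType R} (ip : {dot V for idfun}).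
Implicit Types (T S : R -> 'End(V)) (A B : 'End(V)).

(** The base value [A] is a parameter instead of [T 0], so that [is_influence] is an instance with
    [A] the functional at the uncontaminated law. *)
Definition has_rderiv T A A' : Prop :=
  opnorm ip (e^-1 *: (T e - A) - A') @[e --> 0^'+] --> (0 : R).

(** An expansion with an error operator and a scalar bound tending to 0: in this form the calculus
    rules reduce to explicit remainders. *)
Lemma has_rderivP T A A' : has_rderiv T A A' <->
  exists (E : R -> 'End(V)) (b : R -> R),
    [/\ \forall e \near 0^'+, T e = A + e *: (A' + E e),
        \forall e \near 0^'+, opnorm ip (E e) <= b e &
        b e @[e --> 0^'+] --> (0 : R)].
Proof.
split=> [dT|[E [b [TE Eb b0]]]].
  exists (fun e => e^-1 *: (T e - A) - A').
  exists (fun e => opnorm ip (e^-1 *: (T e - A) - A')).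
  split=> //; last by near=> e.
  near=> e; have e0 : e != 0 by rewrite gt_eqF.
  by rewrite [A' + _]addrC subrK scalerA divff// scale1r addrC subrK.
apply: (@squeeze_cvgr _ _ _ _ (cst 0) b) => //; last exact: cvg_cst.
near=> e; have e0 : e != 0 by rewrite gt_eqF.
rewrite opnorm_ge0 /=; have -> : T e = A + e *: (A' + E e) by near: e.
rewrite (addrC A) addrK scalerA mulVf// scale1r (addrC A') addrK.
by near: e.
Unshelve. all: by end_near. Qed.

Lemma has_rderiv_unique T A B B' :
  has_rderiv T A B -> has_rderiv T A B' -> B = B'.
Proof.
move=> dB dB'; apply/eqP; rewrite -subr_eq0; apply/eqP/(@opnorm_eq0 _ _ ip).
apply/eqP; rewrite eq_le opnorm_ge0 andbT.
have dBB' : opnorm ip (e^-1 *: (T e - A) - B) +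
    opnorm ip (e^-1 *: (T e - A) - B') @[e --> 0^'+] --> (0 : R).
  by have := cvgD dB dB'; rewrite addr0; exact.
apply: (cvgr_to_ge dBB'). near=> e.
rewrite -[X in _ <= X + _](opnormN ip).
by apply: le_trans (opnormD _ _ _); rewrite opprB addrA subrK.
Unshelve. all: by end_near. Qed.

Lemma has_rderivD T S A A' B B' : has_rderiv T A A' -> has_rderiv S B B' ->
  has_rderiv (fun e => T e + S e) (A + B) (A' + B').
Proof.
move=> /has_rderivP[E [b [TE Eb b0]]] /has_rderivP[F [c [SF Fc c0]]].
apply/has_rderivP; exists (fun e => E e + F e), (fun e => b e + c e); split.
- near=> e; have -> : T e = A + e *: (A' + E e) by near: e.
  have -> : S e = B + e *: (B' + F e) by near: e.
  by rewrite [LHS]addrACA -!scalerDr [X in _ *: X]addrACA.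
- near=> e; apply: le_trans (opnormD _ _ _) _.
  by apply: lerD; near: e.
- by have := cvgD b0 c0; rewrite addr0; exact.
Unshelve. all: by end_near. Qed.

Lemma has_rderivZ (s : R -> R) (s0 s1 : R) A :
  e^-1 * (s e - s0) @[e --> 0^'+] --> s1 ->
  has_rderiv (fun e => s e *: A) (s0 *: A) (s1 *: A).
Proof.
move=> ds; apply/has_rderivP.
exists (fun e => (e^-1 * (s e - s0) - s1) *: A).
exists (fun e => `|e^-1 * (s e - s0) - s1| * opnorm ip A); split.
- near=> e; have e0 : e != 0 by rewrite gt_eqF.
  rewrite -scalerDl scalerA -scalerDl; congr (_ *: _).
  by field.
- by near=> e; exact: opnormZ_le.
- rewrite [X in _ --> X](_ : _ = `|s1 - s1| * opnorm ip A); last first.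
    by rewrite subrr normr0 mul0r.
  by apply: cvgMl; apply: cvg_norm; apply: cvgB => //; exact: cvg_cst.
Unshelve. all: by end_near. Qed.

Lemma cvg_id_right0 : (e : R) @[e --> 0^'+] --> (0 : R).
Proof. exact: cvg_at_right_filter. Qed.

Lemma has_rderiv_comp T S A A' B B' :
  has_rderiv T A A' -> has_rderiv S B B' ->
  has_rderiv (fun e => (T e \o S e)%VF) (A \o B)%VF ((A' \o B) + (A \o B'))%VF.
Proof.
move=> /has_rderivP[E [b [TE Eb b0]]] /has_rderivP[F [c [SF Fc c0]]].
pose N := opnorm ip; apply/has_rderivP.
exists (fun e => ((E e \o B) + (A \o F e) + e *: ((A' + E e) \o (B' + F e)))%VF).
exists (fun e => b e * N B + N A * c e + e * ((N A' + b e) * (N B' + c e))).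
split.
- near=> e; have -> : T e = A + e *: (A' + E e) by near: e.
  have -> : S e = B + e *: (B' + F e) by near: e.
  apply/lfunP => x; apply: (dot_ext (ip := ip)) => z.
  rewrite !(comp_lfunE, add_lfunE, scale_lfunE, lfunD, lfunZ).
  by rewrite !(dotDl, dotZl); ring.
- near=> e; have e0 : 0 <= e by rewrite ltW.
  have Ee : opnorm ip (E e) <= b e by near: e.
  have Fe : opnorm ip (F e) <= c e by near: e.
  apply: le_trans (opnormD _ _ _) _; apply: lerD.
    apply: le_trans (opnormD _ _ _) _; apply: lerD.
      by apply: le_trans (opnorm_comp _ _ _) _; rewrite ler_wpM2r ?opnorm_ge0.
    by apply: le_trans (opnorm_comp _ _ _) _; rewrite ler_wpM2l ?opnorm_ge0.
  apply: le_trans (opnormZ_le _ _ _) _; rewrite ger0_norm// ler_wpM2l//.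
  apply: le_trans (opnorm_comp _ _ _) _; rewrite ler_pM ?opnorm_ge0//.
    by apply: le_trans (opnormD _ _ _) _; rewrite lerD2l.
  by apply: le_trans (opnormD _ _ _) _; rewrite lerD2l.
- rewrite [X in _ --> X](_ : _ = 0 * N B + N A * 0 +
    0 * ((N A' + 0) * (N B' + 0))); last by rewrite mul0r mulr0 mul0r !addr0.
  apply: cvgD; [apply: cvgD; [exact: cvgMl|exact: cvgMr]|].
  apply: cvgM; first exact: cvg_id_right0.
  by apply: cvgM; apply: cvgD => //; exact: cvg_cst.
Unshelve. all: by end_near. Qed.

(** [S e] may be any positive root of [T e]. Since D = S e - s is O(e) by [sqrt_near_scalar], the
    term D^2 / e left by [sqrt_expansion] tends to 0. *)
Lemma has_rderiv_sqrt T S s A' : 0 < s ->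
  (\forall e \near 0^'+, psd ip (S e) /\ forall x, S e (S e x) = T e x) ->
  has_rderiv T (s ^+ 2 *: \1%VF) A' ->
  has_rderiv S (s *: \1%VF) ((2 * s)^-1 *: A').
Proof.
move=> s0 SST /has_rderivP[E [b [TE Eb b0]]].
pose N := opnorm ip; apply/has_rderivP.
pose D e : 'End(V) := S e - s *: \1%VF.
exists (fun e => (2 * s)^-1 *: (E e - e^-1 *: (D e \o D e)%VF)).
exists (fun e => (2 * s)^-1 * (b e + e * (s^-1 * (N A' + b e)) ^+ 2)); split.
- near=> e; have e0 : e != 0 by rewrite gt_eqF.
  have [pS SS] : psd ip (S e) /\ forall x, S e (S e x) = T e x by near: e.
  have := sqrt_expansion s0 SS.
  have -> : T e = s ^+ 2 *: \1%VF + e *: (A' + E e) by near: e.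
  rewrite [X in _ *: (X - _)](addrC) addKr => DE.
  rewrite -[LHS](subrK (s *: \1%VF)) addrC; congr (_ + _).
  rewrite DE -/(D e) -scalerDr scalerA [e * _]mulrC -scalerA.
  by congr (_ *: _); rewrite addrA scalerBr scalerA divff// scale1r.
- near=> e; have e0 : 0 < e by [].
  have [pS SS] : psd ip (S e) /\ forall x, S e (S e x) = T e x by near: e.
  have Ee : opnorm ip (E e) <= b e by near: e.
  have De : opnorm ip (D e) <= e * (s^-1 * (N A' + b e)).
    have := sqrt_near_scalar s0 pS SS.
    have -> : T e = s ^+ 2 *: \1%VF + e *: (A' + E e) by near: e.
    rewrite [X in _ * opnorm _ X](addrC) addKr => /le_trans; apply.
    rewrite mulrCA ler_wpM2l ?invr_ge0 ?(ltW s0)//.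
    apply: le_trans (opnormZ_le _ _ _) _; rewrite gtr0_norm// ler_pM2l//.
    by apply: le_trans (opnormD _ _ _) _; rewrite lerD2l.
  apply: le_trans (opnormZ_le _ _ _) _; rewrite ger0_norm; last first.
    by rewrite invr_ge0 mulr_ge0 ?ltW.
  rewrite ler_wpM2l//; first by rewrite invr_ge0 mulr_ge0 ?ltW.
  apply: le_trans (opnormD _ _ _) _; rewrite opnormN lerD//.
  apply: le_trans (opnormZ_le _ _ _) _; rewrite gtr0_norm ?invr_gt0//.
  rewrite ler_pdivrMl//; apply: le_trans (opnorm_comp _ _ _) _.
  set c := s^-1 * _ in De *.
  have -> : e * (e * c ^+ 2) = (e * c) * (e * c) by ring.
  by rewrite ler_pM ?opnorm_ge0.
- rewrite [X in _ --> X](_ : _ =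
    (2 * s)^-1 * (0 + 0 * (s^-1 * (N A' + 0)) ^+ 2)); last first.
    by rewrite mul0r addr0 mulr0.
  apply: cvgMr; apply: cvgD => //; apply: cvgM; first exact: cvg_id_right0.
  rewrite expr2; under eq_fun do rewrite expr2.
  by apply: cvgM; apply: cvgMr; apply: cvgD => //; exact: cvg_cst.
Unshelve. all: by end_near. Qed.

(** The inverse of an [lfun] is a generalized one, so injectivity near 0 comes first; the derivative
    then follows from a second-order resolvent expansion. *)
Lemma has_rderiv_inv T s A' : 0 < s -> has_rderiv T (s *: \1%VF) A' ->
  has_rderiv (fun e => (T e)^-1%VF) (s^-1 *: \1%VF) (- s ^- 2 *: A').
Proof.
move=> s0 /has_rderivP[E [b [TE Eb b0]]].
pose N := opnorm ip; apply/has_rderivP; pose G e := ((T e)^-1)%VF.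
(* The perturbation takes away less than half of s, so |T e x| >= (s / 2) |x| and the inverse has
   norm at most 2 / s. *)
have small : \forall e \near 0^'+, e * (N A' + b e) < s / 2.
  have : e * (N A' + b e) @[e --> 0^'+] --> 0 * (N A' + 0).
    apply: cvgM; first exact: cvg_id_right0.
    by apply: cvgD => //; exact: cvg_cst.
  by rewrite mul0r => /cvgr_lt; apply; rewrite divr_gt0.
have k : \forall e \near 0^'+, [/\ forall x, T e (G e x) = x,
    forall x, G e (T e x) = x & opnorm ip (G e) <= 2 / s].
  near=> e; have e0 : 0 < e by [].
  have Tlow x : s / 2 * enorm ip x <= enorm ip (T e x).
    have -> : T e = s *: \1%VF + e *: (A' + E e) by near: e.
    rewrite add_lfunE 2!scale_lfunE id_lfunE.
    apply: le_trans (enormB_ge ip _ _); rewrite !enormZ !gtr0_norm//.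
    have : e * enorm ip ((A' + E e) x) <= s / 2 * enorm ip x.
      apply: (@le_trans _ _ (e * (N A' + b e) * enorm ip x)); last first.
        by rewrite ler_wpM2r ?enorm_ge0// ltW//; near: e.
      rewrite -mulrA ler_pM2l//; apply: le_trans (le_opnorm _ _ _) _.
      rewrite ler_wpM2r ?enorm_ge0//; apply: le_trans (opnormD _ _ _) _.
      by rewrite lerD2l; near: e.
    by set p := e * _; have := enorm_ge0 ip x; lra.
  have k0 : lker (T e) == 0%VS.
    apply/lker0P => x y /eqP; rewrite -subr_eq0 -lfunB => /eqP Txy.
    apply/eqP; rewrite -subr_eq0 -(enorm_eq0 ip) eq_le enorm_ge0 andbT.
    have := Tlow (x - y); rewrite Txy enorm0 pmulr_rle0//.
    by rewrite divr_gt0.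
  split=> [x|x|]; [exact: lker0_lfunVK|exact: lker0_lfunK|].
  apply: opnorm_le => [|x]; first by rewrite divr_ge0 ?ltW.
  rewrite -[2 / s]invf_div ler_pdivlMl ?divr_gt0//.
  by apply: le_trans (Tlow _) _; rewrite lker0_lfunVK.
(* With Y = A' + E e, the identity G = s^-1 (1 - e G Y) used twice gives G = s^-1 - e s^-2 Y + e^2
   s^-2 G Y^2. *)
exists (fun e => - s ^- 2 *: E e + (e * s ^- 2) *:
  (G e \o ((A' + E e) \o (A' + E e)))%VF).
exists (fun e => s ^- 2 * b e + e * s ^- 2 * (2 / s * (N A' + b e) ^+ 2)); split.
- near=> e; have e0 : 0 < e by [].
  have [TG GT _] : [/\ forall x, T e (G e x) = x,
    forall x, G e (T e x) = x & opnorm ip (G e) <= 2 / s] by near: e.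
  have TEe : T e = s *: \1%VF + e *: (A' + E e) by near: e.
  have Gx y : G e y = s^-1 *: (y - e *: G e ((A' + E e) y)).
    have Ty : T e y = s *: y + e *: (A' + E e) y.
      by rewrite TEe [LHS]add_lfunE !scale_lfunE id_lfunE.
    rewrite -{2}(GT y) Ty lfunD !lfunZ.
    by rewrite addrK scalerA mulVf ?scale1r// gt_eqF.
  apply/lfunP => x; rewrite -/(G e) Gx (Gx ((A' + E e) x)).
  apply: (dot_ext (ip := ip)) => z.
  rewrite !(comp_lfunE, add_lfunE, scale_lfunE, id_lfunE).
  rewrite !(dotDl, dotNl, dotZl).
  by field; rewrite gt_eqF.
- near=> e; have e0 : 0 < e by [].
  have [_ _ Ge] : [/\ forall x, T e (G e x) = x,
    forall x, G e (T e x) = x & opnorm ip (G e) <= 2 / s] by near: e.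
  have Ee : opnorm ip (E e) <= b e by near: e.
  have s2 : 0 < s ^- 2 by rewrite invr_gt0 exprn_gt0.
  have AE : opnorm ip (A' + E e) <= N A' + b e.
    by apply: le_trans (opnormD _ _ _) _; rewrite lerD2l.
  apply: le_trans (opnormD _ _ _) _; apply: lerD.
    by apply: le_trans (opnormZ_le _ _ _) _; rewrite normrN gtr0_norm// ler_pM2l.
  apply: le_trans (opnormZ_le _ _ _) _; rewrite gtr0_norm ?mulr_gt0//.
  rewrite ler_pM2l ?mulr_gt0//; apply: le_trans (opnorm_comp _ _ _) _.
  rewrite ler_pM ?opnorm_ge0//; apply: le_trans (opnorm_comp _ _ _) _.
  by rewrite expr2 ler_pM ?opnorm_ge0.
- rewrite [X in _ --> X](_ : _ =
    s ^- 2 * 0 + 0 * s ^- 2 * (2 / s * (N A' + 0) ^+ 2)); last first.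
    by rewrite mulr0 !mul0r addr0.
  apply: cvgD; first exact: cvgMr.
  apply: cvgM; first by apply: cvgMl; exact: cvg_id_right0.
  apply: cvgMr; rewrite expr2; under eq_fun do rewrite expr2.
  by apply: cvgM; apply: cvgD => //; exact: cvg_cst.
Unshelve. all: by end_near. Qed.

End OneSidedDerivative.

(** * Densities and changes of variables on the line *)

Section DensityMeasure.
Local Open Scope ereal_scope.
Context d (T : measurableType d) (R : realType).
Variables (mu : {measure set T -> \bar R}) (f : T -> R).
Hypotheses (mf : measurable_fun setT f) (f0 : forall x, (0 <= f x)%R).

Let nu A := \int[mu]_(x in A) (f x)%:E.

Let nu0 : nu set0 = 0. Proof. exact: integral_set0. Qed.

Let nu_ge0 A : 0 <= nu A.
Proof. by apply: integral_ge0 => x _; rewrite lee_fin. Qed.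

Let nu_sigma : semi_sigma_additive nu.
Proof.
apply: semi_sigma_additive_nng_induced; first exact/measurable_EFinP.
by move=> x; rewrite lee_fin.
Qed.

Lemma exists_density_measure : exists nu' : {measure set T -> \bar R},
  forall A, nu' A = \int[mu]_(x in A) (f x)%:E.
Proof.
pose m : {measure set T -> \bar R} :=
  HB.pack nu (isMeasure.Build d T R nu nu0 nu_ge0 nu_sigma).
by exists m.
Qed.

End DensityMeasure.

Section Density.
Local Open Scope ereal_scope.
Context d (T : measurableType d) (R : realType).
Variables (mu nu : {measure set T -> \bar R}) (f : T -> R).
Hypotheses (mf : measurable_fun setT f) (f0 : forall x, (0 <= f x)%R).
Hypothesis nuE : forall A, measurable A -> nu A = \int[mu]_(x in A) (f x)%:E.
Implicit Types g : T -> \bar R.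

Import HBNNSimple.

Let mfE : measurable_fun setT (EFin \o f). Proof. exact/measurable_EFinP. Qed.

Let integral_density_nnsfun (g : {nnsfun T >-> R}) :
  \int[nu]_x (g x)%:E = \int[mu]_x ((f x)%:E * (g x)%:E).
Proof.
under [LHS]eq_integral do rewrite fimfunE -fsumEFin//.
rewrite [LHS]ge0_integral_fsum//; last 2 first.
  - by move=> r; exact/measurable_EFinP/measurableT_comp.
  - by move=> r x _; rewrite EFinM nnfun_muleindic_ge0.
under [RHS]eq_integral.
  move=> x xD; rewrite fimfunE -fsumEFin// ge0_mule_fsumr; last first.
    by move=> r; rewrite EFinM nnfun_muleindic_ge0.
  over.
rewrite [RHS]ge0_integral_fsum//; last 2 first.
  - move=> r; apply: emeasurable_funM => //.
    by apply/measurable_EFinP; exact: measurableT_comp.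
  - move=> r x _; rewrite mule_ge0//; first by rewrite lee_fin.
    by rewrite EFinM nnfun_muleindic_ge0.
apply: eq_fsbigr => r _; rewrite integralZl_indic_nnsfun//= integral_indic//.
rewrite setIT nuE//; under [RHS]eq_integral do rewrite EFinM muleCA.
rewrite integral_mkcond.
have [r0|r0] := leP 0%R r; last first.
  rewrite preimage_nnfun0// patch_set0 integral0 mule0.
  by under eq_integral do rewrite indicE in_set0 mule0 mule0; rewrite integral0.
rewrite ge0_integralZl//; last 2 first.
  - apply: emeasurable_funM => //; exact/measurable_EFinP.
  - by move=> x _; rewrite mule_ge0// lee_fin.
congr (_ * _); apply: eq_integral => x _; rewrite patchE indicE.
by case: ifPn => _; rewrite ?mule1 ?mule0.
Qed.

(** Simple functions first, then monotone convergence. The formula for [nu] is asked on measurable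
    sets only, which is the form in which [elliptical_density] provides it. *)
Lemma integral_density g : measurable_fun setT g -> (forall x, 0 <= g x) ->
  \int[nu]_x g x = \int[mu]_x ((f x)%:E * g x).
Proof.
move=> mg g0; pose g_ := nnsfun_approx measurableT mg.
have g_cvg x : EFin \o g_ ^~ x @ \oo --> g x by exact: cvg_nnsfun_approx.
have nd x : {homo (fun n => (g_ n x)%:E) : n m / (n <= m)%N >-> n <= m}.
  by move=> a b ab; rewrite lee_fin; exact/lefP/nd_nnsfun_approx.
transitivity (limn (fun n => \int[nu]_x (g_ n x)%:E)).
  rewrite -monotone_convergence//=.
  - by apply: eq_integral => x _; apply/esym/cvg_lim => //; exact: g_cvg.
  - by move=> n; exact/measurable_EFinP.
  - by move=> n x _; rewrite lee_fin.
transitivity (limn (fun n => \int[mu]_x ((f x)%:E * (g_ n x)%:E))).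
  by congr (limn _); apply/funext => n; exact: integral_density_nnsfun.
rewrite -monotone_convergence//=.
- apply: eq_integral => x _; apply/cvg_lim => //.
  by apply: cvgeZl => //; exact: g_cvg.
- by move=> n; apply: emeasurable_funM => //; exact/measurable_EFinP.
- by move=> n x _; rewrite mule_ge0// lee_fin.
- by move=> x _ a b ab; rewrite lee_wpmul2l ?lee_fin//; exact/nd.
Qed.

End Density.

Section AffineLine.
Context {R : realType}.
Local Notation mR := (measurableTypeR R).
Local Notation leb := (@lebesgue_measure R).

Let affine (c a x : mR) : mR := c * x + a.

Let measurable_affine c a : measurable_fun setT (affine c a).
Proof. by apply: measurable_funD => //; exact: measurable_funM. Qed.

(** The left side integrates [f] against |c| times the image of Lebesgue measure, a measure that
    gives every half-open interval its length. *)
Lemma integral_affine (c a : R) (f : mR -> \bar R) : c != 0 ->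
  measurable_fun setT f -> (forall x, 0 <= f x)%E ->
  (`|c|%:E * \int[leb]_x f (c * x + a)%R = \int[leb]_x f x)%E.
Proof.
move=> c0 mf f0; pose k : {nonneg R} := NngNum (normr_ge0 c).
have mA := measurable_affine c a.
pose pf : {measure set mR -> \bar R} :=
  measure_function_pushforward__canonical__measure_function_Measure leb mA.
pose mu : {measure set mR -> \bar R} := mscale k pf.
transitivity (\int[mu]_x f x)%E.
  rewrite ge0_integral_mscale//; congr (_ * _)%E.
  by rewrite ge0_integral_pushforward//= ?preimage_setT.
apply: eq_measure_integral => A mmA _; apply/esym.
apply: lebesgue_measure_unique => // X /ocitvP[->|[[u v]/= uv ->]].
  by rewrite !measure0.
rewrite lebesgue_measure_itv /= lte_fin uv /mscale /= /pushforward.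
(* A negative slope exchanges the end points, so the preimage of an interval open on the left is
   open on the right. *)
have [cp|cn|/eqP] := ltgtP c 0; last by rewrite (negbTE c0).
- rewrite (_ : _ @^-1` _ = `[(v - a) / c, (u - a) / c[%classic); last first.
    apply/seteqP; split => x /=; rewrite !in_itv /= /affine.
      move=> /andP[ux xv]; rewrite ler_ndivrMr// ltr_ndivlMr//.
      by rewrite (mulrC x) ltrBlDr lerBrDr ux xv.
    rewrite ler_ndivrMr// ltr_ndivlMr// (mulrC x) ltrBlDr lerBrDr.
    by move=> /andP[-> ->].
  rewrite lebesgue_measure_itv /= lte_fin ltr_nM2r ?invr_lt0// ltrD2r uv.
  by rewrite -!EFinD -EFinM ltr0_norm//; congr EFin; field.
- rewrite (_ : _ @^-1` _ = `](u - a) / c, (v - a) / c]%classic); last first.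
    apply/seteqP; split => x /=; rewrite !in_itv /= /affine.
      move=> /andP[ux xv]; rewrite ltr_pdivrMr// ler_pdivlMr//.
      by rewrite (mulrC x) ltrBlDr lerBrDr ux xv.
    rewrite ltr_pdivrMr// ler_pdivlMr// (mulrC x) ltrBlDr lerBrDr.
    by move=> /andP[-> ->].
  rewrite lebesgue_measure_itv /= lte_fin ltr_pM2r ?invr_gt0// ltrD2r uv.
  by rewrite -!EFinD -EFinM gtr0_norm//; congr EFin; field.
Qed.

End AffineLine.

Section FundamentalTheorem.
Context {R : realType}.

Lemma integral_is_derive (F f : R -> R) (a b : R) : a < b ->
  (forall x, is_derive x (1 : R) F (f x)) -> continuous f ->
  (\int[lebesgue_measure]_(x in `[a, b]) (f x)%:E = (F b - F a)%:E)%E.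
Proof.
move=> ab dF cf; rewrite EFinB.
have cF x : {for x, continuous F}.
  by apply: differentiable_continuous; apply/derivable1_diffP; case: (dF x).
apply: continuous_FTC2 => //.
- exact: continuous_subspaceT.
- split; first by move=> x _; case: (dF x).
  + by apply: cvg_at_right_filter; exact: cF.
  + by apply: cvg_at_left_filter; exact: cF.
- by move=> x _; rewrite derive1E; case: (dF x).
Qed.

End FundamentalTheorem.

Section RadialPushforward.
Local Open Scope ereal_scope.
Context d (T : measurableType d) (R : realType).
Variables (mu : {measure set T -> \bar R}) (N : T -> R) (C : R) (m : nat).
Hypotheses (mN : measurable_fun setT N) (N0 : forall x, (0 <= N x)%R).
Hypotheses (C0 : (0 <= C)%R) (m0 : (0 < m)%N).
Hypothesis cdf : forall s : R, (0 <= s)%R ->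
  mu [set x | (N x <= s)%R] = (C * s ^+ m)%:E.
Local Notation mR := (measurableTypeR R).
Local Notation leb := (@lebesgue_measure R).

(** The derivative of C t^m, cut off on the negative half-line to be nonnegative everywhere. *)
Let w (t : mR) : R := ((0 <= t)%R%:R * (C * m%:R * t ^+ m.-1))%R.

Let w0 t : (0 <= w t)%R.
Proof.
rewrite /w; have [t0|_] := leP 0%R t; last by rewrite mul0r.
by rewrite mul1r !mulr_ge0// ?exprn_ge0.
Qed.

Let mw : measurable_fun setT w.
Proof.
apply: measurable_funM.
  apply: (@measurable_comp _ _ _ _ _ _ setT (fun b : bool => b%:R : R)) => //.
  by apply: measurable_fun_ler => //; exact: measurable_cst.
by apply: measurable_funM => //; exact: measurable_funX.
Qed.

Let integral_w s : (0 <= s)%R ->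
  \int[leb]_(t in `[0%R, s]) (w t)%:E = (C * s ^+ m)%:E.
Proof.
rewrite le_eqVlt => /predU1P[<-|s0].
  by rewrite set_itv1 integral_set1 expr0n eqn0Ngt m0 mulr0.
rewrite (@eq_integral _ _ _ leb _ (fun t => (C * m%:R * t ^+ m.-1)%:E)); last first.
  by move=> t; rewrite inE /= in_itv /= => /andP[t0 _]; rewrite /w t0 mul1r.
have dF (x : R) : is_derive x (1%R : R) (fun t : R => C * t ^+ m)%R
    (C * m%:R * x ^+ m.-1)%R.
  have dX : is_derive x (1%R : R) (fun t : R => t ^+ m)%R (m%:R * x ^+ m.-1)%R.
    have := is_deriveX m (is_derive_id x (1%R : R)).
    rewrite /GRing.scale /= mulr1 (_ : (id ^+ m)%R = (fun t : R => t ^+ m)%R)//.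
    by rewrite exprfctE.
  have := is_deriveZ C dX.
  by rewrite /GRing.scale /= mulrA.
have := integral_is_derive s0 dF.
rewrite expr0n eqn0Ngt m0 mulr0 subr0; apply.
move=> x; apply: cvgM; first exact: cvg_cst.
exact: exprn_continuous.
Qed.

(** The law of [N] has distribution function C s^m, hence density C m t^(m-1), because half-lines
    determine a measure. With [N] the Euclidean norm this is polar integration; with [N] the square
    root on the half-line it is the substitution t = u^2. *)
Lemma integral_radial (phi : R -> \bar R) : measurable_fun setT phi ->
  (forall t, 0 <= phi t) ->
  \int[mu]_x phi (N x) =
  \int[leb]_(t in `[0%R, +oo[) ((C * m%:R * t ^+ m.-1)%:E * phi t).
Proof.
move=> mphi phi0.
have [nu nuE] := exists_density_measure leb mw w0.
have mN' : measurable_fun setT (N : T -> mR) by exact: mN.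
pose rho : {measure set mR -> \bar R} :=
  measure_function_pushforward__canonical__measure_function_Measure mu mN'.
transitivity (\int[rho]_t phi t).
  by rewrite [RHS]ge0_integral_pushforward//= ?preimage_setT.
transitivity (\int[nu]_t phi t).
  apply: eq_measure_integral => A mA _.
  pose G : set (set mR) := [set B | exists s : R, B = `]-oo, s]%classic].
  have mG : measurable = <<s G >>.
    rewrite [LHS](RGenOInfty.measurableE R); apply/seteqP; split.
      apply: smallest_sub; first exact: smallest_sigma_algebra.
      move=> _ [x ->]; rewrite -setCitvl.
      apply: sigma_algebraC; apply: sub_sigma_algebra; by exists x.
    apply: smallest_sub; first exact: smallest_sigma_algebra.
    move=> _ [x ->]; rewrite -setCitvr.
    by apply: sigma_algebraC; apply: sub_sigma_algebra; exists x.
  have rhoE s : rho `]-oo, s]%classic =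
      if (0 <= s)%R then (C * s ^+ m)%:E else 0.
    rewrite /rho /= /pushforward (_ : _ @^-1` _ = [set x | (N x <= s)%R]); last first.
      by apply/seteqP; split => x /=; rewrite in_itv.
    case: ifPn => s0; first exact: cdf.
    rewrite (_ : [set x | _] = set0) ?measure0// -subset0 => x /= Nxs.
    by move: s0; rewrite (le_trans (N0 x)).
  apply: (measure_unique G (fun k => `]-oo, k%:R]%classic)) => //.
  - move=> _ _ [a ->] [b ->]; exists (Num.min a b).
    by apply/seteqP; split=> x /=; rewrite !in_itv /= le_min => /andP.
  - by move=> k; exists k%:R.
  - apply/seteqP; split => // x _; exists (Num.truncn `|x|).+1 => //=.
    by rewrite in_itv /= (le_trans (ler_norm x))// ltW// truncnS_gt.
  - move=> _ [s ->]; rewrite rhoE nuE; case: ifPn => s0.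
      rewrite -integral_w// [LHS]integral_mkcond [RHS]integral_mkcond.
      apply: eq_integral => t _; rewrite !patchE !mem_setE !in_itv /= /w.
      by case: (0 <= t)%R; rewrite //= mul0r; case: ifP.
    rewrite [RHS]integral0_eq// => t; rewrite /= in_itv /= /w => ts.
    have /negbTE -> : ~~ (0 <= t)%R by apply: contra s0 => /le_trans; apply.
    by rewrite mul0r.
  - by move=> k; rewrite rhoE; case: ifP => _; rewrite ltry.
rewrite (@integral_density _ _ _ leb nu w)//.
rewrite [RHS]integral_mkcond; apply: eq_integral => t _; rewrite patchE.
rewrite mem_setE in_itv /= andbT /w.
by case: (0 <= t)%R; rewrite ?mul1r// mul0r mul0e.
Qed.

End RadialPushforward.

(** * Lebesgue measure on tuples *)

Section LebesgueTupleIntegral.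
Context {R : realType}.
Local Notation mR := (measurableTypeR R).
Local Notation leb := (@lebesgue_measure R).
Local Notation lam := (@lebesgue_tuple R).

Lemma measurable_mktuple d (T : measurableType d) n (g : 'I_n -> T -> mR) :
  (forall i, measurable_fun setT (g i)) ->
  measurable_fun setT (fun x => [tuple g i x | i < n]).
Proof.
move=> mg; apply/measurable_fun_tnthP => i.
by rewrite (_ : _ \o _ = g i)//; apply/funext => x /=; rewrite tnth_mktuple.
Qed.

Lemma measurable_fun_tnth d (T : measurableType d) n (f : T -> n.-tuple mR) i :
  measurable_fun setT f -> measurable_fun setT (fun x => tnth (f x) i).
Proof. by move/measurable_fun_tnthP; exact. Qed.

Lemma integral_tuple0 (f : 0.-tuple mR -> \bar R) :
  measurable_fun setT f -> (\int[lam 0]_t f t = f [tuple])%E.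
Proof.
by move=> mf; rewrite /= integral_dirac// diracT mul1e.
Qed.

Lemma integral_tupleS n (f : n.+1.-tuple mR -> \bar R) :
  measurable_fun setT f -> (forall t, 0 <= f t)%E ->
  (\int[lam n.+1]_t f t = \int[leb]_x \int[lam n]_t f (tcons (x, t)))%E.
Proof.
move=> mf f0.
transitivity (\int[pushforward (leb \x lam n)%E (@tcons R n)]_t f t)%E => //.
rewrite ge0_integral_pushforward//=; last exact: measurable_tcons.
rewrite preimage_setT fubini_tonelli1//=.
by apply: measurableT_comp => //; exact: measurable_tcons.
Qed.

Definition taffine n (c a : 'I_n -> R) (t : n.-tuple mR) : n.-tuple mR :=
  [tuple c i * tnth t i + a i | i < n].

Lemma measurable_taffine n (c a : 'I_n -> R) : measurable_fun setT (taffine c a).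
Proof.
apply: measurable_mktuple => i; apply: measurable_funD => //.
by apply: measurable_funM => //; exact: measurable_tnth.
Qed.

Lemma taffine_tcons n (c a : 'I_n.+1 -> R) x (t : n.-tuple mR) :
  taffine c a (tcons (x, t)) =
  tcons (c ord0 * x + a ord0, taffine (c \o lift ord0) (a \o lift ord0) t).
Proof.
apply: eq_from_tnth => i; rewrite tnth_mktuple.
case: (unliftP ord0 i) => [j ->|->]; last by [].
by rewrite !tnthS tnth_mktuple.
Qed.

(** Tonelli peels off the first coordinate: the one-dimensional formula treats it and the induction
    hypothesis treats the inner integral. *)
Lemma integral_taffine n (c a : 'I_n -> R) (f : n.-tuple mR -> \bar R) :
  (forall i, c i != 0) -> measurable_fun setT f -> (forall t, 0 <= f t)%E ->
  ((\prod_i `|c i|)%:E * \int[lam n]_t f (taffine c a t) = \int[lam n]_t f t)%E.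
Proof.
elim: n c a f => [|n IH] c a f c0 mf f0.
  rewrite big_ord0 mul1e !integral_tuple0//.
    by congr f; exact: tuple0.
  by apply: measurableT_comp => //; exact: measurable_taffine.
have mfa : measurable_fun setT (f \o taffine c a).
  by apply: measurableT_comp => //; exact: measurable_taffine.
have mfx x : measurable_fun setT (fun t : n.-tuple mR => f (tcons (x, t))).
  apply: measurableT_comp => //.
  by apply: measurableT_comp; [exact: measurable_tcons|exact: measurable_pair1].
pose c' := c \o lift ord0; pose a' := a \o lift ord0.
rewrite big_ord_recl EFinM -muleA.
pose G x : \bar R := (\int[lam n]_t f (tcons (x, t)))%E.
pose G' x : \bar R := (\int[lam n]_t f (tcons (x, taffine c' a' t)))%E.
have GG' x : ((\prod_i `|c' i|)%:E * G' x = G x)%E.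
  by rewrite /G' /G; apply: (IH c' a' (fun t => f (tcons (x, t)))) => // i; exact: c0.
have mG' : measurable_fun setT G'.
  pose k (p : mR * n.-tuple mR) := f (tcons (p.1, taffine c' a' p.2)).
  apply: (@measurable_fun_fubini_tonelli_F _ _ _ _ _ (lam n) k).
    apply: measurableT_comp => //.
    apply: measurableT_comp; first exact: measurable_tcons.
    apply: measurable_fun_pair => //.
    by apply: measurableT_comp => //; exact: measurable_taffine.
  by move=> x; exact: f0.
have G'0 x : (0 <= G' x)%E by apply: integral_ge0 => t _; exact: f0.
have -> : (\int[lam n.+1]_t f (taffine c a t) =
    \int[leb]_x G' (c ord0 * x + a ord0)%R)%E.
  rewrite (integral_tupleS mfa); last by move=> t; exact: f0.
  apply: eq_integral => x _; apply: eq_integral => t _.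
  by congr f; exact: taffine_tcons.
rewrite muleCA integral_affine//.
rewrite -ge0_integralZl//; last by rewrite lee_fin prodr_ge0.
rewrite [RHS]integral_tupleS//.
by apply: eq_integral => x _; exact: GG'.
Qed.

Definition tnorm n (t : n.-tuple mR) : R := Num.sqrt (\sum_i tnth t i ^+ 2).

Lemma tnorm_ge0 n (t : n.-tuple mR) : 0 <= tnorm t. Proof. exact: sqrtr_ge0. Qed.

Lemma tnorm_sq n (t : n.-tuple mR) : tnorm t ^+ 2 = \sum_i tnth t i ^+ 2.
Proof. by rewrite sqr_sqrtr// sumr_ge0// => i _; exact: sqr_ge0. Qed.

Lemma measurable_tnorm n : measurable_fun setT (@tnorm n).
Proof.
apply: (@measurableT_comp _ _ _ _ _ _ (fun x : R => Num.sqrt x)).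
  by apply: continuous_measurable_fun; exact: sqrt_continuous.
apply: measurable_sum => i.
by apply: measurable_funX; exact: measurable_tnth.
Qed.

Lemma measurable_gauss_tnorm n :
  measurable_fun setT (fun t : n.-tuple mR => gauss_fun (tnorm t)).
Proof.
apply: (@measurableT_comp _ _ _ _ _ _ (@gauss_fun R)).
  exact: measurable_gauss_fun.
exact: measurable_tnorm.
Qed.

Lemma tnorm_sq_tcons n x (t : n.-tuple mR) :
  tnorm (tcons (x, t)) ^+ 2 = x ^+ 2 + tnorm t ^+ 2.
Proof.
by rewrite !tnorm_sq big_ord_recl /=; congr (_ + _); apply: eq_bigr => i _; rewrite tnthS.
Qed.

(** [gauss_fun] is exp(-x^2), so at the norm it is a product over the coordinates, each of which
    contributes sqrt(pi). *)
Lemma integral_gauss_tnorm n :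
  (\int[lam n]_t (gauss_fun (tnorm t))%:E = (Num.sqrt pi ^+ n)%:E)%E.
Proof.
have mg k : measurable_fun setT (fun t : k.-tuple mR => (gauss_fun (tnorm t))%:E).
  by apply/measurable_EFinP; exact: measurable_gauss_tnorm.
elim: n => [|n IH].
  rewrite integral_tuple0//.
  by rewrite /gauss_fun tnorm_sq big_ord0 oppr0 expR0.
rewrite integral_tupleS//; last by move=> t; rewrite lee_fin gauss_fun_ge0.
have gE x (t : n.-tuple mR) : (gauss_fun (tnorm (tcons (x, t))))%:E =
    ((gauss_fun x)%:E * (gauss_fun (tnorm t))%:E)%E.
  by rewrite -EFinM /gauss_fun tnorm_sq_tcons opprD expRD.
transitivity (\int[leb]_x ((Num.sqrt pi ^+ n)%:E * (gauss_fun x)%:E))%E.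
  apply: eq_integral => x _; under eq_integral do rewrite gE.
  rewrite ge0_integralZl//.
  - by rewrite IH muleC.
  - exact: mg.
  - by move=> t _; rewrite lee_fin gauss_fun_ge0.
  - by rewrite lee_fin gauss_fun_ge0.
rewrite ge0_integralZl//.
- by rewrite integralT_gauss -EFinM -exprSr.
- by apply/measurable_EFinP; exact: measurable_gauss_fun.
- by move=> x _; rewrite lee_fin gauss_fun_ge0.
Qed.

End LebesgueTupleIntegral.

(** * Rotation invariance of Lebesgue measure on tuples *)

Section OrthogonalInvariance.
Context {R : realType}.
Local Notation mR := (measurableTypeR R).
Local Notation lam := (@lebesgue_tuple R).

Definition tmul n (A : 'M[R]_n) (t : n.-tuple mR) : n.-tuple mR :=
  [tuple \sum_j A i j * tnth t j | i < n].

Lemma measurable_tmul n (A : 'M[R]_n) : measurable_fun setT (tmul A).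
Proof.
apply: measurable_mktuple => i; apply: measurable_sum => j.
by apply: measurable_funM => //; exact: measurable_tnth.
Qed.

Lemma tmul_comp n (A B : 'M[R]_n) t : tmul A (tmul B t) = tmul (A *m B) t.
Proof.
apply: eq_from_tnth => i; rewrite !tnth_mktuple.
under eq_bigr do rewrite tnth_mktuple mulr_sumr.
rewrite exchange_big /=; apply: eq_bigr => k _; rewrite !mxE mulr_suml.
by apply: eq_bigr => j _; rewrite mulrA.
Qed.

Lemma tmul1 n t : tmul (1%:M : 'M[R]_n) t = t.
Proof.
apply: eq_from_tnth => i; rewrite tnth_mktuple (bigD1 i)//= big1 => [|j ji].
  by rewrite mxE eqxx mul1r addr0.
by rewrite mxE eq_sym (negbTE ji) mul0r.
Qed.

Local Notation tshift a := (taffine (fun=> 1) a).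

Lemma tmul_shift n (A : 'M[R]_n) a t : tmul A (tshift (tnth a) t) =
  tshift (tnth (tmul A t)) (tmul A a).
Proof.
apply: eq_from_tnth => i; rewrite !tnth_mktuple mul1r -big_split /=.
by apply: eq_bigr => j _; rewrite tnth_mktuple mul1r mulrDr addrC.
Qed.

Lemma tnorm_tmul n (A : 'M[R]_n) t : A^T *m A = 1%:M -> tnorm (tmul A t) = tnorm t.
Proof.
move=> AA; congr Num.sqrt.
under eq_bigr do rewrite expr2 tnth_mktuple mulr_suml.
rewrite exchange_big /=; apply: eq_bigr => j _.
transitivity (tnth t j * tnth (tmul A^T (tmul A t)) j).
  rewrite tnth_mktuple mulr_sumr; apply: eq_bigr => i _.
  by rewrite tnth_mktuple mxE mulrCA mulrA.
by rewrite tmul_comp AA tmul1 expr2.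
Qed.

(* Both sides are multiplied by the integral of a Gaussian [e]: by translation
   invariance, the integral of f(A x) e(y) is that of f(A x) e(y - A x), hence of
   f(A x + y) e(- A x), and [e] is invariant under [A] and [-1]. *)
Lemma integral_tmul n (A : 'M[R]_n) (f : n.-tuple mR -> \bar R) :
  A *m A^T = 1%:M -> measurable_fun setT f -> (forall t, 0 <= f t)%E ->
  (\int[lam n]_t f (tmul A t) = \int[lam n]_t f t)%E.
Proof.
move=> AAT mf f0; have ATA := mulmx1C AAT.
pose e t : \bar R := (gauss_fun (tnorm (t : n.-tuple mR)))%:E.
have me : measurable_fun setT e.
  by apply/measurable_EFinP; exact: measurable_gauss_tnorm.
have e0 t : (0 <= e t)%E by rewrite lee_fin gauss_fun_ge0.
have Z : (\int[lam n]_t e t = (Num.sqrt pi ^+ n)%:E)%E by exact: integral_gauss_tnorm.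
have Zp : 0 < Num.sqrt (pi : R) ^+ n by rewrite exprn_gt0// sqrtr_gt0 pi_gt0.
have shift (a : 'I_n -> R) (g : n.-tuple mR -> \bar R) :
    measurable_fun setT g -> (forall t, 0 <= g t)%E ->
    (\int[lam n]_t g (tshift a t) = \int[lam n]_t g t)%E.
  move=> mg g0; rewrite -(@integral_taffine _ _ (fun=> 1) a g)//.
  by rewrite big1 ?mul1e// => i _; rewrite normr1.
have mA : measurable_fun setT (fun x => f (tmul A x)).
  by apply: measurableT_comp => //; exact: measurable_tmul.
have ms d (T : measurableType d) (u v : T -> n.-tuple mR) :
    measurable_fun setT u -> measurable_fun setT v ->
    measurable_fun setT (fun p => tshift (tnth (u p)) (v p)).
  move=> mu mv; apply: measurable_mktuple => i.
  apply: measurable_funD; first apply: measurable_funM => //.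
    exact: measurable_fun_tnth.
  exact: measurable_fun_tnth.
have mAp : measurable_fun setT (fun p : n.-tuple mR * n.-tuple mR => tmul A p.1).
  by apply: measurableT_comp => //; exact: measurable_tmul.
pose opp (t : n.-tuple mR) : n.-tuple mR := tmul (- 1%:M) t.
have mopp : measurable_fun setT opp by exact: measurable_tmul.
have oppE t : opp t = [tuple - tnth t i | i < n].
  apply: eq_from_tnth => i; rewrite !tnth_mktuple -[in RHS](tmul1 t) tnth_mktuple.
  by rewrite -sumrN; apply: eq_bigr => j _; rewrite mxE mulNr.
pose g (p : n.-tuple mR * n.-tuple mR) : \bar R :=
  (f (tmul A p.1) * e (tshift (tnth (opp (tmul A p.1))) p.2))%E.
pose k (p : n.-tuple mR * n.-tuple mR) : \bar R :=
  (e p.1 * f (tshift (tnth (tmul A p.1)) p.2))%E.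
have mg : measurable_fun setT g.
  apply: emeasurable_funM; first exact: measurableT_comp.
  apply: measurableT_comp => //; apply: ms => //.
  exact: measurableT_comp.
have mk : measurable_fun setT k.
  apply: emeasurable_funM; first exact: measurableT_comp.
  by apply: measurableT_comp => //; exact: ms.
have g0 p : (0 <= g p)%E by rewrite mule_ge0.
have k0 p : (0 <= k p)%E by rewrite mule_ge0.
have gk x y : g (tshift (tnth (tmul A^T y)) x, y) = k (x, y).
  rewrite /g /k /= tmul_shift tmul_comp AAT tmul1 muleC; congr (_ * _)%E.
  rewrite /e; congr (gauss_fun _)%:E; rewrite -(tnorm_tmul x ATA).
  congr Num.sqrt; apply: eq_bigr => i _.
  rewrite oppE !tnth_mktuple !mul1r opprD.
  by rewrite addrA subrr add0r sqrrN.
have mgy y : measurable_fun setT (fun x => g (x, y)).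
  by apply: (measurableT_comp mg); exact: measurable_pair2.
have gky y : (\int[lam n]_x g (x, y) = \int[lam n]_x k (x, y))%E.
  rewrite -(shift (tnth (tmul A^T y)) (fun x => g (x, y)) (mgy y) (fun x => g0 (x, y))).
  by apply: eq_integral => x _; exact: gk.
have H : (\int[lam n]_x \int[lam n]_y g (x, y) =
          \int[lam n]_x \int[lam n]_y k (x, y))%E.
  have Fg := @fubini_tonelli _ _ _ _ _ (lam n) (lam n) g mg g0.
  have Fk := @fubini_tonelli _ _ _ _ _ (lam n) (lam n) k mk k0.
  apply: (etrans Fg); apply: (etrans _ (esym Fk)).
  by apply: eq_integral => y _; exact: gky.
have Zl (u : n.-tuple mR -> \bar R) c : measurable_fun setT u ->
    (forall t, 0 <= u t)%E -> (0 <= c)%E ->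
    (\int[lam n]_t (c * u t) = c * \int[lam n]_t u t)%E.
  by move=> mu u0 c0; rewrite ge0_integralZl.
have gE : (\int[lam n]_x \int[lam n]_y g (x, y) =
    (Num.sqrt pi ^+ n)%:E * \int[lam n]_t f (tmul A t))%E.
  have Z0 : (0 <= (Num.sqrt (pi : R) ^+ n)%:E)%E by rewrite lee_fin ltW.
  apply: (etrans _ (Zl (fun t => f (tmul A t)) _ mA (fun t => f0 _) Z0)).
  apply: eq_integral => x _.
  pose a := tnth (opp (tmul A x)).
  have mea : measurable_fun setT (fun y => e (tshift a y)).
    by apply: (measurableT_comp me); exact: measurable_taffine.
  apply: (etrans (Zl _ (f (tmul A x)) mea (fun y => e0 _) (f0 _))).
  by rewrite (shift a e me e0) Z muleC.
have kE : (\int[lam n]_x \int[lam n]_y k (x, y) =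
    (Num.sqrt pi ^+ n)%:E * \int[lam n]_t f t)%E.
  have I0 : (0 <= \int[lam n]_t f t)%E by apply: integral_ge0 => t _; exact: f0.
  rewrite muleC -Z; apply: (etrans _ (Zl e _ me e0 I0)).
  apply: eq_integral => x _.
  pose a := tnth (tmul A x).
  have mfa : measurable_fun setT (fun y => f (tshift a y)).
    by apply: (measurableT_comp mf); exact: measurable_taffine.
  apply: (etrans (Zl _ (e x) mfa (fun y => f0 _) (e0 _))).
  by rewrite (shift a f mf f0) muleC.
(* The Gaussian factor is finite and positive, so it cancels even when the integral of [f] is
   infinite. *)
have cancel (z : R) (a b : \bar R) : 0 < z -> (z%:E * a = z%:E * b)%E -> a = b.
  move=> z0 zab; rewrite -[a]mul1e -[b]mul1e -(mulVf (lt0r_neq0 z0)) EFinM.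
  by rewrite -!muleA zab.
apply: (cancel _ _ _ Zp); apply: (etrans (esym gE)); exact: (etrans H kE).
Qed.

End OrthogonalInvariance.

Section GaussTail.
Context {R : realType}.
Local Notation leb := (@lebesgue_measure R).

Lemma is_derive_gauss_fun (x : R) :
  is_derive x (1 : R) (fun t => - gauss_fun t) (2 * x * gauss_fun x).
Proof.
by rewrite /gauss_fun; apply: is_derive_eq; rewrite /GRing.scale /=; ring.
Qed.

Lemma continuous_gauss_weight : continuous (fun u : R => 2 * u * gauss_fun u).
Proof.
move=> x; apply: cvgM; last exact: continuous_gauss_fun.
by apply: cvgM; [exact: cvg_cst|exact: cvg_id].
Qed.

(** It displays the Gaussian as a superposition of indicators of the balls of radius u, with weight
    2 u exp(-u^2). *)
Lemma integral_gauss_tail (a : R) : 0 <= a ->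
  (\int[leb]_(u in `[a, +oo[) (2 * u * gauss_fun u)%:E = (gauss_fun a)%:E)%E.
Proof.
move=> a0; rewrite (@ge0_continuous_FTC2y _ _ (fun t => - gauss_fun t) a 0).
- by rewrite -EFinB sub0r opprK.
- by move=> x ax; rewrite !mulr_ge0 ?gauss_fun_ge0// (le_trans a0).
- exact/continuous_subspaceT/continuous_gauss_weight.
- by rewrite -oppr0; apply: cvgN; exact: cvg_gauss_fun.
- by move=> x _; case: (is_derive_gauss_fun x).
- by apply: cvg_at_right_filter; apply: cvgN; exact: continuous_gauss_fun.
- by move=> x _; rewrite derive1E; case: (is_derive_gauss_fun x).
Qed.

End GaussTail.

(** * Volumes of balls and polar integration *)

Section TupleRadial.
Context {R : realType}.
Local Notation mR := (measurableTypeR R).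
Local Notation leb := (@lebesgue_measure R).
Local Notation lam := (@lebesgue_tuple R).
Variables (n : nat) (n0 : (0 < n)%N).
Local Open Scope ereal_scope.

Let ball (s : R) : set (n.-tuple mR) := [set t | (tnorm t <= s)%R].

Let mball s : measurable (ball s).
Proof.
have := @measurable_tnorm R n; move=> /(_ measurableT `]-oo, s]%classic).
by rewrite setTI => /(_ (measurable_itv _)); congr measurable.
Qed.

(** A Markov inequality with Gaussian weight: on the ball the Gaussian is at least exp(-s^2), and
    its total integral is finite. *)
Let ball_fin s : lam n (ball s) < +oo.
Proof.
have : (gauss_fun s)%:E * lam n (ball s) <= (Num.sqrt pi ^+ n)%:E.
  rewrite -integral_gauss_tnorm -integral_cst//.
  apply: (@le_trans _ _ (\int[lam n]_(t in ball s) (gauss_fun (tnorm t))%:E)).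
    apply: ge0_le_integral => //.
    - by move=> t _; rewrite lee_fin gauss_fun_ge0.
    - apply: measurable_funTS; apply/measurable_EFinP.
      exact: measurable_gauss_tnorm.
    - move=> t /= ts; rewrite lee_fin /gauss_fun ler_expR lerN2.
      have t0 := tnorm_ge0 t.
      by rewrite ler_pXn2r ?nnegrE// (le_trans t0).
  apply: ge0_subset_integral => //.
    by apply/measurable_EFinP; exact: measurable_gauss_tnorm.
  by move=> t _; rewrite lee_fin gauss_fun_ge0.
case: (lam n (ball s)) (measure_ge0 (lam n) (ball s)) => [r _ _|_|//].
  by rewrite ltry.
by rewrite gt0_muley ?lte_fin ?expR_gt0// leye_eq.
Qed.

Let C : R := fine (lam n (ball 1)).

Let ball_pos (s : R) : (0 < s)%R -> lam n (ball s) = (C * s ^+ n)%:E.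
Proof.
move=> s0.
have indicI u : \int[lam n]_t (\1_(ball u) t)%:E = lam n (ball u).
  by rewrite integral_indic// setIT.
have mb : measurable_fun setT (fun t => (\1_(ball s) t)%:E : \bar R).
  by apply/measurable_EFinP; exact: measurable_indic.
have := @integral_taffine R n (fun=> s) (fun=> 0%R) (fun t => (\1_(ball s) t)%:E).
move=> /(_ (fun=> lt0r_neq0 s0) mb (fun t => _)); rewrite indicI => <-; last first.
  by move=> t; rewrite lee_fin indicE.
rewrite big_const_ord iter_mulr_1 gtr0_norm// mulrC EFinM; congr (_ * _).
have bE t : \1_(ball s) (taffine (fun=> s) (fun=> 0%R) t) = \1_(ball 1) t :> R.
  have sE : tnorm (taffine (fun=> s) (fun=> 0%R) t) = (s * tnorm t)%R.
    rewrite -[RHS]ger0_norm ?mulr_ge0 ?tnorm_ge0 ?ltW// -sqrtr_sqr; congr Num.sqrt.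
    rewrite exprMn tnorm_sq mulr_sumr; apply: eq_bigr => i _.
    by rewrite tnth_mktuple addr0 exprMn.
  rewrite !indicE; congr ((nat_of_bool _)%:R); apply/idP/idP;
    by rewrite !inE /ball /= sE ger_pMr.
under eq_integral do rewrite bE.
by rewrite indicI /C fineK// ge0_fin_numE.
Qed.

Let C0 : (0 <= C)%R. Proof. exact/fine_ge0/measure_ge0. Qed.

Let ball_cdf (s : R) : (0 <= s)%R -> lam n (ball s) = (C * s ^+ n)%:E.
Proof.
rewrite le_eqVlt => /predU1P[<-|]; last exact: ball_pos.
rewrite expr0n eqn0Ngt n0 mulr0; apply/eqP; rewrite eq_le measure_ge0 andbT.
apply/lee_addgt0Pr => e e0; rewrite add0e.
(* The ball of radius 0 lies in that of radius s'. The bound 1 gives s'^n <= s', and the other one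
   gives C s' <= e. *)
pose s' := (Num.min 1 (e / (C + 1)))%R.
have C1 : (0 < C + 1)%R by rewrite ltr_wpDl.
have s'0 : (0 < s')%R by rewrite lt_min ltr01 divr_gt0.
apply: (@le_trans _ _ (lam n (ball s'))).
  apply: le_measure; rewrite ?inE//.
  by move=> t /le_trans; apply; exact: ltW.
rewrite ball_pos// lee_fin; apply: (@le_trans _ _ (C * s')%R).
  have s'1 : (s' <= 1)%R by rewrite ge_min lexx.
  by rewrite ler_wpM2l// -[leRHS]expr1 ler_wiXn2l ?(ltW s'0).
apply: (@le_trans _ _ (C * (e / (C + 1)))%R).
  by rewrite ler_wpM2l// ge_min lexx orbT.
rewrite mulrCA ger_pMr// ler_pdivrMr// mul1r lerDl//.
Qed.

(** [integral_gauss_tail] and Tonelli: the layer of height u contributes 2 u exp(-u^2) times the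
    volume C u^n of a ball. *)
Let gauss_layers : (Num.sqrt pi ^+ n)%:E =
  \int[leb]_(u in `[0%R, +oo[) (C * (2 * u ^+ n.+1 * gauss_fun u))%:E.
Proof.
pose w (u : R) : R := (2 * u * gauss_fun u)%R.
have mw : measurable_fun setT w.
  by apply: continuous_measurable_fun; exact: continuous_gauss_weight.
pose k (p : n.-tuple mR * mR) : \bar R := ((tnorm p.1 <= p.2)%R%:R * w p.2)%:E.
have k0 p : 0 <= k p.
  rewrite lee_fin; have [tp|_] := leP (tnorm p.1) p.2; last by rewrite mul0r.
  rewrite !mulr_ge0// ?gauss_fun_ge0//.
  exact: le_trans (tnorm_ge0 _) tp.
have mk : measurable_fun setT k.
  apply/measurable_EFinP; apply: measurable_funM.
    apply: (@measurable_comp _ _ _ _ _ _ setT (fun b : bool => b%:R : R)) => //.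
    apply: measurable_fun_ler; last exact: measurable_snd.
    by apply: measurableT_comp => //; exact: measurable_tnorm.
  exact: measurableT_comp.
rewrite -integral_gauss_tnorm.
transitivity (\int[lam n]_x \int[leb]_u k (x, u)).
  apply: eq_integral => t _; rewrite -integral_gauss_tail ?tnorm_ge0//.
  rewrite integral_mkcond; apply: eq_integral => u _; rewrite patchE mem_setE.
  by rewrite in_itv /= andbT /k /=; case: ifP; rewrite ?mul1r// mul0r.
rewrite (@fubini_tonelli _ _ _ _ _ (lam n) leb k)//.
rewrite [RHS]integral_mkcond; apply: eq_integral => u _; rewrite patchE mem_setE.
rewrite in_itv /= andbT; case: ifPn => u0; last first.
  rewrite integral0_eq// => t _; rewrite /k /=.
  have [tu|_] := leP (tnorm t) u; last by rewrite mul0r.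
  by rewrite (le_trans (tnorm_ge0 _) tu) in u0.
transitivity (\int[lam n]_t ((w u)%:E * (\1_(ball u) t)%:E)).
  apply: eq_integral => t _; rewrite /k /= -EFinM mulrC indicE; congr ((_ * (nat_of_bool _)%:R)%:E).
  by apply/idP/idP; rewrite inE.
rewrite ge0_integralZl//.
- transitivity ((w u)%:E * lam n (ball u)).
    by congr (_ * _); rewrite integral_indic// setIT.
  by rewrite (ball_cdf u0) -EFinM /w exprS; congr EFin; ring.
- by apply/measurable_EFinP; exact: measurable_indic.
- by rewrite lee_fin !mulr_ge0// gauss_fun_ge0.
Qed.

(** [C] is the volume of the unit ball. The two values of the same Gaussian integral will evaluate
    Gamma(n/2) and Gamma(n/2 + 1) separately, with no functional equation between them. *)
Lemma tuple_radial : exists2 C : R, (0 < C)%R & [/\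
  forall phi : R -> \bar R, measurable_fun setT phi -> (forall t, 0 <= phi t) ->
    \int[lam n]_t phi (tnorm t) =
    \int[leb]_(t in `[0%R, +oo[) ((C * n%:R * t ^+ n.-1)%:E * phi t),
  (Num.sqrt pi ^+ n)%:E =
    \int[leb]_(u in `[0%R, +oo[) (C * n%:R * u ^+ n.-1 * gauss_fun u)%:E &
  (Num.sqrt pi ^+ n)%:E =
    \int[leb]_(u in `[0%R, +oo[) (C * (2 * u ^+ n.+1 * gauss_fun u))%:E].
Proof.
have rad phi : measurable_fun setT phi -> (forall t, 0 <= phi t) ->
    \int[lam n]_t phi (tnorm t) =
    \int[leb]_(t in `[0%R, +oo[) ((C * n%:R * t ^+ n.-1)%:E * phi t).
  by apply: integral_radial => //; [exact: measurable_tnorm|exact: tnorm_ge0].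
exists C; last split=> //.
(* A unit ball of volume 0 would make the Gaussian integral 0. *)
- rewrite lt_neqAle C0 andbT; apply/eqP => C_0; have := gauss_layers.
  rewrite -C_0; under eq_integral do rewrite mul0r.
  rewrite integral0 => /eqP; rewrite eqe expf_eq0 sqrtr_eq0 leNgt pi_gt0.
  by rewrite andbF.
- rewrite -integral_gauss_tnorm (rad (fun t => (gauss_fun t)%:E))//.
  by apply/measurable_EFinP; exact: measurable_gauss_fun.
  by move=> t; rewrite lee_fin gauss_fun_ge0.
Qed.

End TupleRadial.

(** * Gamma function at half-integers *)

Section GammaHalf.
Context {R : realType}.
Local Notation leb := (@lebesgue_measure R).

(** The substitution t = u^2, obtained from [integral_radial] for Lebesgue measure on the positive
    half-line: there the set where the square root is at most s has measure s^2. *)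
Lemma integral_Gamma_half n : (0 < n)%N ->
  (\int[leb]_(t in `]0%R, +oo[) (t `^ (n%:R / 2 - 1) * expR (- t))%:E =
   \int[leb]_(t in `[0%R, +oo[) (2 * t ^+ n.-1 * gauss_fun t)%:E)%E.
Proof.
move=> n0.
pose D : set (measurableTypeR R) := `]0, +oo[%classic.
have mD : measurable D by exact: measurable_itv.
have mI : measurable_fun setT (\1_D : _ -> R) by exact: measurable_indic.
have I0 x : 0 <= \1_D x :> R by rewrite indicE.
have [nu nuE] := exists_density_measure leb mI I0.
have nuI A : measurable A -> nu A = (\int[leb]_(x in A) (\1_D x)%:E)%E by [].
pose phi (t : R) : \bar R := ((t ^+ 2) `^ (n%:R / 2 - 1) * gauss_fun t)%:E.
have mphi : measurable_fun setT phi.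
  apply/measurable_EFinP; apply: measurable_funM; last exact: measurable_gauss_fun.
  apply: (@measurableT_comp _ _ _ _ _ _ (fun x : R => x `^ _)).
    exact: measurable_powR.
  exact: measurable_funX.
have phi0 t : (0 <= phi t)%E by rewrite lee_fin mulr_ge0 ?powR_ge0 ?gauss_fun_ge0.
have msqrt : measurable_fun setT (fun x : R => Num.sqrt x).
  by apply: continuous_measurable_fun; exact: sqrt_continuous.
have cdf (s : R) : 0 <= s -> nu [set x : R | Num.sqrt x <= s] = (1 * s ^+ 2)%:E.
  move=> s0; have -> : [set x : R | Num.sqrt x <= s] = `]-oo, s ^+ 2]%classic.
    apply/seteqP; split => x /=; rewrite in_itv /=.
      move=> xs; have [x0|/ltW x0] := leP 0 x; last by rewrite (le_trans x0)// sqr_ge0.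
      by rewrite -(sqr_sqrtr x0) ler_pXn2r ?nnegrE ?sqrtr_ge0.
    have [x0|x0 _] := leP 0 x; last by rewrite ltr0_sqrtr.
    by rewrite -{1}(sqr_sqrtr x0) ler_pXn2r ?nnegrE ?sqrtr_ge0.
  rewrite nuE integral_indic// /D.
  rewrite (_ : _ `&` _ = `]0, s ^+ 2]%classic); last first.
    by apply/seteqP; split => x /=; rewrite !in_itv /= andbT;
      [case=> -> ->|move=> /andP[-> ->]].
  rewrite /= lebesgue_measure_itv /= lte_fin mul1r; case: ltP => [_|s2].
    by rewrite -EFinD subr0.
  by congr EFin; apply/esym/eqP; rewrite eq_le s2 sqr_ge0.
have := @integral_radial _ _ R nu Num.sqrt 1 2 msqrt (@sqrtr_ge0 _) ler01 isT cdf phi mphi phi0.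
have -> : (\int[nu]_x phi (Num.sqrt x) =
    \int[leb]_(t in `]0%R, +oo[) (t `^ (n%:R / 2 - 1) * expR (- t))%:E)%E.
  rewrite (integral_density mI I0 nuI)//; last by apply: measurableT_comp.
  rewrite [RHS]integral_mkcond; apply: eq_integral => t _; rewrite patchE indicE.
  case: ifPn => // [|_]; rewrite ?mul0e//= mul1e inE /D /= in_itv /= andbT => t0.
  by rewrite /phi /gauss_fun sqr_sqrtr// ltW.
move=> ->; rewrite -integral_itv_obnd_cbnd; last first.
  apply: measurable_funTS; apply: emeasurable_funM => //.
  by apply/measurable_EFinP; apply: measurable_funM => //; exact: measurable_funX.
rewrite -integral_itv_obnd_cbnd; last first.
  apply: measurable_funTS; apply/measurable_EFinP.
  apply: measurable_funM; last exact: measurable_gauss_fun.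
  by apply: measurable_funM => //; exact: measurable_funX.
apply: eq_integral => t; rewrite inE /= in_itv /= andbT => t0.
rewrite /phi -EFinM; congr EFin; rewrite mulrA; congr (_ * _).
have t2 : (t ^+ 2) `^ (n%:R / 2 - 1) * t = t ^+ n.-1.
  apply: (mulIf (lt0r_neq0 t0)); rewrite -mulrA -expr2 -exprSr prednK//.
  rewrite -{2}[t ^+ 2]powRr1 ?sqr_ge0// -powRD ?subrK; last first.
    by apply/implyP => _; rewrite expf_eq0 gt_eqF.
  rewrite -[in LHS](powR_mulrn 2) ?ltW// -powRrM.
  rewrite mulrCA mulfV// mulr1 powR_mulrn ?ltW//.
by rewrite -t2 mul1r expr1; ring.
Qed.

(** The formula pi^(n/2) / Gamma(n/2 + 1) for the volume of the unit ball, and the area constant of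
    the sphere up to the factor 2. *)
Lemma Gamma_half n : (0 < n)%N -> exists2 C : R, 0 < C & [/\
  forall phi : R -> \bar R, measurable_fun setT phi -> (forall t, 0 <= phi t)%E ->
    (\int[lebesgue_tuple n]_t phi (tnorm t) =
    \int[leb]_(t in `[0%R, +oo[) ((C * n%:R * t ^+ n.-1)%:E * phi t))%E,
  pi `^ (n%:R / 2) / Gamma (n%:R / 2) = C * n%:R / 2 :> R &
  pi `^ (n%:R / 2) / Gamma (n%:R / 2 + 1) = C :> R].
Proof.
move=> n0; have [C C0 [rad G1 G2]] := @tuple_radial R n n0.
have n0R : 0 < n%:R :> R by rewrite ltr0n.
exists C => //.
have ->: pi `^ (n%:R / 2) = Num.sqrt pi ^+ n :> R.
  by rewrite mulrC powRrM -powR_mulrn ?powR_ge0// powR12_sqrt ?pi_ge0.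
have sp : 0 < Num.sqrt (pi : R) ^+ n by rewrite exprn_gt0// sqrtr_gt0 pi_gt0.
(* The real left side also excludes an infinite integral, for which the [fine] inside [Gamma] would
   return 0. *)
have scale c m : 0 < c -> (0 < m)%N ->
    ((Num.sqrt (pi : R) ^+ n)%:E =
       c%:E * \int[leb]_(t in `[0%R, +oo[) (2 * t ^+ m.-1 * gauss_fun t)%:E)%E ->
    Gamma (m%:R / 2) = Num.sqrt pi ^+ n / c.
  move=> c0 m0; rewrite -integral_Gamma_half// => cE.
  rewrite /Gamma /Rintegral; move: cE; case: (\int[leb]_(t in _) _)%E => [g| |] /=.
  - by rewrite -EFinM => -[->]; rewrite mulrAC mulfV ?mul1r// gt_eqF.
  - by rewrite gt0_muley ?lte_fin.
  - by rewrite gt0_muleNy ?lte_fin.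
have mw m : measurable_fun setT (fun t : measurableTypeR R => (2 * t ^+ m * gauss_fun t)%:E).
  apply/measurable_EFinP; apply: measurable_funM; last exact: measurable_gauss_fun.
  by apply: measurable_funM => //; exact: measurable_funX.
have w0 m t : t \in `[0, +oo[ -> (0%:E <= (2 * t ^+ m * gauss_fun t)%:E)%E :> Prop.
  rewrite in_itv /= andbT => t0.
  by rewrite lee_fin !mulr_ge0 ?gauss_fun_ge0 ?exprn_ge0.
split => //.
- rewrite (scale (C * n%:R / 2) n)//; last 2 first.
  + by rewrite divr_gt0 ?mulr_gt0.
  + rewrite G1 -ge0_integralZl//; last 3 first.
    * exact: measurable_funTS.
    * by move=> t; exact: w0.
    * by rewrite lee_fin divr_ge0 ?mulr_ge0 ?ltW.
    by apply: eq_integral => t _; rewrite -EFinM; congr EFin; field.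
  by rewrite invf_div mulrCA divff ?mulr1// gt_eqF.
- have -> : n%:R / 2 + 1 = n.+2%:R / 2 :> R.
    by rewrite -addn2 natrD; field.
  rewrite (scale C n.+2)//; last first.
  + rewrite G2 -ge0_integralZl//; last 3 first.
    * exact: measurable_funTS.
    * by move=> t; exact: w0.
    * by rewrite lee_fin ltW.
  by rewrite invf_div mulrCA divff ?mulr1// gt_eqF.
Qed.

End GammaHalf.

(** * The radial profile *)

Section PositiveIntegral.
Context {R : realType}.
Local Notation leb := (@lebesgue_measure R).

(** If the integral were 0, [f] would vanish almost everywhere and the interval ]0, r] would be
    negligible. *)
Lemma integral_itv_gt0 (f : R -> R) (r : R) : 0 < r ->
  measurable_fun (`[0, r]%classic : set (measurableTypeR R)) f ->
  (forall t, 0 <= t <= r -> 0 <= f t) -> (forall t, 0 < t <= r -> 0 < f t) ->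
  (0 < \int[leb]_(t in `[0%R, r]) (f t)%:E)%E.
Proof.
move=> r0 mf f0 fp; rewrite lt_neqAle integral_ge0 ?andbT; last first.
  by move=> t /=; rewrite in_itv /= => t0; rewrite lee_fin f0.
apply/eqP => /esym I0.
have : ae_eq leb (`[0%R, r]%classic : set (measurableTypeR R)) (EFin \o f) (cst 0%E).
  apply/ae_eq_integral_abs => //; first exact/measurable_EFinP.
  rewrite -[RHS]I0; apply: eq_integral => t; rewrite inE /= in_itv /= => t0.
  by rewrite ger0_norm ?f0.
move=> [A [mA A0 Af]].
have : (leb `]0%R, r]%classic <= leb A)%E.
  apply: le_measure; rewrite ?inE// => t /=; rewrite in_itv /= => /andP[t0 tr].
  apply: Af => /=; rewrite in_itv /= (ltW t0) tr => /(_ isT) [ft0].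
  by have := fp t; rewrite t0 tr ft0 ltxx => /(_ isT).
by rewrite A0 lebesgue_measure_itv /= lte_fin r0 -EFinD subr0 lee_fin leNgt r0.
Qed.

End PositiveIntegral.

Section DecreasingProfile.
Context {R : realType}.
Variables h h' : R -> R.
Hypotheses (h0 : forall t, 0 <= t -> 0 <= h t)
  (dh : has_derivative_on_nonneg h h') (h'0 : forall t, 0 <= t -> h' t < 0).
Local Notation leb := (@lebesgue_measure R).
Local Notation mR := (measurableTypeR R).

Let slope (t : R) : 0 <= t -> forall e : R, 0 < e -> exists2 d : R, 0 < d &
  forall s, 0 <= s -> s != t -> `|s - t| < d ->
    `|(s - t)^-1 * (h s - h t) - h' t| < e.
Proof.
move=> t0 e e0; have := dh t0 => /cvgrPdist_lt /(_ e e0).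
rewrite /within /= => -[d /= d0 dP]; exists d => // s s0 st std.
rewrite distrC; apply: dP => //.
by rewrite /= distrC.
Qed.

(** The hypotheses say nothing about [h] at negative arguments. This extension by a constant is
    continuous on the whole line, which gives measurability and access to the mean value theorem. *)
Definition clamped (t : R) : R := h (Num.max 0 t).

Lemma clampedE t : 0 <= t -> clamped t = h t.
Proof. by move=> t0; rewrite /clamped; move: t0 => /max_idPr ->. Qed.

Let slope_bound (t : R) : 0 <= t -> exists2 d : R, 0 < d &
  forall s, 0 <= s -> `|s - t| < d -> `|h s - h t| <= (`|h' t| + 1) * `|s - t|.
Proof.
move=> t0; have [d d0 dP] := slope t0 ltr01; exists d => // s s0 std.
have [->|st] := eqVneq s t; first by rewrite !subrr normr0 mulr0.
have := dP s s0 st std; set x := _ * _ => xh.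
have -> : h s - h t = x * (s - t).
  by rewrite /x mulrAC mulVf ?mul1r// subr_eq0.
rewrite normrM ler_wpM2r// -lerBlDl; apply: le_trans (ltW xh).
exact: lerB_dist.
Qed.

Lemma continuous_clamped : continuous clamped.
Proof.
move=> t; apply/cvgrPdist_lt => e e0.
have m0 : 0 <= Num.max 0 t by rewrite le_max lexx.
have [d d0 dP] := slope_bound m0.
have c0 : 0 < `|h' (Num.max 0 t)| + 1 by rewrite ltr_wpDl.
near=> s; rewrite /clamped distrC.
(* Clamping is 1-Lipschitz, so the local linear bound on [h] carries over. *)
have st : `|Num.max 0 s - Num.max 0 t| <= `|s - t|.
  have n1 := ler_norm (s - t); have n2 := ler_norm (t - s); rewrite distrC in n2.
  rewrite ler_norml /Num.max; case: ltP => s0; case: ltP => t0;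
    by apply/andP; split; lra.
have s0 : 0 <= Num.max 0 s by rewrite le_max lexx.
apply: le_lt_trans (dP _ s0 _) _.
  apply: le_lt_trans st _; rewrite distrC; near: s.
  exact: cvgr_dist_lt.
rewrite -ltr_pdivlMl//; apply: le_lt_trans st _; rewrite distrC; near: s.
by apply: cvgr_dist_lt => //; rewrite mulr_gt0 ?invr_gt0.
Unshelve. all: by end_near. Qed.

Lemma is_derive_clamped (t : R) : 0 < t -> is_derive t (1 : R) clamped (h' t).
Proof.
move=> t0.
have H : e^-1 *: (clamped (e *: (1 : R) + t) - clamped t) @[e --> (0 : R)^'] --> h' t.
  apply/cvgrPdist_lt => e e0; have [d d0 dP] := slope (ltW t0) e0.
  near=> s; have s0 : s != 0 by near: s; exact: nbhs_dnbhs_neq.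
  have st : `|s| < Num.min d t.
    by near: s; apply: dnbhs0_lt; rewrite lt_min d0 t0.
  have sd : `|s| < d by rewrite (lt_le_trans st)// ge_min lexx.
  have ts : `|s| < t by rewrite (lt_le_trans st)// ge_min lexx orbT.
  have st0 : 0 <= s + t by move: ts; rewrite ltr_norml => /andP[]; lra.
  rewrite /GRing.scale /= mulr1 (clampedE st0) (clampedE (ltW t0)) distrC.
  have := dP (s + t) st0; rewrite addrK; apply => //.
  by rewrite -subr_eq0 addrK.
by split; [apply/cvg_ex; exists (h' t)|exact/cvg_lim].
Unshelve. all: by end_near. Qed.

(** The mean value theorem for the clamped profile; it needs a two-sided derivative only in the
    interior, so a = 0 is allowed. *)
Lemma profile_decreasing a b : 0 <= a -> a < b -> h b < h a.
Proof.
move=> a0 ab; have b0 : 0 <= b by rewrite (le_trans a0)// ltW.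
have dc x : x \in `]a, b[ -> is_derive x (1 : R) clamped (h' x).
  rewrite in_itv /= => /andP[ax _].
  by apply: is_derive_clamped; exact: le_lt_trans ax.
have cc : {within `[a, b], continuous clamped}.
  exact/continuous_subspaceT/continuous_clamped.
have [c] := @MVT R clamped h' a b ab dc cc.
rewrite in_itv /= => /andP[ac _]; rewrite !clampedE// => E.
rewrite -subr_lt0 E nmulr_rlt0 ?subr_gt0//.
by apply: h'0; rewrite (le_trans a0)// ltW.
Qed.

Lemma profile_gt0 t : 0 <= t -> 0 < h t.
Proof.
move=> t0; have t1 : t < t + 1 by rewrite ltrDl.
apply: le_lt_trans (profile_decreasing t0 t1).
by apply: h0; rewrite addr_ge0.
Qed.

Lemma continuous_profile_sq : continuous (fun t : R => h (t ^+ 2)).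
Proof.
move=> t; rewrite (_ : (fun t : R => h (t ^+ 2)) = clamped \o (fun t => t ^+ 2)).
  by apply: continuous_comp; [exact: exprn_continuous|exact: continuous_clamped].
by apply/funext => x /=; rewrite clampedE ?sqr_ge0.
Qed.

Local Notation H := (fun t : R => h (t ^+ 2)).

Let mH : measurable_fun setT (H : mR -> R).
Proof. by apply: continuous_measurable_fun; exact: continuous_profile_sq. Qed.

Lemma integral_profile_fin m r :
  (\int[leb]_(t in `[0%R, r]) (t ^+ m * h (t ^+ 2))%:E \is a fin_num)%E.
Proof.
have c : continuous (fun t : R => t ^+ m * h (t ^+ 2)).
  by move=> t; apply: cvgM; [exact: exprn_continuous|exact: continuous_profile_sq].
apply: integrable_fin_num => //.
apply: continuous_compact_integrable; first exact: segment_compact.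
exact: continuous_subspaceT.
Qed.

(** * Integration by parts as an inequality, through difference quotients *)

Section DerivativeIntegral.
Variables (m : nat) (r : R).
Hypotheses (m0 : (0 < m)%N) (r0 : 0 < r).
Local Open Scope ereal_scope.

(** Minus t^m times the right difference quotient of H(t) = h(t^2) with step 1 / (n + 1); it is
    nonnegative since [h] decreases. *)
Let D n (t : mR) : R := (n.+1%:R * (t ^+ m * (H t - H (t + n.+1%:R^-1))))%R.

Let mHs (c : R) : measurable_fun setT (fun t : mR => H (t + c)%R).
Proof.
apply: (measurableT_comp mH).
by apply: measurable_funD => //; exact: measurable_cst.
Qed.

Let mD n : measurable_fun setT (D n).
Proof.
apply: measurable_funM; first exact: measurable_cst.
apply: measurable_funM; first exact: measurable_funX.
by apply: measurable_funB => //; exact: mHs.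
Qed.

Let D0 n t : (0 <= t)%R -> (0 <= D n t)%R.
Proof.
move=> t0; rewrite /D !mulr_ge0 ?exprn_ge0// subr_ge0 ltW//.
apply: profile_decreasing; first exact: sqr_ge0.
by rewrite ltr_pXn2r ?nnegrE ?addr_ge0// ltrDl.
Qed.

Let power_increment (s d : R) k : (0 <= d)%R -> (d <= s)%R ->
  (s ^+ k.+1 - (s - d) ^+ k.+1 <= k.+1%:R * d * s ^+ k)%R.
Proof.
move=> d0 ds; have s0 : (0 <= s)%R := le_trans d0 ds.
elim: k => [|k IH]; first by rewrite !expr1 expr0 mulr1 mul1r; lra.
rewrite (exprS s) (exprS (s - d)).
have -> : (s * s ^+ k.+1 - (s - d) * (s - d) ^+ k.+1 =
  s * (s ^+ k.+1 - (s - d) ^+ k.+1) + d * (s - d) ^+ k.+1)%R by ring.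
have -> : (k.+2%:R * d * s ^+ k.+1 =
  s * (k.+1%:R * d * s ^+ k) + d * s ^+ k.+1)%R by rewrite exprS; ring.
rewrite lerD ?ler_wpM2l// lerXn2r ?nnegrE ?subr_ge0//.
by rewrite gerBl.
Qed.

Let W (t : mR) : R := (m%:R * (t ^+ m.-1 * H t))%R.

Let mW : measurable_fun setT W.
Proof.
apply: measurable_funM; first exact: measurable_cst.
by apply: measurable_funM => //; exact: measurable_funX.
Qed.

Let in0r (t : mR) : (`[0%R, r]%classic : set mR) t -> (0 <= t <= r)%R.
Proof. by rewrite /= in_itv. Qed.

Let h_ge0 t : (0 <= h (t ^+ 2))%R. Proof. by apply: h0; exact: sqr_ge0. Qed.

(** Summation by parts: translating by the step d moves the difference from H to t^m. The shifted
    integral is only bounded below, the part beyond r being dropped, and N (t^m - (t - d)^m) <= m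
    t^(m-1). *)
Let integral_D n :
  \int[leb]_(t in `[0%R, r]) (D n t)%:E <= \int[leb]_(t in `[0%R, r]) (W t)%:E.
Proof.
pose N : R := n.+1%:R; pose d : R := (N^-1)%R.
have N0 : (0 < N)%R by rewrite ltr0n.
have d0 : (0 < d)%R by rewrite invr_gt0.
pose f (t : mR) : R := (N * (t ^+ m * H t))%R.
pose g (t : mR) : R := (N * (t ^+ m * H (t + d)))%R.
pose k (t : mR) : R := (N * ((Num.max 0 (t - d)) ^+ m * H t))%R.
have mf : measurable_fun setT f.
  apply: measurable_funM; first exact: measurable_cst.
  by apply: measurable_funM => //; exact: measurable_funX.
have mg : measurable_fun setT g.
  apply: measurable_funM; first exact: measurable_cst.
  by apply: measurable_funM; [exact: measurable_funX|exact: mHs].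
have mk : measurable_fun setT k.
  apply: measurable_funM; first exact: measurable_cst.
  apply: measurable_funM => //; apply: measurable_funX.
  apply: measurable_maxr; first exact: measurable_cst.
  by apply: measurable_funB => //; exact: measurable_cst.
have g0 t : (0 <= t)%R -> (0 <= g t)%R.
  by move=> t0; rewrite /g !mulr_ge0 ?exprn_ge0// ltW.
have k0 t : (0 <= k t)%R.
  by rewrite /k !mulr_ge0 ?exprn_ge0 ?le_max ?lexx// ltW.
have W0 t : (0 <= t)%R -> (0 <= W t)%R by move=> t0; rewrite /W !mulr_ge0 ?exprn_ge0.
have mE (u : mR -> R) : measurable_fun setT u ->
    measurable_fun (`[0%R, r] : set mR) (fun t => (u t)%:E).
  by move=> mu; apply: measurable_funTS; exact/measurable_EFinP.
have E1 : \int[leb]_(t in `[0%R, r]) (f t)%:E =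
    \int[leb]_(t in `[0%R, r]) (D n t)%:E + \int[leb]_(t in `[0%R, r]) (g t)%:E.
  rewrite -ge0_integralD//=.
  - by apply: eq_integral => t _; rewrite -EFinD /f /D /g; congr EFin; rewrite -/N -/d; ring.
  - by move=> t /in0r /andP[t0 _]; rewrite lee_fin D0.
  - exact: mE.
  - by move=> t /in0r /andP[t0 _]; rewrite lee_fin g0.
  - exact: mE.
have E2 : \int[leb]_(t in `[0%R, r]) (f t)%:E <=
    \int[leb]_(t in `[0%R, r]) (W t)%:E + \int[leb]_(t in `[0%R, r]) (k t)%:E.
  rewrite -ge0_integralD//=; first last.
  - exact: mE.
  - by move=> t _; rewrite lee_fin k0.
  - exact: mE.
  - by move=> t /in0r /andP[t0 _]; rewrite lee_fin W0.
  apply: ge0_le_integral => //=.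
  - by move=> t /in0r /andP[t0 _]; rewrite lee_fin /f !mulr_ge0 ?exprn_ge0// ltW.
  - exact: mE.
  - by apply: emeasurable_funD; exact: mE.
  move=> t /in0r /andP[t0 _]; rewrite -EFinD lee_fin /f /W /k.
  have -> : (m%:R * (t ^+ m.-1 * H t) + N * (Num.max 0 (t - d) ^+ m * H t) =
    (m%:R * t ^+ m.-1 + N * Num.max 0 (t - d) ^+ m) * H t)%R by ring.
  rewrite mulrA ler_wpM2r//.
  have mE' : m = m.-1.+1 by rewrite prednK.
  have Nd : (N * d = 1)%R by rewrite /d divff// gt_eqF.
  case: (ltP 0 (t - d))%R => td.
    rewrite subr_gt0 in td.
    have := power_increment m.-1 (ltW d0) (ltW td); rewrite -mE' => pi.
    have : (N * (t ^+ m - (t - d) ^+ m) <= N * (m%:R * d * t ^+ m.-1))%R.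
      by rewrite ler_pM2l.
    have -> : (N * (m%:R * d * t ^+ m.-1) = N * d * (m%:R * t ^+ m.-1))%R by ring.
    by rewrite Nd mul1r mulrBr; lra.
  (* Near the origin t <= d, so the shifted power is 0 and N t <= 1 <= m suffices. *)
  rewrite expr0n eqn0Ngt m0 mulr0 addr0 mE' exprS -mE' mulrA ler_wpM2r ?exprn_ge0//.
  have tN : (N * t <= 1)%R by rewrite -Nd ler_pM2l// -subr_le0.
  by rewrite (le_trans tN)// ler1n.
have E3 : \int[leb]_(t in `[0%R, r]) (k t)%:E <= \int[leb]_(t in `[0%R, r]) (g t)%:E.
  have mkr : measurable_fun setT ((fun t => (k t)%:E) \_ (`[0%R, r] : set mR)).
    by apply/(measurable_restrictT _ _).1 => //; exact: mE.
  have kr0 t : 0 <= ((fun t => (k t)%:E) \_ (`[0%R, r] : set mR)) t.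
    by rewrite patchE; case: ifP; rewrite ?lee_fin.
  rewrite integral_mkcond -(@integral_affine R 1 d _ _ mkr kr0)//.
  rewrite normr1 mul1e [leRHS]integral_mkcond; apply: ge0_le_integral => //=.
  - apply: (measurableT_comp mkr).
    apply: measurable_funD; last exact: measurable_cst.
    by apply: measurable_funM => //; exact: measurable_cst.
  - by apply/(measurable_restrictT _ _).1 => //; exact: mE.
  move=> t _; rewrite mul1r !patchE !mem_setE !in_itv /=.
  case: (leP 0%R t) => t0 /=.
    case: ifP => [/andP[_ tdr]|_]; last by case: ifP; rewrite ?lee_fin ?g0.
    rewrite (le_trans _ tdr) ?lerDl ?(ltW d0)// lee_fin /k /g addrK.
    by move: (t0) => /max_idPr ->.
  case: ifP => // _; rewrite lee_fin /k addrK max_l ?(ltW t0)//.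
  by rewrite expr0n eqn0Ngt m0 mul0r mulr0.
(* Finiteness allows the integral of [g] to be cancelled from both sides. *)
have gfin : \int[leb]_(t in `[0%R, r]) (g t)%:E \is a fin_num.
  apply: integrable_fin_num => //.
  apply: continuous_compact_integrable; first exact: segment_compact.
  apply: continuous_subspaceT => t.
  apply: cvgM; first exact: cvg_cst.
  apply: cvgM; first exact: exprn_continuous.
  apply: (@continuous_comp _ _ _ (fun t => t + d)%R H).
    by apply: cvgD; [exact: cvg_id|exact: cvg_cst].
  exact: continuous_profile_sq.
rewrite -(leeD2rE _ _ gfin) -E1; apply: le_trans E2 _.
exact: leeD2l.
Qed.

(** The chain rule by hand: (t + 1/(n + 1))^2 approaches t^2 from the right, where [h] is
    controlled, so t = 0 needs no separate argument. *)
Let derivD (t : R) : (0 <= t)%R ->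
  (D n t)%:E @[n --> \oo] --> (2 * t ^+ m.+1 * - h' (t ^+ 2))%:E.
Proof.
move=> t0.
pose y n : R := ((t + n.+1%:R^-1) ^+ 2)%R; pose x : R := (t ^+ 2)%R.
have d0 n : (0 < n.+1%:R^-1 :> R)%R by rewrite invr_gt0.
have xy n : (y n - x = n.+1%:R^-1 * (2 * t + n.+1%:R^-1))%R by rewrite /y /x; ring.
have xy0 n : (y n - x)%R != 0%R.
  by rewrite xy mulf_neq0 ?gt_eqF// ltr_wpDl// mulr_ge0.
have dcvg : (n.+1%:R^-1 : R)%R @[n --> \oo] --> 0%R by exact: cvg_harmonic.
have slopes : ((y n - x)^-1 * (h (y n) - h x))%R @[n --> \oo] --> h' x.
  apply/cvgrPdist_lt => e e0; have [d dp dP] := slope (sqr_ge0 t) e0.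
  have yx : (y n - x)%R @[n --> \oo] --> 0%R.
    have : (n.+1%:R^-1 * (2 * t + n.+1%:R^-1))%R @[n --> \oo] -->
        (0 * (2 * t + 0))%R.
      by apply: cvgM => //; apply: cvgD => //; exact: cvg_cst.
    by rewrite mul0r; under eq_fun do rewrite -xy.
  have := yx => /cvgr0_norm_lt /(_ d dp) ydn.
  near=> n; rewrite distrC; apply: dP; first exact: sqr_ge0.
    by rewrite -subr_eq0.
  by near: n.
have DE n : D n t = (- (t ^+ m) * (((y n - x)^-1 * (h (y n) - h x)) *
    (2 * t + n.+1%:R^-1)))%R.
  rewrite /D -/x -/(y n).
  have -> : (2 * t + n.+1%:R^-1 = n.+1%:R * (y n - x))%R.
    by rewrite xy mulrA divff// mul1r.
  have -> : ((y n - x)^-1 * (h (y n) - h x) * (n.+1%:R * (y n - x)) =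
     (y n - x)^-1 * (y n - x) * (n.+1%:R * (h (y n) - h x)))%R by ring.
  by rewrite mulVf// mul1r; ring.
have Dcvg : D n t @[n --> \oo] --> (- (t ^+ m) * (h' x * (2 * t + 0)))%R.
  under eq_fun do rewrite DE.
  apply: cvgM; first exact: cvg_cst.
  by apply: cvgM => //; apply: cvgD => //; exact: cvg_cst.
have -> : (2 * t ^+ m.+1 * - h' (t ^+ 2) = - (t ^+ m) * (h' x * (2 * t + 0)))%R.
  by rewrite exprS /x; ring.
by apply: cvg_EFin; [exact: nearW|exact: Dcvg].
Unshelve. all: by end_near. Qed.

Let g (t : mR) : R := (2 * t ^+ m.+1 * - h' (t ^+ 2))%R.

Let mg : measurable_fun (`[0%R, r]%classic : set mR) (EFin \o g).
Proof.
apply: (@emeasurable_fun_cvg _ _ _ _ (fun n t => (D n t)%:E)).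
  by move=> n; apply: measurable_funTS; exact/measurable_EFinP.
by move=> t /in0r /andP[t0 _]; exact: derivD.
Qed.

(** Integration by parts of t^m against -dH, without its boundary term -r^m h(r^2) <= 0. The finite
    right side is what makes the left one finite. *)
Lemma integral_derivative_profile_le :
  \int[leb]_(t in `[0%R, r]) (2 * t ^+ m.+1 * - h' (t ^+ 2))%:E <=
  \int[leb]_(t in `[0%R, r]) (m%:R * (t ^+ m.-1 * h (t ^+ 2)))%:E.
Proof.
have -> : \int[leb]_(t in `[0%R, r]) (2 * t ^+ m.+1 * - h' (t ^+ 2))%:E =
    \int[leb]_(t in `[0%R, r]) limn_einf (fun n => (D n t)%:E).
  apply: eq_integral => t; rewrite inE => /in0r /andP[t0 _].
  by have [-> _] := cvg_limn_einf_sup (derivD t0).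
apply: (@le_trans _ _ (limn_einf (fun n => \int[leb]_(t in `[0%R, r]) (D n t)%:E))).
  apply: fatou => // [n|n t /in0r /andP[t0 _]].
    by apply: measurable_funTS; exact/measurable_EFinP.
  by rewrite lee_fin D0.
rewrite limn_einf_lim; apply: lime_le; first exact: is_cvg_einfs.
near=> n; apply: (@le_trans _ _ (\int[leb]_(t in `[0%R, r]) (D n t)%:E)).
  by apply: ereal_inf_lbound; exists n => /=.
exact: integral_D.
Unshelve. all: by end_near. Qed.

Lemma integral_derivative_profile_gt0 :
  0 < \int[leb]_(t in `[0%R, r]) (2 * t ^+ m.+1 * - h' (t ^+ 2))%:E.
Proof.
apply: integral_itv_gt0 => //; first exact/measurable_EFinP.
  by move=> t /andP[t0 _]; rewrite !mulr_ge0 ?exprn_ge0// oppr_ge0 ltW// h'0// sqr_ge0.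
by move=> t /andP[t0 _]; rewrite !mulr_gt0 ?exprn_gt0// oppr_gt0 h'0// sqr_ge0.
Qed.

Lemma measurable_derivative_profile :
  measurable_fun (`[0%R, r]%classic : set mR)
    (fun t => t ^+ m.+1 * - h' (t ^+ 2))%R.
Proof.
rewrite (_ : (fun t => _) = (fun t => 2^-1 * g t)%R).
  apply: measurable_funM; first exact: measurable_cst.
  exact/measurable_EFinP.
by apply/funext => t; rewrite /g -mulrA mulKf.
Qed.

End DerivativeIntegral.

Lemma Rintegral_profile_gt0 m r : 0 < r ->
  0 < \int[leb]_(t in `[0, r]) (t ^+ m * h (t ^+ 2)).
Proof.
move=> r0; rewrite /Rintegral; apply: fine_gt0; apply/andP; split; last first.
  by rewrite ltey_eq integral_profile_fin.
apply: integral_itv_gt0 => //.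
- by apply: measurable_funTS; apply: measurable_funM => //; exact: measurable_funX.
- by move=> t /andP[t0 _]; rewrite mulr_ge0 ?exprn_ge0 ?h0 ?sqr_ge0.
- by move=> t /andP[t0 _]; rewrite mulr_gt0 ?exprn_gt0 ?profile_gt0 ?sqr_ge0.
Qed.

Lemma Rintegral_derivative_profile m r : (0 < m)%N -> 0 < r ->
  let I := \int[leb]_(t in `[0, r]) (t ^+ m.+1 * h' (t ^+ 2)) in
  I < 0 /\ 2 * - I <= m%:R * \int[leb]_(t in `[0, r]) (t ^+ m.-1 * h (t ^+ 2)).
Proof.
move=> m0 r0 I.
pose a := (\int[leb]_(t in `[0%R, r]) (t ^+ m.+1 * - h' (t ^+ 2))%:E)%E.
pose b := (\int[leb]_(t in `[0%R, r]) (t ^+ m.-1 * h (t ^+ 2))%:E)%E.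
have in0r (t : mR) : (`[0%R, r]%classic : set mR) t -> 0 <= t.
  by rewrite /= in_itv /= => /andP[].
have aE : (\int[leb]_(t in `[0%R, r]) (2 * t ^+ m.+1 * - h' (t ^+ 2))%:E = 2%:E * a)%E.
  rewrite -ge0_integralZl//=.
  - by apply: eq_integral => t _; rewrite -EFinM mulrA.
  - by apply/measurable_EFinP; exact: measurable_derivative_profile.
  - move=> t /in0r t0.
    by rewrite lee_fin mulr_ge0 ?exprn_ge0// oppr_ge0 ltW// h'0// sqr_ge0.
have bE : (\int[leb]_(t in `[0%R, r]) (m%:R * (t ^+ m.-1 * h (t ^+ 2)))%:E = m%:R%:E * b)%E.
  rewrite -ge0_integralZl//=.
  - apply: measurable_funTS; apply/measurable_EFinP.
    by apply: measurable_funM => //; exact: measurable_funX.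
  - by move=> t /in0r t0; rewrite lee_fin mulr_ge0 ?exprn_ge0 ?h0 ?sqr_ge0.
have IE : I = - fine a.
  rewrite /I /Rintegral -fineN; congr fine; rewrite /a -integral_ge0N//.
    by apply: eq_integral => t _; rewrite -EFinN mulrN opprK.
  move=> t /in0r t0.
  by rewrite lee_fin mulr_ge0 ?exprn_ge0// oppr_ge0 ltW// h'0// sqr_ge0.
have := integral_derivative_profile_gt0 m r0.
have := integral_derivative_profile_le r m0.
have := integral_profile_fin m.-1 r; rewrite aE bE IE opprK /Rintegral -/b.
(* The upper bound rules out an infinite value; without this [fine] could return 0 and the strict
   sign of [I] would be lost. *)
move=> /fineK <-; clear aE IE; case: a => [c| |] /=.
- by rewrite -!EFinM lee_fin lte_fin => cb; rewrite pmulr_rgt0// oppr_lt0.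
- by rewrite gt0_muley ?lte_fin// -EFinM leye_eq.
- by rewrite gt0_muleNy ?lte_fin.
Qed.

End DecreasingProfile.

(** * The Borel structure of the product space *)

Section EprodMeasurability.
Context {R : realType} {K : nat} {E : 'I_K -> vectType R}.
Variable ip : forall k, {dot (E k) for idfun}.
Local Notation prodE := (eprod ip).
Local Notation dot := (eprod_dot (ip := ip) : {dot (eprod ip) for idfun}).
Local Notation q := (\dim {: eprod ip}).
Local Notation mR := (measurableTypeR R).

(** The sigma-algebra is generated by open sets, so it suffices that the preimage of ]a, +oo[ is
    open. Cauchy-Schwarz gives the radius, and the added 1 keeps its denominator positive. *)
Lemma measurable_dot (v : prodE) :
  measurable_fun [set: prodE] (fun x : prodE => dot v x : R).
Proof.
apply: (measurability _ (RGenOInfty.measurableE R)) => //.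
move=> _ [_ [a ->] <-]; rewrite setTI; apply: sub_sigma_algebra.
move=> x /=; rewrite in_itv /= andbT -[X in _ < X]/(dot v x) => ax.
have v1 : 0 < enorm dot v + 1 by rewrite ltr_wpDl ?enorm_ge0.
exists ((dot v x - a) / (enorm dot v + 1)).
  by rewrite divr_gt0// subr_gt0.
move=> y yx; rewrite /= in_itv /= andbT -[X in _ < X]/(dot v y).
have : - (dot v (y - x)) < dot v x - a.
  apply: le_lt_trans (ler_norm _) _; rewrite normrN.
  apply: le_lt_trans (CauchySchwarz_dot _ _ _) _.
  apply: (@le_lt_trans _ _ ((enorm dot v + 1) * enorm dot (y - x))).
    by rewrite ler_wpM2r ?enorm_ge0// lerDl.
  by rewrite mulrC -ltr_pdivlMr.
by rewrite dotBr opprB ltrD2l ltrN2.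
Qed.

Section Coordinates.
Variable e : q.-tuple prodE.
Hypothesis oe : orthonormal_basis dot e.

Definition of_coords (t : q.-tuple mR) : prodE :=
  \sum_i (tnth t i : R) *: tnth e i.

Lemma dot_of_coords t i : dot (tnth e i) (of_coords t) = tnth t i.
Proof.
rewrite dot_sumr (bigD1 i)//= big1 => [|j ji].
  by rewrite dotZr oe eqxx mulr1 addr0.
by rewrite dotZr oe eq_sym (negbTE ji) mulr0.
Qed.

Let rat_tuple (c : q.-tuple rat) : q.-tuple mR := [tuple ratr (tnth c i) | i < q].

Let dist_sq (c t : q.-tuple mR) : R := \sum_i (tnth t i - tnth c i) ^+ 2.

Let enorm_of_coords (c t : q.-tuple mR) :
  enorm dot (of_coords t - of_coords c) ^+ 2 = dist_sq c t.
Proof.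
rewrite enorm_sq (dot_expand oe); apply: eq_bigr => i _.
by rewrite dotBr !dot_of_coords expr2.
Qed.

Let measurable_box c (d : R) : measurable [set t | dist_sq c t < d].
Proof.
have m : measurable_fun setT (dist_sq c).
  apply: measurable_sum => i; apply: measurable_funX.
  by apply: measurable_funB; [exact: measurable_tnth|exact: measurable_cst].
have := m measurableT `]-oo, d[%classic (measurable_itv _).
by rewrite setTI; congr measurable; apply/seteqP; split => t /=; rewrite in_itv.
Qed.

Let rat_approx (t : q.-tuple mR) (d : R) : 0 < d ->
  exists c, dist_sq (rat_tuple c) t < d ^+ 2.
Proof.
move=> d0; pose n1 := q.+1%:R : R.
have n10 : 0 < n1 by rewrite ltr0n.
(* With q coordinates each within d / (q + 1), the squared distance is at most q d^2 / (q + 1)^2 <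
   d^2. *)
have eta0 : 0 < d / n1 by rewrite divr_gt0.
have rP i : exists c : rat, tnth t i - d / n1 < ratr c < tnth t i.
  have [|c] := @rat_in_itvoo R (tnth t i - d / n1) (tnth t i).
    by rewrite ltrBlDr ltrDl.
  by rewrite in_itv /= => cP; exists c.
have [c cP] := choice rP; exists [tuple c i | i < q].
apply: (@le_lt_trans _ _ (\sum_(i < q) (d / n1) ^+ 2)).
  apply: ler_sum => i _; rewrite !tnth_mktuple.
  have /andP[c1 c2] := cP i.
  have c3 : tnth t i - ratr (c i) <= d / n1 by rewrite lerBlDr -lerBlDl ltW.
  by rewrite ler_pXn2r ?nnegrE ?subr_ge0 ?(ltW c2) ?(ltW eta0).
rewrite sumr_const card_ord -mulr_natl exprMn exprVn.
rewrite mulrCA gtr_pMr ?exprn_gt0// ltr_pdivrMr ?exprn_gt0// mul1r.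
apply: (@lt_le_trans _ _ n1); first by rewrite ltr_nat.
by rewrite expr2 ler_pMr// ler1n.
Qed.

(** Tuples carry the product sigma-algebra while the target is generated by arbitrary open sets.
    Second countability bridges the two: the preimage of an open set is the union of the balls with
    rational centre and radius 1 / (k + 1) that it contains. *)
Lemma measurable_of_coords : measurable_fun setT of_coords.
Proof.
apply: (measurability (eopen dot)) => // _ [U oU <-]; rewrite setTI.
pose radius k : R := k.+1%:R^-1.
have radius0 k : 0 < radius k by rewrite invr_gt0.
pose box (ck : q.-tuple rat * nat) : set (q.-tuple mR) :=
  [set t | dist_sq (rat_tuple ck.1) t < radius ck.2 ^+ 2].
pose F n : set (q.-tuple mR) := if unpickle n is Some ck then
  (if `[< box ck `<=` of_coords @^-1` U >] then box ck else set0) else set0.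
suff -> : of_coords @^-1` U = \bigcup_n F n.
  apply: bigcupT_measurable => n; rewrite /F.
  case: unpickle => // ck; case: ifP => _ //; exact: measurable_box.
apply/seteqP; split => [t Ut|t [n _]]; last first.
  by rewrite /F; case: unpickle => // ck; case: ifPn => [/asboolP|//]; exact.
have [d d0 dU] := oU _ Ut.
have [k kd] : exists k, 2 * radius k < d.
  exists (Num.truncn (2 / d)); rewrite /radius ltr_pdivrMr// mulrC.
  by rewrite -ltr_pdivrMr// mulrC truncnS_gt.
have [c ct] := rat_approx t (radius0 k).
exists (pickle (c, k)) => //; rewrite /F pickleK /=.
rewrite ifT//; apply/asboolP => u ub /=; apply: dU.
have norm_lt v : dist_sq (rat_tuple c) v < radius k ^+ 2 ->
    enorm dot (of_coords v - of_coords (rat_tuple c)) < radius k.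
  by rewrite -enorm_of_coords ltr_pXn2r ?nnegrE ?enorm_ge0 ?ltW.
apply: le_lt_trans kd.
have -> : of_coords u - of_coords t =
    (of_coords u - of_coords (rat_tuple c)) - (of_coords t - of_coords (rat_tuple c)).
  by rewrite opprB addrA subrK.
apply: le_trans (enormD _ _ _) _; rewrite enormN mulr_natl mulr2n.
by rewrite lerD// ltW// norm_lt.
Qed.

End Coordinates.

(** The change of coordinates between two orthonormal bases is an orthogonal matrix. This frees the
    computation from the arbitrary basis [onb] and allows an eigenbasis of V. *)
Lemma integral_lebesgue_eprod (e : q.-tuple prodE) (f : prodE -> \bar R) :
  orthonormal_basis dot e -> measurable_fun setT f -> (forall x, 0 <= f x)%E ->
  (\int[lebesgue_eprod ip]_x f x = \int[lebesgue_tuple q]_t f (of_coords e t))%E.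
Proof.
move=> oe mf f0; pose b := onb dot; have ob : orthonormal_basis dot b := onbP dot.
have mb := measurable_of_coords ob.
transitivity (\int[lebesgue_tuple q]_t f (of_coords b t))%E.
  transitivity (\int[pushforward (lebesgue_tuple q) (of_coords b)]_x f x)%E => //.
  by rewrite [LHS]ge0_integral_pushforward//= ?preimage_setT.
pose A : 'M[R]_q := \matrix_(j, i) dot (tnth b j) (tnth e i).
have AA : A *m A^T = 1%:M.
  apply/matrixP => i j; rewrite !mxE.
  under eq_bigr do rewrite !mxE !(dotC dot (tnth b _)).
  by rewrite -(dot_expand oe) ob.
have := @integral_tmul R q A (fun t => f (of_coords b t)) AA.
move=> <-//; last by apply: (measurableT_comp mf).
apply: eq_integral => t _; congr f.
rewrite /of_coords; under eq_bigr do rewrite tnth_mktuple scaler_suml.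
rewrite exchange_big /=; apply: eq_bigr => i _.
rewrite [tnth e i in RHS](orthonormal_expand ob) scaler_sumr.
by apply: eq_bigr => j _; rewrite mxE scalerA mulrC.
Qed.

End EprodMeasurability.

(** * Truncated moments of an elliptical law *)

Section EllipticalLaw.
Context {R : realType} {K : nat} {E : 'I_K -> vectType R}.
Variable ip : forall k, {dot (E k) for idfun}.
Local Notation prodE := (eprod ip).
Local Notation dot := (eprod_dot (ip := ip) : {dot (eprod ip) for idfun}).
Local Notation q := (\dim {: eprod ip}).
Local Notation mR := (measurableTypeR R).
Local Notation leb := (@lebesgue_measure R).
Local Notation lam := (lebesgue_tuple q).
Variables (P : {measure set prodE -> \bar R}) (V : 'End(prodE)) (h h' : R -> R).
Variables (e : q.-tuple prodE) (d : 'I_q -> R).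
Hypotheses (oe : orthonormal_basis dot e)
  (Ve : forall i, V (tnth e i) = d i *: tnth e i) (d_gt0 : forall i, 0 < d i).
Hypotheses (h0 : forall t, 0 <= t -> 0 <= h t)
  (dh : has_derivative_on_nonneg h h') (h'0 : forall t, 0 <= t -> h' t < 0).
Hypothesis PV : elliptical_density P V h.

Lemma eigenbasis_lker0 : lker V == 0%VS.
Proof.
rewrite -subv0; apply/subvP => x; rewrite memv_ker memv0 => /eqP Vx.
rewrite (orthonormal_expand oe x) big1// => i' _.
have : dot (tnth e i') (V x) = 0 by rewrite Vx dot0r.
rewrite [in V x](orthonormal_expand oe x) linear_sum /= dot_sumr (bigD1 i')//=.
rewrite big1 => [|j ji]; last first.
  by rewrite lfunZ Ve !dotZr oe eq_sym (negbTE ji) !mulr0.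
rewrite lfunZ Ve !dotZr oe eqxx mulr1 addr0 => /eqP.
by rewrite mulf_eq0 (gt_eqF (d_gt0 _)) orbF => /eqP ->; rewrite scale0r.
Qed.

Lemma eigenbasis_inv i : (V^-1)%VF (tnth e i) = (d i)^-1 *: tnth e i.
Proof.
have V0 := eigenbasis_lker0.
apply: (lker0P V0); rewrite lker0_lfunVK// lfunZ Ve scalerA mulVf ?scale1r//.
by rewrite gt_eqF.
Qed.

Lemma mahalanobisE x :
  dot x ((V^-1)%VF x) = \sum_i (d i)^-1 * dot (tnth e i) x ^+ 2.
Proof.
rewrite [in (V^-1)%VF x](orthonormal_expand oe x) linear_sum /= dot_sumr.
apply: eq_bigr => i _; rewrite lfunZ eigenbasis_inv !dotZr (dotC dot x).
by rewrite mulrCA expr2.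
Qed.

Lemma mahalanobis_ge0 x : 0 <= dot x ((V^-1)%VF x).
Proof.
rewrite mahalanobisE sumr_ge0// => i _.
by rewrite mulr_ge0 ?sqr_ge0// invr_ge0 ltW.
Qed.

Lemma measurable_mahalanobis :
  measurable_fun [set: prodE] (fun x : prodE => dot x ((V^-1)%VF x) : R).
Proof.
under eq_fun do rewrite mahalanobisE.
apply: measurable_sum => i; apply: measurable_funM; first exact: measurable_cst.
by apply: measurable_funX; exact: measurable_dot.
Qed.

(** This is V^(1/2) in coordinates of the eigenbasis: it turns <x, V^-1 x> into |z|^2 and the
    ellipsoid into a ball. *)
Definition whiten (z : q.-tuple mR) : prodE :=
  of_coords e (taffine (fun i => Num.sqrt (d i)) (fun=> 0) z).

Lemma dot_whiten z i : dot (tnth e i) (whiten z) = Num.sqrt (d i) * tnth z i.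
Proof. by rewrite dot_of_coords// tnth_mktuple addr0. Qed.

Lemma mahalanobis_whiten z : dot (whiten z) ((V^-1)%VF (whiten z)) = tnorm z ^+ 2.
Proof.
rewrite mahalanobisE tnorm_sq; apply: eq_bigr => i _.
rewrite dot_whiten exprMn sqr_sqrtr ?ltW// mulrA mulVf ?mul1r// gt_eqF//.
Qed.

Lemma measurable_whiten : measurable_fun setT whiten.
Proof.
apply: measurableT_comp; first exact: measurable_of_coords.
exact: measurable_taffine.
Qed.

Let measurable_profile_sq : measurable_fun setT (fun t : R => h (t ^+ 2)).
Proof. by apply: continuous_measurable_fun; exact: continuous_profile_sq dh. Qed.

(** In whitened coordinates the density is h(|z|^2): the Jacobian, the product of the sqrt(d_i),
    cancels (det V)^(-1/2). *)
Lemma integral_elliptical (f : prodE -> \bar R) :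
  measurable_fun setT f -> (forall x, 0 <= f x)%E ->
  (\int[P]_x f x = \int[lam]_z ((h (tnorm z ^+ 2))%:E * f (whiten z)))%E.
Proof.
move=> mf f0; pose c := lfun_det V `^ (- 2^-1).
have c0 : 0 <= c by exact: powR_ge0.
have mb := measurable_of_coords (onbP dot).
pose mu : {measure set prodE -> \bar R} :=
  measure_function_pushforward__canonical__measure_function_Measure lam mb.
(* The quadratic form is nonnegative, so clamping changes no value; it only makes measurability
   available. *)
pose w (x : prodE) : R := c * clamped h (dot x ((V^-1)%VF x)).
have w0 x : 0 <= w x.
  by rewrite mulr_ge0// clampedE ?mahalanobis_ge0// h0// mahalanobis_ge0.
have mw : measurable_fun setT w.
  apply: measurable_funM; first exact: measurable_cst.
  apply: (@measurableT_comp _ _ _ _ _ _ (clamped h)).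
    by apply: continuous_measurable_fun; exact: continuous_clamped dh.
  exact: measurable_mahalanobis.
have PE A : measurable A -> P A = (\int[mu]_(x in A) (w x)%:E)%E.
  move=> mA; rewrite PV//; apply: eq_integral => x _.
  by rewrite /w clampedE// mahalanobis_ge0.
rewrite (integral_density mw w0 PE mf f0).
have mwf : measurable_fun setT (fun x => ((w x)%:E * f x)%E).
  by apply: emeasurable_funM => //; exact/measurable_EFinP.
have wf0 x : (0 <= (w x)%:E * f x)%E by rewrite mule_ge0 ?lee_fin.
transitivity (\int[lebesgue_eprod ip]_x ((w x)%:E * f x))%E; first by [].
rewrite (integral_lebesgue_eprod oe mwf wf0).
have mg : measurable_fun setT
    (fun t => ((w (of_coords e t))%:E * f (of_coords e t))%E).
  by apply: (measurableT_comp mwf); exact: measurable_of_coords.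
rewrite -(@integral_taffine R q (fun i => Num.sqrt (d i)) (fun=> 0) _ _ mg); last first.
- by move=> t; exact: wf0.
- by move=> i; rewrite gt_eqF// sqrtr_gt0.
have mhf : measurable_fun setT
    (fun z : q.-tuple mR => ((h (tnorm z ^+ 2))%:E * f (whiten z))%E).
  apply: emeasurable_funM; last first.
    by apply: (measurableT_comp mf); exact: measurable_whiten.
  apply/measurable_EFinP.
  exact: (measurableT_comp measurable_profile_sq (@measurable_tnorm R q)).
rewrite -ge0_integralZl; last first.
- by rewrite lee_fin prodr_ge0.
- by move=> z _; exact: wf0.
- by apply: (measurableT_comp mg); exact: measurable_taffine.
- exact: measurableT.
apply: eq_integral => z _; rewrite muleA -/(whiten z); congr (_ * _)%E.
rewrite -EFinM; congr EFin; rewrite /w mahalanobis_whiten clampedE ?sqr_ge0// mulrA.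
suff -> : \prod_i `|Num.sqrt (d i)| * c = 1 by rewrite mul1r.
rewrite /c (lfun_det_eigenbasis oe Ve).
have -> : \prod_i `|Num.sqrt (d i)| = (\prod_i d i) `^ 2^-1.
  rewrite powR12_sqrt ?prodr_ge0// => [|i _]; last exact: ltW.
  apply: (big_rec2 (fun x y => x = Num.sqrt y)); first by rewrite sqrtr1.
  move=> i x y _ ->; rewrite ger0_norm ?sqrtr_ge0// sqrtrM//.
  exact: ltW.
rewrite powRN mulfV// powR_eq0 negb_and gt_eqF//.
by apply: prodr_gt0.
Qed.

Variable r : R.
Hypotheses (q_gt0 : (0 < q)%N) (r_ge0 : 0 <= r).
Local Notation B := (ellipsoid V r).

Lemma ellipsoid_whiten z : B (whiten z) = (tnorm z <= r) :> Prop.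
Proof.
rewrite /ellipsoid /=; rewrite -[X in is_true (X <= _)]/(dot _ _).
by rewrite mahalanobis_whiten ler_pXn2r// nnegrE tnorm_ge0.
Qed.

Lemma measurable_ellipsoid : measurable B.
Proof.
have := measurable_mahalanobis measurableT (measurable_itv `]-oo, r ^+ 2]).
by rewrite setTI; congr measurable.
Qed.

Lemma radial_moments : exists2 C : R, 0 < C &
  [/\ pi `^ (q%:R / 2) / Gamma (q%:R / 2) = C * q%:R / 2,
      pi `^ (q%:R / 2) / Gamma (q%:R / 2 + 1) = C &
  forall m, (\int[lam]_z (tnorm z ^+ m * h (tnorm z ^+ 2) *
                            (tnorm z <= r)%R%:R)%:E =
    (C * q%:R)%:E * \int[leb]_(t in `[0%R, r]) (t ^+ (q.-1 + m) * h (t ^+ 2))%:E)%E].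
Proof.
have [C C0 [rad G1 G2]] := @Gamma_half R q q_gt0.
exists C => //; split => // m.
(* The absolute value keeps [phi] nonnegative on the whole line, as the radial formula demands. *)
pose phi (t : R) : \bar R := (`|t| ^+ m * h (t ^+ 2) * (t <= r)%R%:R)%:E.
have mphi : measurable_fun setT phi.
  apply/measurable_EFinP; apply: measurable_funM.
    apply: measurable_funM; last exact: measurable_profile_sq.
    apply: measurable_funX; apply: continuous_measurable_fun.
    exact: (@norm_continuous _ R^o).
  apply: (@measurable_comp _ _ _ _ _ _ setT (fun b : bool => b%:R : R)) => //.
  by apply: measurable_fun_ler => //; exact: measurable_cst.
have phi0 t : (0 <= phi t)%E by rewrite lee_fin !mulr_ge0 ?exprn_ge0 ?h0 ?sqr_ge0.
transitivity (\int[lam]_z phi (tnorm z))%E.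
  by apply: eq_integral => z _; rewrite /phi ger0_norm ?tnorm_ge0.
rewrite rad// integral_mkcond.
have in0r (t : mR) : (`[0%R, r]%classic : set mR) t -> 0 <= t.
  by rewrite /= in_itv /= => /andP[].
rewrite -ge0_integralZl//=.
- rewrite [RHS]integral_mkcond; apply: eq_integral => t _.
  rewrite !patchE !mem_setE !in_itv /= andbT.
  have [t0|//] := leP 0 t; rewrite /phi /=; case: (t <= r).
    by rewrite -!EFinM ger0_norm// exprD mulr1 !mulrA.
  by rewrite mulr0 mule0.
- apply: measurable_funTS; apply/measurable_EFinP.
  by apply: measurable_funM => //; exact: measurable_funX.
- by move=> t /in0r t0; rewrite lee_fin mulr_ge0 ?exprn_ge0 ?h0 ?sqr_ge0.
- by rewrite lee_fin mulr_ge0// ltW.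
Qed.

Hypothesis gamma_gt0 : 0 < radial_mass q h r.
Local Notation gamma := (radial_mass q h r).

Let q0 : 0 < q%:R :> R. Proof. by rewrite ltr0n. Qed.

Lemma ellipsoid_mass : P B = gamma%:E.
Proof.
have [C C0 [G1 _ M]] := radial_moments.
have -> : P B = (\int[P]_x (\1_B x)%:E)%E.
  by rewrite integral_indic ?setIT//; exact: measurable_ellipsoid.
rewrite integral_elliptical; last first.
- by move=> x; rewrite lee_fin.
- by apply/measurable_EFinP; apply: measurable_indic; exact: measurable_ellipsoid.
transitivity (\int[lam]_z (tnorm z ^+ 0 * h (tnorm z ^+ 2) * (tnorm z <= r)%R%:R)%:E)%E.
  apply: eq_integral => z _; rewrite -EFinM expr0 mul1r; congr ((_ * _)%:E).
  rewrite indicE; congr ((nat_of_bool _)%:R).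
  by apply/idP/idP; rewrite inE ellipsoid_whiten.
rewrite M addn0 /radial_mass.
have -> : 2 * pi `^ (q%:R / 2) / Gamma (q%:R / 2) = C * q%:R by rewrite -mulrA G1; field.
rewrite [in RHS]EFinM /Rintegral fineK//; exact: integral_profile_fin dh _ _.
Qed.

Lemma radius_gt0 : 0 < r.
Proof.
rewrite lt_neqAle r_ge0 andbT; apply/eqP => r0; move: gamma_gt0.
by rewrite /radial_mass -r0 set_itv1 /Rintegral integral_set1 mulr0 ltxx.
Qed.

Lemma whiten_tmul (A : 'M[R]_q) z i :
  dot (tnth e i) (whiten (tmul A z)) = Num.sqrt (d i) * \sum_j A i j * tnth z j.
Proof. by rewrite dot_whiten tnth_mktuple. Qed.

(** The whitened density depends on the norm alone, so orthogonal changes of the whitened variable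
    preserve the law. *)
Lemma integral_elliptical_tmul (A : 'M[R]_q) (f g : prodE -> \bar R) :
  A *m A^T = 1%:M -> measurable_fun setT f -> (forall x, 0 <= f x)%E ->
  measurable_fun setT g -> (forall x, 0 <= g x)%E ->
  (forall z, f (whiten (tmul A z)) = g (whiten z)) ->
  (\int[P]_x f x = \int[P]_x g x)%E.
Proof.
move=> AA mf f0 mg g0 fg; rewrite !integral_elliptical//.
pose k (z : q.-tuple mR) := ((h (tnorm z ^+ 2))%:E * f (whiten z))%E.
have mk : measurable_fun setT k.
  apply: emeasurable_funM; last by apply: (measurableT_comp mf); exact: measurable_whiten.
  apply/measurable_EFinP.
  exact: (measurableT_comp measurable_profile_sq (@measurable_tnorm R q)).
have k0 z : (0 <= k z)%E by rewrite mule_ge0 ?lee_fin ?h0 ?sqr_ge0.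
rewrite -[LHS](integral_tmul AA mk k0); apply: eq_integral => z _.
by rewrite /k fg tnorm_tmul// (mulmx1C AA).
Qed.

(* The positive and negative parts of [F] have the same integral [a], and
   [fine (a - a) = 0] even when [a] is infinite. *)
Lemma Rintegral_elliptical_odd (A : 'M[R]_q) (F : prodE -> R) :
  A *m A^T = 1%:M -> measurable_fun setT F ->
  (forall z, F (whiten (tmul A z)) = - F (whiten z)) ->
  \int[P]_(x in B) F x = 0.
Proof.
move=> AA mF FA; have mB := measurable_ellipsoid.
pose G x := (F x * \1_B x)%R.
have mG : measurable_fun setT G by apply: measurable_funM => //; exact: measurable_indic.
have GA z : G (whiten (tmul A z)) = - G (whiten z).
  rewrite /G FA mulNr; congr (- (_ * _)); rewrite !indicE; congr ((nat_of_bool _)%:R).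
  by apply/idP/idP; rewrite !inE !ellipsoid_whiten tnorm_tmul// (mulmx1C AA).
have -> : \int[P]_(x in B) F x = \int[P]_x G x.
  rewrite /Rintegral integral_mkcond; congr fine; apply: eq_integral => x _.
  by rewrite patchE /G indicE; case: ifP => _; rewrite ?mulr1// mulr0.
rewrite /Rintegral integralE.
have -> : (\int[P]_x ((fun x => (G x)%:E)^\+ x) = \int[P]_x ((fun x => (G x)%:E)^\- x))%E.
  apply: (integral_elliptical_tmul AA).
  - by apply: measurable_funepos; exact/measurable_EFinP.
  - by move=> x; exact: funepos_ge0.
  - by apply: measurable_funeneg; exact/measurable_EFinP.
  - by move=> x; exact: funeneg_ge0.
  - by move=> z; rewrite funeposE funenegE GA EFinN.
by case: (integral _ _ _) => [a| |] //=; rewrite subrr.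
Qed.

Lemma measurable_dot2 (u v : prodE) :
  measurable_fun [set: prodE] (fun x : prodE => dot u x * dot v x : R).
Proof. by apply: measurable_funM; exact: measurable_dot. Qed.

(** The reflection of one coordinate; it makes the first moments and the cross moments odd, hence
    zero. *)
Let flip (i : 'I_q) : 'M[R]_q := diag_mx (\row_k (if k == i then -1 else 1)).

Let flipE i z k : (\sum_j flip i k j * tnth z j) = (if k == i then -1 else 1) * tnth z k.
Proof.
rewrite (bigD1 k)//= big1 => [|j jk]; first by rewrite !mxE eqxx mulr1n addr0.
by rewrite !mxE [k == j]eq_sym (negbTE jk) mulr0n mul0r.
Qed.

Let flip_orthogonal i : flip i *m (flip i)^T = 1%:M.
Proof.
rewrite tr_diag_mx mulmx_diag -diag_const_mx; congr diag_mx.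
by apply/rowP => k; rewrite !mxE; case: ifP => _; rewrite ?mulrNN mulr1.
Qed.

Lemma ellipsoid_first_moment i : \int[P]_(x in B) dot (tnth e i) x = 0.
Proof.
apply: (Rintegral_elliptical_odd (flip_orthogonal i)); first exact: measurable_dot.
by move=> z; rewrite whiten_tmul flipE eqxx mulN1r mulrN dot_whiten.
Qed.

Lemma ellipsoid_cross_moment i j : i != j ->
  \int[P]_(x in B) (dot (tnth e i) x * dot (tnth e j) x) = 0.
Proof.
move=> ij.
apply: (Rintegral_elliptical_odd (flip_orthogonal i)); first exact: measurable_dot2.
move=> z; rewrite !whiten_tmul !flipE eqxx [j == i]eq_sym (negbTE ij) mul1r.
by rewrite !dot_whiten mulN1r mulrN mulNr.
Qed.

Let swap_orthogonal (i j : 'I_q) : tperm_mx i j *m (tperm_mx i j)^T = 1%:M :> 'M[R]_q.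
Proof. by rewrite tr_tperm_mx -perm_mxM tperm2 perm_mx1. Qed.

(** Transpositions of the whitened coordinates show that the moments divided by d_k are all equal.
    Their sum is the truncated expectation of <x, V^-1 x>, a radial integral, so each one is a q-th
    of it. *)
Lemma ellipsoid_second_moment i :
  \int[P]_(x in B) (dot (tnth e i) x * dot (tnth e i) x) =
  gamma * sigma2 q h gamma r * d i.
Proof.
pose J k : \bar R := (\int[P]_x ((d k)^-1 * dot (tnth e k) x ^+ 2 * \1_B x)%:E)%E.
have mJ k : measurable_fun [set: prodE]
    (fun x => ((d k)^-1 * dot (tnth e k) x ^+ 2 * \1_B x)%:E).
  apply/measurable_EFinP; apply: measurable_funM.
    by apply: measurable_funM => //; apply: measurable_funX; exact: measurable_dot.
  by apply: measurable_indic; exact: measurable_ellipsoid.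
have fJ0 k x : (0 <= ((d k)^-1 * dot (tnth e k) x ^+ 2 * \1_B x)%:E)%E.
  by rewrite lee_fin mulr_ge0 ?indicE// mulr_ge0 ?sqr_ge0// invr_ge0 ltW.
have Jij k l : J k = J l.
  apply: (integral_elliptical_tmul (swap_orthogonal k l)) => // z.
  congr EFin; congr (_ * _); last first.
    rewrite !indicE; congr ((nat_of_bool _)%:R); apply/idP/idP;
    by rewrite !inE !ellipsoid_whiten tnorm_tmul// (mulmx1C (swap_orthogonal k l)).
  rewrite whiten_tmul dot_whiten (bigD1 l)//= big1 => [|j jl].
    rewrite !mxE tpermL eqxx mul1r addr0 !exprMn !sqr_sqrtr ?ltW//.
    by rewrite !mulrA !mulVf// gt_eqF.
  by rewrite !mxE tpermL [l == j]eq_sym (negbTE jl) mul0r.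
have [C C0 [G1 _ M]] := radial_moments.
pose S := \int[leb]_(t in `[0, r]) (t ^+ q.+1 * h (t ^+ 2)).
have Ssum : (\sum_k J k = (C * q%:R * S)%:E)%E.
  rewrite /J -ge0_integral_sum//.
  rewrite integral_elliptical; last first.
  - by move=> x; apply: sume_ge0 => k _.
  - exact: emeasurable_sum.
  transitivity (\int[lam]_z (tnorm z ^+ 2 * h (tnorm z ^+ 2) * (tnorm z <= r)%R%:R)%:E)%E.
    apply: eq_integral => z _; rewrite sumEFin -EFinM; congr EFin.
    rewrite -mulr_suml -mahalanobisE mahalanobis_whiten mulrA [h _ * _]mulrC.
    congr (_ * _); rewrite indicE; congr ((nat_of_bool _)%:R).
    by apply/idP/idP; rewrite inE ellipsoid_whiten.
  rewrite M (_ : (q.-1 + 2)%N = q.+1); last by rewrite addn2 prednK.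
  by rewrite [in RHS]EFinM /S /Rintegral fineK//; exact: integral_profile_fin dh _ _.
have Ji : J i = (C * S)%:E.
  have : (\sum_(k < q) J i = (C * q%:R * S)%:E)%E.
    by rewrite -Ssum; apply: eq_bigr => k _; exact: Jij.
  have : (0 <= J i)%E by apply: integral_ge0 => x _; exact: fJ0.
  (* An infinite common value would make the sum infinite, against [Ssum]. *)
  case: (J i) => [a _| _ |//].
    rewrite sumEFin sumr_const card_ord -[a *+ _]mulr_natl => -[aE]; congr EFin.
    by apply: (mulfI (lt0r_neq0 q0)); rewrite aE; ring.
  by rewrite (bigD1 i)//= addye// gt_eqF// (lt_le_trans (ltNyr 0))// sume_ge0.
have -> : sigma2 q h gamma r = C * S / gamma.
  rewrite /sigma2 -/S.
  have g0 : Gamma (q%:R / 2) != 0 :> R.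
    apply/eqP => g0; move: G1; rewrite g0 invr0 mulr0 => /eqP.
    by rewrite eq_sym mulf_eq0 invr_eq0 pnatr_eq0 orbF gt_eqF// mulr_gt0.
  have -> : pi `^ (q%:R / 2) = C * q%:R / 2 * Gamma (q%:R / 2) by rewrite -G1 divfK.
  by field; rewrite g0 !gt_eqF.
rewrite mulrCA mulfV ?gt_eqF// mulr1.
have -> : \int[P]_(x in B) (dot (tnth e i) x * dot (tnth e i) x) =
    fine ((d i)%:E * J i)%E.
  rewrite /Rintegral integral_mkcond /J -ge0_integralZl//; last first.
    by rewrite lee_fin ltW.
  congr fine; apply: eq_integral => x _; rewrite patchE -EFinM indicE expr2.
  case: ifP => _; rewrite ?mulr0// mulr1 !mulrA divff ?mul1r// gt_eqF//.
by rewrite Ji -EFinM /= mulrC.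
Qed.

End EllipticalLaw.

(** * Vector integrals and contamination *)

Section VectorIntegral.
Context d (T : measurableType d) {R : realType} {V : vectType R}.
Variables (mu : {measure set T -> \bar R}) (D : set T).
Hypothesis mD : measurable D.

Lemma Rintegral_sum (I : finType) (s : I -> T -> R) :
  (forall m, mu.-integrable D (EFin \o s m)) ->
  \int[mu]_(t in D) (\sum_m s m t) = \sum_m \int[mu]_(t in D) s m t.
Proof.
move=> si; rewrite /Rintegral.
under eq_integral do rewrite -sumEFin.
rewrite (@integral_sum _ _ _ mu D mD _ (fun m t => (s m t)%:E))//.
by rewrite -sum_fine// => m _; exact: (integrable_fin_num mD (si m)).
Qed.

(** It replaces the basis [vbasis] in [vintegral] by any finite family along which the integrand is
    expanded, such as an orthonormal basis or its tensors. *)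
Lemma vintegral_lincomb (I : finType) (s : I -> T -> R) (v : I -> V) (F : T -> V) :
  (forall m, mu.-integrable D (EFin \o s m)) ->
  (forall t, F t = \sum_m s m t *: v m) ->
  vintegral mu D F = \sum_m (\int[mu]_(t in D) s m t) *: v m.
Proof.
move=> si FE; rewrite /vintegral; pose b := vbasis {:V}.
transitivity (\sum_(i < \dim {:V}) \sum_m
    ((\int[mu]_(t in D) s m t) * coord b i (v m)) *: b`_i).
  apply: eq_bigr => i _; rewrite -scaler_suml; congr (_ *: _).
  under eq_Rintegral => t _.
    rewrite FE linear_sum /=; under eq_bigr do rewrite linearZ /=; over.
  rewrite (@Rintegral_sum _ (fun m t => s m t * coord b i (v m))) => [|m].
    by apply: eq_bigr => m _; rewrite RintegralZr.
  have := integrableZl mD (coord b i (v m)) (si m).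
  by apply: eq_integrable => // t _ /=; rewrite -EFinM mulrC.
rewrite exchange_big /=; apply: eq_bigr => m _.
rewrite [v m in RHS](coord_vbasis (memvf (v m))) scaler_sumr.
by apply: eq_bigr => i _; rewrite scalerA.
Qed.

End VectorIntegral.

Section Contamination.
Context d (T : measurableType d) {R : realType}.
Variables (P : {measure set T -> \bar R}) (D : set T) (x : T).
Hypotheses (mD : measurable D) (PD : (P D < +oo)%E).

Lemma bounded_integrable (mu : {measure set T -> \bar R}) (s : T -> R) (M : R) :
  (mu D < +oo)%E -> measurable_fun setT s -> (forall t, D t -> `|s t| <= M) ->
  mu.-integrable D (EFin \o s).
Proof.
move=> muD ms sM; apply: measurable_bounded_integrable => //.
  exact: measurable_funTS.
exists M; split; first exact: num_real.
by move=> y My t Dt; exact: le_trans (sM t Dt) (ltW My).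
Qed.

Lemma integral_mscale (k : {nonneg R}) (mu : {measure set T -> \bar R}) (f : T -> \bar R) :
  mu.-integrable D f ->
  (\int[mscale k mu]_(t in D) f t = k%:num%:E * \int[mu]_(t in D) f t)%E.
Proof.
move=> fi; have mf := measurable_int _ fi.
have E1 : (\int[mscale k mu]_(t in D) f^\+ t = k%:num%:E * \int[mu]_(t in D) f^\+ t)%E.
  by apply: ge0_integral_mscale => //; exact: measurable_funepos.
have E2 : (\int[mscale k mu]_(t in D) f^\- t = k%:num%:E * \int[mu]_(t in D) f^\- t)%E.
  by apply: ge0_integral_mscale => //; exact: measurable_funeneg.
rewrite (integralE (mscale k mu) D f) (integralE mu D f) E1 E2.
have F1 : (\int[mu]_(t in D) f^\+ t \is a fin_num)%E.
  by apply: integrable_fin_num => //; exact: integrable_funepos.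
have F2 : (\int[mu]_(t in D) f^\- t \is a fin_num)%E.
  by apply: integrable_fin_num => //; exact: integrable_funeneg.
by rewrite -(fineK F1) -(fineK F2) -!EFinM -!EFinB; congr EFin; rewrite mulrBr.
Qed.

Lemma contaminate_lty e : (contaminate P x e D < +oo)%E.
Proof.
have -> : contaminate P x e D = ((Num.max 0 (1 - e))%:E * P D + (Num.max 0 e)%:E * \d_x D)%E.
  exact: measure_addE.
rewrite lte_add_pinfty// lte_mul_pinfty// ?lee_fin ?le_max ?lexx//.
by rewrite diracE ltry.
Qed.

Lemma Rintegral_contaminate (s : T -> R) (M e : R) : 0 <= e <= 1 ->
  measurable_fun setT s -> (forall t, D t -> `|s t| <= M) ->
  \int[contaminate P x e]_(t in D) s t =
  (1 - e) * (\int[P]_(t in D) s t) + e * (\1_D x * s x).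
Proof.
move=> /andP[e0 e1] ms sM.
have iP := bounded_integrable PD ms sM.
have dD : (dirac x D < +oo :> \bar R)%E by rewrite diracE ltry.
have iD := bounded_integrable dD ms sM.
have mE : measurable_fun D (EFin \o s) := measurable_int _ iP.
rewrite /Rintegral /contaminate integral_measure_add//=; last 2 first.
- apply: (bounded_integrable _ ms sM); rewrite /mscale /=.
  by rewrite lte_mul_pinfty// ?lee_fin ?le_max ?lexx.
- apply: (bounded_integrable _ ms sM); rewrite /mscale /=.
  by rewrite lte_mul_pinfty// ?lee_fin ?le_max ?lexx.
rewrite !integral_mscale// integral_dirac//= diracE.
have -> : Num.max 0 (1 - e) = 1 - e by apply/max_idPr; rewrite subr_ge0.
have -> : Num.max 0 e = e by exact/max_idPr.
have /fineK <- : (\int[P]_(t in D) (s t)%:E \is a fin_num)%E by exact: integrable_fin_num.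
by rewrite -!EFinM -EFinD /= indicE.
Qed.

End Contamination.

(** * Block components of operators *)

Section Components.
Context {R : realType} {K : nat} {E : 'I_K -> vectType R}.
Variable ip : forall k, {dot (E k) for idfun}.
Local Notation prodE := (eprod ip).
Local Notation dot := (eprod_dot (ip := ip) : {dot (eprod ip) for idfun}).
Implicit Types (x y z : prodE) (A B V : 'End(prodE)).

Lemma tauE k x : tau ip k x = proj k x.
Proof. by rewrite lfunE. Qed.

Lemma dot_tau k x (y : E k) : ip k (proj k x) y = dot x (tau_adj ip k y).
Proof. by rewrite -tauE (adjointP dot (ip k)). Qed.

(** The orthogonal projection onto the k-th factor, seen inside the product. *)
Definition component k : 'End(prodE) := (tau_adj ip k \o tau ip k)%VF.

Lemma dot_component k x y : dot x (component k y) = ip k (proj k x) (proj k y).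
Proof. by rewrite comp_lfunE -dot_tau tauE. Qed.

Lemma component_self_adjoint k : self_adjoint dot (component k).
Proof. by move=> x y; rewrite (dotC dot) !dot_component (dotC (ip k)). Qed.

Lemma enorm_proj_sq x : enorm dot x ^+ 2 = \sum_k enorm (ip k) (proj k x) ^+ 2.
Proof. by rewrite enorm_sq; apply: eq_bigr => k _; rewrite enorm_sq. Qed.

Lemma enorm_proj k x : enorm (ip k) (proj k x) <= enorm dot x.
Proof.
rewrite -(ler_pXn2r (n := 2))// ?nnegrE ?enorm_ge0// enorm_proj_sq (bigD1 k)//=.
by rewrite lerDl sumr_ge0// => j _; rewrite sqr_ge0.
Qed.

Lemma opnorm_component k : opnorm dot (component k) <= 1.
Proof.
apply: opnorm_le_dual => // x y; rewrite mul1r (dotC dot) dot_component.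
apply: le_trans (CauchySchwarz_dot _ _ _) _; rewrite mulrC.
by rewrite ler_pM ?enorm_ge0// enorm_proj.
Qed.

Lemma diag_partE A : diag_part A = \sum_k (component k \o (A \o component k))%VF.
Proof. by apply: eq_bigr => k _; rewrite /component !comp_lfunA. Qed.

Lemma dot_diag_part A x y :
  dot (diag_part A x) y = \sum_k dot (A (component k x)) (component k y).
Proof.
rewrite diag_partE sum_lfunE dot_suml; apply: eq_bigr => k _.
by rewrite comp_lfunE component_self_adjoint comp_lfunE.
Qed.

Lemma offdiag_partE A : offdiag_part A =
  \sum_k \sum_(l | l != k) (component k \o (A \o component l))%VF.
Proof.
by apply: eq_bigr => k _; apply: eq_bigr => l _; rewrite /component !comp_lfunA.
Qed.

Lemma diag_part_lin a b A B :
  diag_part (a *: A + b *: B) = a *: diag_part A + b *: diag_part B.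
Proof.
rewrite !diag_partE !scaler_sumr -big_split; apply: eq_bigr => k _ /=.
by rewrite comp_lfunDl comp_lfunDr -!comp_lfunZl -!comp_lfunZr.
Qed.

Lemma offdiag_part_lin a b A B :
  offdiag_part (a *: A + b *: B) = a *: offdiag_part A + b *: offdiag_part B.
Proof.
rewrite !offdiag_partE !scaler_sumr -big_split; apply: eq_bigr => k _ /=.
rewrite !scaler_sumr -big_split; apply: eq_bigr => l _ /=.
by rewrite comp_lfunDl comp_lfunDr -!comp_lfunZl -!comp_lfunZr.
Qed.

Lemma opnorm_offdiag_part A :
  opnorm dot (offdiag_part A) <= K%:R * (K%:R - 1) * opnorm dot A.
Proof.
rewrite offdiag_partE; apply: le_trans (opnorm_sum _ _ _ _) _.
apply: (@le_trans _ _ (\sum_(k < K) (K%:R - 1) * opnorm dot A)); last first.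
  by rewrite sumr_const card_ord -[leLHS]mulr_natl mulrA.
apply: ler_sum => k _; apply: le_trans (opnorm_sum _ _ _ _) _.
apply: (@le_trans _ _ (\sum_(l < K | l != k) opnorm dot A)).
  apply: ler_sum => l _; rewrite -[leRHS]mul1r.
  apply: le_trans (opnorm_comp _ _ _) _.
  rewrite ler_pM ?opnorm_ge0 ?opnorm_component//.
  apply: le_trans (opnorm_comp _ _ _) _.
  by rewrite -[leRHS]mulr1 ler_pM ?opnorm_ge0 ?opnorm_component.
rewrite sumr_const -[leLHS]mulr_natl (_ : #|_| = K.-1); last first.
  by rewrite (cardC1 k) card_ord.
have K0 : (0 < K)%N := leq_ltn_trans (leq0n k) (ltn_ord k).
by rewrite -subn1 natrB.
Qed.

Lemma opnorm_tensor x : opnorm dot (tensor dot x x) <= enorm dot x ^+ 2.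
Proof.
apply: opnorm_le => [|y]; first exact: sqr_ge0.
rewrite tensorE enormZ expr2 -mulrA [leRHS]mulrCA [leLHS]mulrC.
by rewrite ler_wpM2l ?enorm_ge0// CauchySchwarz_dot.
Qed.

(** Blockwise Cauchy-Schwarz leaves the sum of |x_k|^2 |y_k| |z_k|, at most |x|^2 |y| |z|. That no
    factor [K] is lost here keeps K (K - 1) in the final bound. *)
Lemma opnorm_diag_part_tensor x :
  opnorm dot (diag_part (tensor dot x x)) <= enorm dot x ^+ 2.
Proof.
apply: opnorm_le_dual => [|y z]; first exact: sqr_ge0.
rewrite dot_diag_part enorm_proj_sq.
apply: le_trans (ler_norm_sum _ _ _) _; rewrite -mulrA mulr_suml.
apply: ler_sum => k _; rewrite tensorE dotZl !dot_component normrM expr2 -[leRHS]mulrA.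
set a := enorm _ (proj k x).
apply: (@le_trans _ _ ((a * enorm (ip k) (proj k y)) * (a * enorm (ip k) (proj k z)))).
  by rewrite ler_pM ?CauchySchwarz_dot.
rewrite mulrACA -mulrA ler_wpM2l ?enorm_ge0// ler_wpM2l ?enorm_ge0//.
by rewrite ler_pM ?enorm_ge0 ?enorm_proj.
Qed.

Lemma psd_diag_part A : psd dot A -> psd dot (diag_part A).
Proof.
move=> [sA pA]; split => [x y|x]; rewrite 1?(dotC dot x) !dot_diag_part.
  by apply: eq_bigr => k _; rewrite sA (dotC dot).
by rewrite sumr_ge0// => k _; rewrite (dotC dot).
Qed.

Lemma psd_lin a b A x : 0 <= a -> 0 <= b -> psd dot A ->
  psd dot (a *: A + b *: tensor dot x x).
Proof.
move=> a0 b0 [sA pA]; split => [y z|y]; rewrite !add_lfunE !scale_lfunE !tensorE.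
  by rewrite dotDl dotDr !dotZl !dotZr sA (dotC dot y x); congr (_ + _); ring.
rewrite dotDr !dotZr (dotC dot y x) -expr2 addr_ge0//.
  by rewrite mulr_ge0.
by rewrite mulr_ge0// sqr_ge0.
Qed.

(* Writing [x = S (S (V^-1 x))] gives
   [|x|^2 <= |S|^2 |S (V^-1 x)|^2 = |S|^2 <x, V^-1 x>]. *)
Lemma enorm_sq_le_mahalanobis V x : psd dot V -> lker V == 0%VS ->
  enorm dot x ^+ 2 <= opnorm dot (psd_sqrt dot V) ^+ 2 * dot x ((V^-1)%VF x).
Proof.
move=> pV V0; have [[sS _] SS] := psd_sqrtP pV; set S := psd_sqrt _ _ in sS SS *.
set y := (V^-1)%VF x; have Vy : V y = x by rewrite lker0_lfunVK.
have -> : dot x y = enorm dot (S y) ^+ 2.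
  by rewrite enorm_sq sS SS Vy (dotC dot).
rewrite -{1}Vy -SS -exprMn ler_pXn2r ?nnegrE ?mulr_ge0 ?enorm_ge0 ?opnorm_ge0//.
exact: le_opnorm.
Qed.

End Components.

Section SecondMoment.
Context d (T : measurableType d) {R : realType} {W : vectType R}.
Variable ip : {dot W for idfun}.
Variables (mu : {measure set T -> \bar R}) (D : set T) (Y : T -> W).
Hypothesis mD : measurable D.
Local Notation n := (\dim {:W}).

Lemma tensor_expand (e : n.-tuple W) x : orthonormal_basis ip e ->
  tensor ip x x = \sum_(p : 'I_n * 'I_n)
    (ip (tnth e p.1) x * ip (tnth e p.2) x) *: tensor ip (tnth e p.1) (tnth e p.2).
Proof.
move=> oe; apply/lfunP => z; apply: (dot_ext (ip := ip)) => w.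
rewrite sum_lfunE tensorE dotZl (dot_expand oe x z) (dot_expand oe x w).
rewrite big_distrlr pair_big dot_suml; apply: eq_bigr => -[i j] _ /=.
by rewrite scale_lfunE tensorE !dotZl; ring.
Qed.

Lemma dot_vintegral u :
  (forall v, mu.-integrable D (fun t => (ip v (Y t))%:E)) ->
  ip u (vintegral mu D Y) = \int[mu]_(t in D) ip u (Y t).
Proof.
move=> Yi; pose e := onb ip; have oe : orthonormal_basis ip e := onbP ip.
rewrite (@vintegral_lincomb _ _ _ _ _ _ mD _ (fun i t => ip (tnth e i) (Y t))
  (fun i => tnth e i))//; last first.
- by move=> t; exact: orthonormal_expand.
- by move=> i; exact: Yi.
rewrite dot_sumr; under [RHS]eq_Rintegral do rewrite (dot_expand oe).
rewrite (@Rintegral_sum _ _ _ _ _ mD _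
  (fun i t => ip (tnth e i) u * ip (tnth e i) (Y t))) => [|i].
  apply: eq_bigr => i _; rewrite dotZr RintegralZl ?(dotC ip u)//; last exact: Yi.
  by rewrite mulrC.
have := integrableZl mD (ip (tnth e i) u) (Yi (tnth e i)).
by apply: eq_integrable.
Qed.

Lemma dot_vintegral_tensor u v :
  (forall u v, mu.-integrable D (fun t => (ip u (Y t) * ip v (Y t))%:E)) ->
  ip u (vintegral mu D (fun t => tensor ip (Y t) (Y t)) v) =
  \int[mu]_(t in D) (ip u (Y t) * ip v (Y t)).
Proof.
move=> Yi; pose e := onb ip; have oe : orthonormal_basis ip e := onbP ip.
rewrite (@vintegral_lincomb _ _ _ _ _ _ mD _
  (fun (p : 'I_n * 'I_n) t => ip (tnth e p.1) (Y t) * ip (tnth e p.2) (Y t))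
  (fun p => tensor ip (tnth e p.1) (tnth e p.2)))//; last first.
- by move=> t; exact: tensor_expand.
- by move=> p; exact: Yi.
rewrite sum_lfunE dot_sumr.
pose c (p : 'I_n * 'I_n) := ip (tnth e p.1) v * ip (tnth e p.2) u.
under [RHS]eq_Rintegral => t _.
  rewrite mulrC (dot_expand oe v) (dot_expand oe u) big_distrlr pair_big /=; over.
transitivity (\int[mu]_(t in D) \sum_(p : 'I_n * 'I_n)
    c p * (ip (tnth e p.1) (Y t) * ip (tnth e p.2) (Y t))).
  rewrite (@Rintegral_sum _ _ _ _ _ mD _
    (fun p t => c p * (ip (tnth e p.1) (Y t) * ip (tnth e p.2) (Y t)))) => [|p].
    apply: eq_bigr => p _; rewrite scale_lfunE tensorE !dotZr RintegralZl//; last exact: Yi.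
    by rewrite (dotC ip u) [RHS]mulrC.
  have := integrableZl mD (c p) (Yi (tnth e p.1) (tnth e p.2)).
  by apply: eq_integrable.
by apply: eq_Rintegral => t _; apply: eq_bigr => -[i j] _ /=; rewrite /c /= mulrACA.
Qed.

End SecondMoment.

(** * Truncated covariance under contamination *)

Section TrimmedMoments.
Context {R : realType} {K : nat} {E : 'I_K -> vectType R}.
Variable ip : forall k, {dot (E k) for idfun}.
Local Notation prodE := (eprod ip).
Local Notation dot := (eprod_dot (ip := ip) : {dot (eprod ip) for idfun}).
Local Notation q := (\dim {: eprod ip}).
Variables (P : {measure set prodE -> \bar R}) (V : 'End(prodE)) (h h' : R -> R).
Variables (e : q.-tuple prodE) (d : 'I_q -> R) (r : R).
Hypotheses (oe : orthonormal_basis dot e)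
  (Ve : forall i, V (tnth e i) = d i *: tnth e i) (d_gt0 : forall i, 0 < d i).
Hypotheses (h0 : forall t, 0 <= t -> 0 <= h t)
  (dh : has_derivative_on_nonneg h h').
Hypothesis PV : elliptical_density P V h.
Hypotheses (q_gt0 : (0 < q)%N) (r_ge0 : 0 <= r).
Hypothesis gamma_gt0 : 0 < radial_mass q h r.
Local Notation gamma := (radial_mass q h r).
Local Notation sigma2 := (sigma2 q h (radial_mass q h r) r).
Local Notation B := (ellipsoid V r).

Lemma eigenbasis_psd : psd dot V.
Proof.
have VE x y : dot x (V y) = \sum_i d i * (dot (tnth e i) x * dot (tnth e i) y).
  rewrite [in V y](orthonormal_expand oe y) linear_sum /= dot_sumr.
  apply: eq_bigr => i _; rewrite lfunZ Ve !dotZr (dotC dot x) mulrCA.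
  by rewrite (mulrC (dot _ y)).
split=> [x y|x]; last first.
  by rewrite VE sumr_ge0// => i _; rewrite mulr_ge0 ?(ltW (d_gt0 i))// -expr2 sqr_ge0.
rewrite (dotC dot (V x)) !VE; apply: eq_bigr => i _; congr (_ * _).
by rewrite mulrC.
Qed.

(** Radius of a ball containing the ellipsoid: the integrands are bounded on [B], hence integrable
    for the contaminated laws too. *)
Let M := opnorm dot (psd_sqrt dot V) * r.

Lemma ellipsoid_enorm_sq x : B x -> enorm dot x ^+ 2 <= M ^+ 2.
Proof.
move=> Bx; rewrite exprMn.
apply: le_trans (enorm_sq_le_mahalanobis x eigenbasis_psd (eigenbasis_lker0 oe Ve d_gt0)) _.
by rewrite ler_wpM2l ?sqr_ge0.
Qed.

Lemma ellipsoid_enorm x : B x -> enorm dot x <= M.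
Proof.
move=> /ellipsoid_enorm_sq; rewrite ler_pXn2r// nnegrE ?enorm_ge0//.
by rewrite mulr_ge0 ?opnorm_ge0.
Qed.

Let M0 : 0 <= M. Proof. by rewrite mulr_ge0 ?opnorm_ge0. Qed.

Lemma ellipsoid_dot_bounded u x : B x -> `|dot u x| <= enorm dot u * M.
Proof.
move=> /ellipsoid_enorm Bx; apply: le_trans (CauchySchwarz_dot _ _ _) _.
by rewrite ler_wpM2l ?enorm_ge0.
Qed.

Let mB : measurable B := measurable_ellipsoid oe Ve d_gt0 r.

Let PB : P B = gamma%:E.
Proof. exact: (ellipsoid_mass oe Ve d_gt0 h0 dh PV q_gt0 r_ge0). Qed.

Let PBoo : (P B < +oo)%E. Proof. by rewrite PB ltry. Qed.

Lemma ellipsoid_integrable_dot (mu : {measure set prodE -> \bar R}) u :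
  (mu B < +oo)%E -> mu.-integrable B (fun x => (dot u x)%:E).
Proof.
move=> muB; apply: (bounded_integrable mB muB (measurable_dot u)) => x Bx.
exact: ellipsoid_dot_bounded.
Qed.

Lemma ellipsoid_integrable_dot2 u v : P.-integrable B (fun x => (dot u x * dot v x)%:E).
Proof.
apply: (bounded_integrable mB PBoo (measurable_dot2 u v)
  (M := enorm dot u * M * (enorm dot v * M))) => x Bx.
by rewrite normrM ler_pM// ellipsoid_dot_bounded.
Qed.

Lemma ellipsoid_mean u : \int[P]_(x in B) dot u x = 0.
Proof.
under eq_Rintegral do rewrite (dot_expand oe).
rewrite (@Rintegral_sum _ _ _ _ _ mB _
  (fun i x => dot (tnth e i) u * dot (tnth e i) x)) => [|i]; last first.
  have := integrableZl mB (dot (tnth e i) u) (ellipsoid_integrable_dot (tnth e i) PBoo).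
  by apply: eq_integrable.
rewrite big1// => i _; rewrite RintegralZl//; last exact: ellipsoid_integrable_dot.
by rewrite (ellipsoid_first_moment oe Ve d_gt0 h0 dh PV r_ge0) mulr0.
Qed.

(** Both vectors are expanded in the eigenbasis; cross moments vanish and the diagonal ones rebuild
    <u, V v>. *)
Lemma ellipsoid_covariance u v :
  \int[P]_(x in B) (dot u x * dot v x) = gamma * sigma2 * dot u (V v).
Proof.
have -> : dot u (V v) = \sum_i dot (tnth e i) u * (dot (tnth e i) v * d i).
  rewrite [in V v](orthonormal_expand oe v) linear_sum /= dot_sumr.
  apply: eq_bigr => i _; rewrite lfunZ Ve !dotZr (dotC dot u) mulrA.
  by rewrite [RHS]mulrC.
pose c (p : 'I_q * 'I_q) := dot (tnth e p.1) u * dot (tnth e p.2) v.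
transitivity (\int[P]_(x in B) \sum_(p : 'I_q * 'I_q)
    c p * (dot (tnth e p.1) x * dot (tnth e p.2) x)).
  apply: eq_Rintegral => x _; rewrite (dot_expand oe u) (dot_expand oe v).
  rewrite big_distrlr pair_big /=.
  by apply: eq_bigr => -[i j] _ /=; rewrite /c /= mulrACA.
rewrite (@Rintegral_sum _ _ _ _ _ mB _
  (fun p x => c p * (dot (tnth e p.1) x * dot (tnth e p.2) x))) => [|p]; last first.
  have := integrableZl mB (c p) (ellipsoid_integrable_dot2 (tnth e p.1) (tnth e p.2)).
  by apply: eq_integrable.
transitivity (\sum_(p : 'I_q * 'I_q) c p *
    \int[P]_(x in B) (dot (tnth e p.1) x * dot (tnth e p.2) x)).
  by apply: eq_bigr => p _; rewrite RintegralZl//; exact: ellipsoid_integrable_dot2.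
rewrite mulr_sumr -(pair_bigA _ (fun i j => c (i, j) *
    \int[P]_(x in B) (dot (tnth e i) x * dot (tnth e j) x))) /=.
apply: eq_bigr => i _; rewrite (bigD1 i)//= big1 => [|j ji].
  rewrite (ellipsoid_second_moment oe Ve d_gt0 h0 dh PV q_gt0 r_ge0 gamma_gt0) addr0 /c /=.
  by ring.
rewrite (ellipsoid_cross_moment oe Ve d_gt0 h0 dh PV r_ge0) ?mulr0// eq_sym//.
Qed.

(** Covers the law itself (t = 0) and its contaminations at once, through the one property that the
    moment computations use. *)
Definition mixture_on_ellipsoid (mu : {measure set prodE -> \bar R}) (a : prodE) (t : R) :=
  (mu B < +oo)%E /\
  forall (s : prodE -> R) (N : R), measurable_fun setT s ->
    (forall x, B x -> `|s x| <= N) ->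
    \int[mu]_(x in B) s x = (1 - t) * (\int[P]_(x in B) s x) + t * (\1_B a * s a).

Lemma mixture_self a : mixture_on_ellipsoid P a 0.
Proof. by split=> // s N _ _; rewrite subr0 mul1r mul0r addr0. Qed.

Lemma mixture_contaminate a t : 0 <= t <= 1 ->
  mixture_on_ellipsoid (contaminate P a t) a t.
Proof.
move=> t01; split; first exact: contaminate_lty.
by move=> s N ms sN; exact: (Rintegral_contaminate a mB PBoo t01 ms sN).
Qed.

Section Mixture.
Variables (mu : {measure set prodE -> \bar R}) (a : prodE) (t : R).
Hypothesis mix : mixture_on_ellipsoid mu a t.
Let c : R := \1_B a / gamma.

Lemma trimmed_mean_mixture : trimmed_mean gamma B mu = (t * c) *: a.
Proof.
have [muB muE] := mix.
apply: (dot_ext (ip := dot)) => u; rewrite (dotC dot) [RHS](dotC dot) !dotZr.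
rewrite (dot_vintegral mB) => [|v]; last exact: ellipsoid_integrable_dot.
rewrite (muE _ (enorm dot u * M) (measurable_dot u)); last exact: ellipsoid_dot_bounded.
rewrite ellipsoid_mean mulr0 add0r /c; ring.
Qed.

Let shifted_bounded u m x : B x -> `|dot u (x - m)| <= enorm dot u * M + `|dot u m|.
Proof.
move=> Bx; rewrite dotBr; apply: le_trans (ler_normB _ _) _.
by rewrite lerD2r ellipsoid_dot_bounded.
Qed.

Let measurable_shifted u v m :
  measurable_fun [set: prodE] (fun x : prodE => dot u (x - m) * dot v (x - m) : R).
Proof.
apply: measurable_funM; under eq_fun do rewrite dotBr;
  by apply: measurable_funB; [exact: measurable_dot|exact: measurable_cst].
Qed.

Let bounded2 u v m x : B x ->
  `|dot u (x - m) * dot v (x - m)| <=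
    (enorm dot u * M + `|dot u m|) * (enorm dot v * M + `|dot v m|).
Proof. by move=> Bx; rewrite normrM ler_pM ?shifted_bounded. Qed.

(** The trimmed mean is t c a. Recentring the law at it adds (1 - t) (t c)^2, and the point mass, of
    trimmed weight t c, lies at (1 - t c) a from it and adds t c (1 - t c)^2. *)
Lemma mcd_cov_mixture : mcd_cov gamma B mu = ((1 - t) * sigma2) *: V +
  ((1 - t) * (t * c) ^+ 2 + t * c * (1 - t * c) ^+ 2) *: tensor dot a a.
Proof.
have [muB muE] := mix; rewrite /mcd_cov trimmed_mean_mixture.
set m := (t * c) *: a.
apply/lfunP => v; apply: (dot_ext (ip := dot)) => u.
rewrite (dotC dot) [RHS](dotC dot) scale_lfunE dotZr.
rewrite (dot_vintegral_tensor mB) => [|u' v']; last first.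
  apply: (bounded_integrable mB muB (measurable_shifted u' v' m)).
  exact: bounded2.
rewrite (muE _ _ (measurable_shifted u v m) (bounded2 u v m)).
have -> : \int[P]_(x in B) (dot u (x - m) * dot v (x - m)) =
    gamma * sigma2 * dot u (V v) + gamma * (dot u m * dot v m).
  transitivity (\int[P]_(x in B) (dot u x * dot v x +
    (- dot v m * dot u x + (- dot u m * dot v x + dot u m * dot v m)))).
    by apply: eq_Rintegral => x _; rewrite !dotBr; ring.
  have icst (k : R) : P.-integrable B (fun=> k%:E).
    exact: (bounded_integrable mB PBoo (measurable_cst k) (M := `|k|)).
  have iZ (k : R) w : P.-integrable B (fun x => (k * dot w x)%:E).
    have := integrableZl mB k (ellipsoid_integrable_dot w PBoo).
    by apply: eq_integrable.
  have iD (f g : prodE -> R) : P.-integrable B (EFin \o f) ->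
      P.-integrable B (EFin \o g) -> P.-integrable B (fun x => (f x + g x)%:E).
    by move=> fi gi; have := integrableD mB fi gi; apply: eq_integrable.
  have i3 := iD _ _ (iZ (- dot u m) v) (icst (dot u m * dot v m)).
  have i2 := iD _ _ (iZ (- dot v m) u) i3.
  rewrite (RintegralD mB (ellipsoid_integrable_dot2 u v) i2).
  rewrite (RintegralD mB (iZ (- dot v m) u) i3).
  rewrite (RintegralD mB (iZ (- dot u m) v) (icst _)).
  rewrite !(RintegralZl _ mB (ellipsoid_integrable_dot _ PBoo)).
  rewrite !ellipsoid_mean ellipsoid_covariance Rintegral_cst// PB /=.
  by rewrite !mulr0 !add0r [_ * gamma]mulrC.
rewrite add_lfunE !scale_lfunE tensorE [RHS]dotDr !dotBr /m !dotZr (dotC dot a v).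
have g0 : gamma != 0 by rewrite gt_eqF.
have -> : \1_B a = gamma * c by rewrite /c mulrCA mulfV// mulr1.
by field.
Qed.

End Mixture.

Lemma mcd_cov_elliptical : mcd_cov gamma B P = sigma2 *: V.
Proof.
rewrite (mcd_cov_mixture (mixture_self 0)) subr0 mul1r.
by rewrite !mul0r expr0n /= mulr0 addr0 scale0r addr0.
Qed.

End TrimmedMoments.

(** * The constants sigma2 and kappa0 *)

Section RadialConstants.
Context {R : realType}.
Variables (h h' : R -> R) (q : nat) (r : R).
Hypotheses (h0 : forall t, 0 <= t -> 0 <= h t)
  (dh : has_derivative_on_nonneg h h') (h'0 : forall t, 0 <= t -> h' t < 0).
Hypotheses (q_gt0 : (0 < q)%N) (r_gt0 : 0 < r).
Variable g : R.
Hypothesis g_gt0 : 0 < g.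

Let q0 : 0 < q%:R :> R. Proof. by rewrite ltr0n. Qed.
Let S := \int[@lebesgue_measure R]_(t in `[0, r]) (t ^+ q.+1 * h (t ^+ 2)).

Lemma sigma2_kappa0 : exists C, [/\ 0 < C, g * sigma2 q h g r = C * S &
  kappa0 q h' r = C / (q%:R + 2) *
    \int[@lebesgue_measure R]_(t in `[0, r]) (t ^+ (q + 3) * h' (t ^+ 2))].
Proof.
have [C C0 [_ G1 G2]] := @Gamma_half R q q_gt0.
have q2 : 0 < q%:R + 2 :> R by rewrite addr_gt0.
have p0 : pi `^ (q%:R / 2) != 0 :> R by rewrite gt_eqF// powR_gt0// pi_gt0.
have g1 : Gamma (q%:R / 2) != 0 :> R.
  apply/eqP => g1; move: G1; rewrite g1 invr0 mulr0 => /eqP.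
  by rewrite eq_sym mulf_eq0 invr_eq0 pnatr_eq0 orbF gt_eqF// mulr_gt0.
have g2 : Gamma (q%:R / 2 + 1) != 0 :> R.
  by apply/eqP => g2; move: G2; rewrite g2 invr0 mulr0 => /eqP; rewrite lt_eqF.
exists C; split => //.
- rewrite /sigma2 -/S.
  have -> : pi `^ (q%:R / 2) = C * q%:R / 2 * Gamma (q%:R / 2) by rewrite -G1 divfK.
  by field; rewrite g1 !gt_eqF.
- rewrite /kappa0; congr (_ * _).
  by rewrite invfM mulrCA G2 mulrC.
Qed.

Lemma sigma2_gt0 : 0 < sigma2 q h g r.
Proof.
have [C [C0 E _]] := sigma2_kappa0.
rewrite -(pmulr_rgt0 _ g_gt0) E mulr_gt0//.
by apply: (Rintegral_profile_gt0 h0 dh) => //.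
Qed.

(** The integration by parts is used with m = q + 2; its factor q + 2 cancels the one in the
    denominator of [kappa0]. *)
Lemma kappa0_bound : 0 < `|kappa0 q h' r| /\ 2 * `|kappa0 q h' r| <= g * sigma2 q h g r.
Proof.
have [C [C0 -> ->]] := sigma2_kappa0.
have q2 : 0 < q%:R + 2 :> R by rewrite addr_gt0.
have [I0 I1] := Rintegral_derivative_profile h0 dh h'0 (ltn0Sn q.+1) r_gt0.
move: I0 I1; rewrite (_ : q.+3 = (q + 3)%N) ?addn3//= -/S.
set I := Rintegral _ _ _ => I0 I1.
have D0 : 0 < C / (q%:R + 2) by rewrite divr_gt0.
rewrite normrM (gtr0_norm D0) (ltr0_norm I0); split.
  by rewrite mulr_gt0// oppr_gt0.
rewrite mulrCA mulrAC ler_pdivrMr// -mulrA ler_pM2l// mulrC.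
by rewrite [leLHS]mulrC [leRHS]mulrC -natrD addn2.
Qed.

End RadialConstants.

(** * The covariance operator *)

Section Covariance.
Context {R : realType} {K : nat} {E : 'I_K -> vectType R}.
Variable ip : forall k, {dot (E k) for idfun}.
Local Notation prodE := (eprod ip).
Local Notation dot := (eprod_dot (ip := ip) : {dot (eprod ip) for idfun}).
Local Notation q := (\dim {: eprod ip}).
Context d (Omega : measurableType d) (P : probability Omega R).
Variables (X : {mfun Omega >-> prodE}) (V : 'End(prodE)).
Hypotheses
  (VE : V = vintegral P setT (fun w => tensor dot (X w) (X w)))
  (Xfin : forall k,
     (\int[P]_w ((enorm (ip k) (tau ip k (X w)) ^+ 2)%:E) < +oo)%E)
  (Vk : forall k, vintegral P setT
     (fun w => tensor (ip k) (tau ip k (X w)) (tau ip k (X w))) = \1%VF).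

Lemma measurable_dot_mfun u : measurable_fun setT (fun w => dot u (X w) : R).
Proof. exact: measurableT_comp (measurable_dot u) _. Qed.

Let measurable_proj_sq k :
  measurable_fun setT (fun w => enorm (ip k) (tau ip k (X w)) ^+ 2).
Proof.
have e := onbP (ip k); set b := onb _ in e.
under eq_fun => w do rewrite enorm_sq (dot_expand e).
apply: measurable_sum => i; apply: measurable_funM;
  under eq_fun do rewrite tauE (dotC (ip k)) dot_tau (dotC dot);
  exact: measurable_dot_mfun.
Qed.

(** Dominated by |u| |v| times the sum of the |X_k|^2, which is |X|^2. *)
Lemma covariance_integrable u v :
  P.-integrable setT (fun w => (dot u (X w) * dot v (X w))%:E).
Proof.
have ik k : P.-integrable setT (fun w => (enorm (ip k) (tau ip k (X w)) ^+ 2)%:E).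
  apply/integrableP; split; first exact/measurable_EFinP.
  under eq_integral do rewrite gee0_abs ?lee_fin ?sqr_ge0//.
  exact: Xfin.
have := integrable_sum measurableT (index_enum _) (P := xpredT) (fun k _ => ik k).
move=> si; have := integrableZl measurableT (enorm dot u * enorm dot v) si.
apply: le_integrable => //.
  by apply/measurable_EFinP; apply: measurable_funM; exact: measurable_dot_mfun.
move=> w _; rewrite sumEFin -EFinM !abse_EFin lee_fin.
have -> : \sum_k enorm (ip k) (tau ip k (X w)) ^+ 2 = enorm dot (X w) ^+ 2.
  by rewrite enorm_proj_sq; apply: eq_bigr => k _; rewrite tauE.
rewrite normrM [leRHS]ger0_norm ?mulr_ge0 ?sqr_ge0 ?enorm_ge0//.
by rewrite expr2 mulrACA ler_pM ?CauchySchwarz_dot.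
Qed.

Lemma covarianceE u v :
  dot u (V v) = \int[P]_w (dot u (X w) * dot v (X w)).
Proof.
by rewrite VE (dot_vintegral_tensor measurableT)//; exact: covariance_integrable.
Qed.

Lemma covariance_psd : psd dot V.
Proof.
split=> [u v|u].
  rewrite (dotC dot) !covarianceE; apply: eq_Rintegral => w _; exact: mulrC.
by rewrite covarianceE Rintegral_ge0// => w _; rewrite -expr2 sqr_ge0.
Qed.

Lemma diag_part_covariance : diag_part V = \1%VF.
Proof.
apply/lfunP => v; apply: (dot_ext (ip := dot)) => u; rewrite id_lfunE dot_diag_part.
apply: eq_bigr => k _; rewrite (dotC dot) covarianceE.
have tX w : tau ip k (X w) = proj k (X w) by rewrite tauE.
transitivity (ip k (proj k u) (vintegral P setT
    (fun w => tensor (ip k) (tau ip k (X w)) (tau ip k (X w))) (proj k v))).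
  rewrite (dot_vintegral_tensor measurableT) => [|u' v']; last first.
    have := covariance_integrable (tau_adj ip k u') (tau_adj ip k v').
    apply: eq_integrable => // w _.
    rewrite tX (dotC dot (tau_adj ip k u')) (dotC dot (tau_adj ip k v')) -!dot_tau.
    by rewrite (dotC (ip k) u') (dotC (ip k) v').
  apply: eq_Rintegral => w _; rewrite tX.
  by rewrite !(component_self_adjoint k _ (X w)) !dot_component.
by rewrite Vk id_lfunE (dotC (ip k)).
Qed.

End Covariance.

(** * Nondegeneracy of V and the bound on [sigma2] *)

Section EllipticalCovariance.
Context {R : realType} {K : nat} {E : 'I_K -> vectType R}.
Variable ip : forall k, {dot (E k) for idfun}.
Local Notation prodE := (eprod ip).
Local Notation dot := (eprod_dot (ip := ip) : {dot (eprod ip) for idfun}).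
Local Notation q := (\dim {: eprod ip}).
Context dO (Omega : measurableType dO) (P : probability Omega R).
Variables (X : {mfun Omega >-> prodE}) (V : 'End(prodE)) (h h' : R -> R).
Variables (e : q.-tuple prodE) (d : 'I_q -> R) (r : R).
Hypotheses
  (VE : V = vintegral P setT (fun w => tensor dot (X w) (X w)))
  (Xfin : forall k,
     (\int[P]_w ((enorm (ip k) (tau ip k (X w)) ^+ 2)%:E) < +oo)%E).
Hypotheses (oe : orthonormal_basis dot e)
  (Ve : forall i, V (tnth e i) = d i *: tnth e i).
Hypotheses (h0 : forall t, 0 <= t -> 0 <= h t)
  (dh : has_derivative_on_nonneg h h').
Hypothesis PV : elliptical_density (distribution P X) V h.

(** A zero eigenvalue would give det V = 0. Since 0 to the power -1/2 is 0 for [powR], the density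
    would vanish and the total mass could not be 1. *)
Lemma covariance_eigenvalue_gt0 i : 0 < d i.
Proof.
have d0 j : d j = dot (tnth e j) (V (tnth e j)) by rewrite Ve dotZr oe eqxx mulr1.
rewrite lt_neqAle d0 (covariance_psd VE Xfin).2 andbT -d0 eq_sym.
apply/eqP => di0; have : distribution P X setT = 1%E by exact: probability_setT.
pose mu : {measure set prodE -> \bar R} :=
  measure_function_pushforward__canonical__measure_function_Measure
    (lebesgue_tuple q) (measurable_of_coords (onbP dot)).
rewrite PV// (_ : integral _ _ _ = \int[mu]_(x in setT) 0)%E; last first.
  apply: eq_integral => x _; rewrite (lfun_det_eigenbasis oe Ve) (bigD1 i)//= di0.
  by rewrite mul0r powR0 ?mul0r// oppr_eq0 invr_eq0 pnatr_eq0.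
by rewrite integral0 => /eqP; rewrite eqe eq_sym oner_eq0.
Qed.

Hypotheses (q_gt0 : (0 < q)%N) (r_ge0 : 0 <= r).
Hypothesis gamma01 : 0 < radial_mass q h r < 1.
Local Notation gamma := (radial_mass q h r).
Local Notation sigma2 := (sigma2 q h (radial_mass q h r) r).
Local Notation B := (ellipsoid V r).

Let d_gt0 := covariance_eigenvalue_gt0.
Let gamma_gt0 : 0 < gamma. Proof. by have /andP[] := gamma01. Qed.
Let mB : measurable B := measurable_ellipsoid oe Ve d_gt0 r.
Let mBX : measurable (X @^-1` B).
Proof. by rewrite -[_ @^-1` _]setTI; exact: measurable_funP. Qed.

Let sq i w := dot (tnth e i) (X w) * dot (tnth e i) (X w).
Let sqB i w := sq i w * \1_B (X w).

Let measurable_sqB i : measurable_fun setT (sqB i).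
Proof.
apply: measurable_funM; first by apply: measurable_funM; exact: measurable_dot_mfun.
exact: (measurable_indic mBX).
Qed.

Let integrable_sq i : P.-integrable setT (EFin \o sq i).
Proof. exact: covariance_integrable Xfin _ _. Qed.

Let integrable_sqB i : P.-integrable setT (EFin \o sqB i).
Proof.
apply: le_integrable (integrable_sq i) => //; first exact/measurable_EFinP.
move=> w _; rewrite /= lee_fin /sqB normrM indicE.
by case: (_ \in _); rewrite ?normr1 ?normr0 ?mulr1// mulr0.
Qed.

Let Rintegral_sqB i : \int[P]_w sqB i w = gamma * sigma2 * d i.
Proof.
rewrite -(ellipsoid_second_moment oe Ve d_gt0 h0 dh PV q_gt0 r_ge0 gamma_gt0 i).
rewrite /Rintegral [in RHS]integral_mkcond; congr fine.
pose f x := dot (tnth e i) x * dot (tnth e i) x * \1_B x.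
have mf : measurable_fun setT f.
  by apply: measurable_funM; [exact: measurable_dot2|exact: measurable_indic].
transitivity (\int[distribution P X]_x (f x)%:E)%E.
  rewrite ge0_integral_distribution//; first exact/measurable_EFinP.
  by move=> x; rewrite lee_fin mulr_ge0// -expr2 sqr_ge0.
apply: eq_integral => x _; rewrite patchE /f indicE.
by case: (_ \in _); rewrite ?mulr1// mulr0.
Qed.

(* [(r^2 - N^2) (1_B - gamma)], with [N^2 = <X, V^-1 X>], is nonnegative
   because [B] is the event [N <= r], and its expectation is
   [q gamma (1 - sigma2)]. *)
Lemma sigma2_le1 : sigma2 <= 1.
Proof.
pose w1 w := r ^+ 2 * (\1_B (X w) - gamma).
(* Together with [w1] these terms sum to the product; [w1] has mean 0 because B has probability
   gamma, and each of these has mean gamma (1 - [sigma2]). *)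
pose w2 i w := (d i)^-1 * (gamma * sq i w - sqB i w).
have i1 : P.-integrable setT (EFin \o w1).
  apply: (@bounded_integrable _ _ _ setT measurableT P w1 (r ^+ 2 * (1 + gamma))).
  - exact: le_lt_trans (probability_le1 P measurableT) (ltry 1).
  - apply: measurable_funM => //; apply: measurable_funB => //.
    exact: (measurable_indic mBX).
  - move=> w _; rewrite normrM ger0_norm ?sqr_ge0// ler_wpM2l ?sqr_ge0//.
    apply: le_trans (ler_normB _ _) _; rewrite (gtr0_norm gamma_gt0) lerD2r.
    by rewrite indicE; case: (_ \in _); rewrite ?normr1 ?normr0.
have i20 i : P.-integrable setT (EFin \o (fun w => gamma * sq i w)).
  have := integrableZl measurableT gamma (integrable_sq i).
  by apply: eq_integrable.
have i21 i : P.-integrable setT (EFin \o (fun w => gamma * sq i w - sqB i w)).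
  by have := integrableB measurableT (i20 i) (integrable_sqB i); apply: eq_integrable.
have i2 i : P.-integrable setT (EFin \o w2 i).
  by have := integrableZl measurableT (d i)^-1 (i21 i); apply: eq_integrable.
have i2s : P.-integrable setT (EFin \o (fun w => \sum_i w2 i w)).
  have := integrable_sum measurableT (index_enum _) (P := xpredT) (fun i _ => i2 i).
  by apply: eq_integrable => // w _ /=; rewrite sumEFin.
have pos : 0 <= \int[P]_w (w1 w + \sum_i w2 i w).
  apply: Rintegral_ge0 => w _.
  have -> : w1 w + \sum_i w2 i w =
      (r ^+ 2 - dot (X w) ((V^-1)%VF (X w))) * (\1_B (X w) - gamma).
    rewrite mulrBl (mahalanobisE oe Ve d_gt0) mulr_suml -sumrN; congr (_ + _).
    apply: eq_bigr => i _; rewrite /w2 /sqB /sq; ring.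
  rewrite indicE; have [/set_mem Bw|] := boolP (_ \in _).
    by rewrite mulr_ge0 ?subr_ge0//; have /andP[_ /ltW] := gamma01.
  rewrite notin_setE => Bw; rewrite mulr_le0// ?sub0r ?oppr_le0 ?(ltW gamma_gt0)//.
  by rewrite subr_le0 ltW// ltNge; apply/negP.
have I1 : \int[P]_w w1 w = 0.
  have iI : P.-integrable setT (EFin \o (fun w => \1_B (X w))).
    apply: (@bounded_integrable _ _ _ setT measurableT P _ 1).
    - exact: le_lt_trans (probability_le1 P measurableT) (ltry 1).
    - exact: (measurable_indic mBX).
    - by move=> w _; rewrite indicE; case: (_ \in _); rewrite ?normr1 ?normr0.
  have ig := finite_measure_integrable_cst P gamma measurableT.
  rewrite (RintegralZl _ measurableT); last first.
    by have := integrableB measurableT iI ig; apply: eq_integrable.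
  rewrite (RintegralB measurableT iI ig) Rintegral_cst//.
  have PT : P setT = 1%E by exact: probability_setT.
  rewrite [X in _ - _ * X](congr1 fine PT) mulr1.
  have -> : \int[P]_w \1_B (X w) = gamma.
    rewrite /Rintegral (integral_indic P measurableT mBX) setIT.
    transitivity (fine gamma%:E) => //; congr fine.
    exact: (ellipsoid_mass oe Ve d_gt0 h0 dh PV q_gt0 r_ge0).
  by rewrite subrr mulr0.
have I2 : \int[P]_w \sum_i w2 i w = q%:R * (gamma * (1 - sigma2)).
  rewrite (Rintegral_sum measurableT)//.
  transitivity (\sum_(i < q) gamma * (1 - sigma2)); last first.
    by rewrite sumr_const card_ord -[LHS]mulr_natl.
  apply: eq_bigr => i _.
  rewrite (RintegralZl _ measurableT (i21 i)).
  rewrite (RintegralB measurableT (i20 i) (integrable_sqB i)).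
  rewrite (RintegralZl _ measurableT (integrable_sq i)) Rintegral_sqB.
  rewrite -(covarianceE VE Xfin) Ve dotZr oe eqxx mulr1.
  by field; rewrite gt_eqF.
move: pos; rewrite (RintegralD measurableT i1 i2s) I1 I2 add0r.
by rewrite pmulr_rge0 ?ltr0n// pmulr_rge0// subr_ge0.
Qed.

End EllipticalCovariance.

(** * Derivative of the canonical analysis operator *)

Section CanonicalAnalysisDerivative.
Context {R : realType} {V : vectType R} (ip : {dot V for idfun}).
Implicit Types (T S : R -> 'End(V)) (A B : 'End(V)).

Lemma near_has_rderiv T S A A' : (\forall e \near 0^'+, T e = S e) ->
  has_rderiv ip S A A' -> has_rderiv ip T A A'.
Proof.
move=> TS; apply: cvg_trans; apply: near_eq_cvg; near=> e.
have TSe : T e = S e by near: e.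
by rewrite TSe.
Unshelve. all: by end_near. Qed.

(** [psd_sqrt] is a chosen root; the estimate near a scalar, with zero right side, identifies it. *)
Lemma psd_sqrt_scalar s : 0 < s -> psd_sqrt ip (s ^+ 2 *: \1%VF) = s *: \1%VF.
Proof.
move=> s0; have pI : psd ip (s ^+ 2 *: \1%VF).
  split=> [x y|x]; rewrite !scale_lfunE !id_lfunE ?dotZl dotZr//.
  by rewrite mulr_ge0 ?sqr_ge0 ?dot_ge0.
have [pS SS] := psd_sqrtP pI; apply/eqP; rewrite -subr_eq0; apply/eqP.
apply: (@opnorm_eq0 _ _ ip); apply/eqP; rewrite eq_le opnorm_ge0 andbT.
by have := sqrt_near_scalar s0 pS SS; rewrite subrr opnorm0 mulr0.
Qed.

Lemma inv_scalar s : s != 0 -> ((s *: \1%VF : 'End(V))^-1)%VF = s^-1 *: \1%VF.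
Proof.
move=> s0; have k0 : lker (s *: \1%VF : 'End(V)) == 0%VS.
  apply/lker0P => x y; rewrite !scale_lfunE !id_lfunE; exact: (can_inj (scalerK s0)).
apply/lfunP => x; apply: (lker0P k0); rewrite lker0_lfunVK//.
by rewrite !scale_lfunE !id_lfunE scalerA mulfV// scale1r.
Qed.

(** The shape of [mcd_lca] with the diagonal and off-diagonal parts as independent arguments, so
    that each can be differentiated on its own. *)
Definition canonical_analysis (D O : 'End(V)) : 'End(V) :=
  let F := ((psd_sqrt ip D)^-1)%VF in (F \o O \o F)%VF.

Lemma canonical_analysis_scalar s G : 0 < s ->
  canonical_analysis (s ^+ 2 *: \1%VF) (s ^+ 2 *: G) = G.
Proof.
move=> s0; have sN0 : s != 0 by rewrite gt_eqF.
rewrite /canonical_analysis psd_sqrt_scalar// inv_scalar//; apply/lfunP => x.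
rewrite !comp_lfunE !scale_lfunE !id_lfunE lfunZ !scalerA.
by rewrite (_ : _ * _ = 1) ?scale1r//; field.
Qed.

(** The terms in -s^2 come from the factor 1 - t. They cancel: the two inverse roots contribute +G
    and the middle factor -G, in keeping with invariance under scaling. *)
Lemma has_rderiv_canonical_analysis D O s c A C G : 0 < s ->
  (\forall e \near 0^'+, psd ip (D e)) ->
  has_rderiv ip D (s ^+ 2 *: \1%VF) (- s ^+ 2 *: \1%VF + c *: A) ->
  has_rderiv ip O (s ^+ 2 *: G) (- s ^+ 2 *: G + c *: C) ->
  has_rderiv ip (fun e => canonical_analysis (D e) (O e)) G
    ((c / s ^+ 2) *: (C - 2^-1 *: ((A \o G) + (G \o A))%VF)).
Proof.
move=> s0 pD dD dO; have sN0 : s != 0 by rewrite gt_eqF.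
have SD : \forall e \near 0^'+, psd ip (psd_sqrt ip (D e)) /\
    forall x, psd_sqrt ip (D e) (psd_sqrt ip (D e) x) = D e x.
  by near=> e; apply: psd_sqrtP; near: e.
have dF := has_rderiv_inv s0 (has_rderiv_sqrt s0 SD dD).
have := has_rderiv_comp (has_rderiv_comp dF dO) dF.
set G0 := (X in has_rderiv _ _ X _); set L0 := (X in has_rderiv _ _ _ X).
have -> : G0 = G.
  apply/lfunP => x; rewrite !comp_lfunE !scale_lfunE !id_lfunE lfunZ !scalerA.
  by rewrite (_ : _ * _ = 1) ?scale1r//; field.
suff -> : L0 = (c / s ^+ 2) *: (C - 2^-1 *: ((A \o G) + (G \o A))%VF) by [].
apply/lfunP => x; apply: (dot_ext (ip := ip)) => z.
rewrite /L0 !(add_lfunE, opp_lfunE, comp_lfunE, scale_lfunE, id_lfunE).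
rewrite ?(lfunD, lfunZ) ?(add_lfunE, opp_lfunE, comp_lfunE, scale_lfunE, id_lfunE).
rewrite !(dotDl, dotNl, dotZl).
by field.
Unshelve. all: by end_near. Qed.

End CanonicalAnalysisDerivative.

(** * The influence function *)

Section InfluenceFunction.
Context {R : realType} {K : nat} {E : 'I_K -> vectType R}.
Variable ip : forall k, {dot (E k) for idfun}.
Local Notation prodE := (eprod ip).
Local Notation dot := (eprod_dot (ip := ip) : {dot (eprod ip) for idfun}).
Local Notation q := (\dim {: eprod ip}).
Context dO (Omega : measurableType dO) (P : probability Omega R).
Variables (X : {mfun Omega >-> prodE}) (V : 'End(prodE)) (h h' : R -> R) (r : R).
Hypotheses
  (VE : V = vintegral P setT (fun w => tensor dot (X w) (X w)))
  (Xfin : forall k,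
     (\int[P]_w ((enorm (ip k) (tau ip k (X w)) ^+ 2)%:E) < +oo)%E)
  (Vk : forall k, vintegral P setT
     (fun w => tensor (ip k) (tau ip k (X w)) (tau ip k (X w))) = \1%VF).
Hypotheses (h0 : forall t, 0 <= t -> 0 <= h t)
  (dh : has_derivative_on_nonneg h h') (h'0 : forall t, 0 <= t -> h' t < 0).
Hypothesis PV : elliptical_density (distribution P X) V h.
Hypotheses (q_gt0 : (0 < q)%N) (r_ge0 : 0 <= r).
Hypothesis gamma01 : 0 < radial_mass q h r < 1.
Local Notation gamma := (radial_mass q h r).
Local Notation sigma2 := (sigma2 q h (radial_mass q h r) r).
Local Notation B := (ellipsoid V r).
Local Notation PX := (distribution P X).
Local Notation T1 := (mcd_lca gamma B).
Local Notation G := (offdiag_part V).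

Let gamma_gt0 : 0 < gamma. Proof. by have /andP[] := gamma01. Qed.

Let r_gt0 : 0 < r. Proof. exact: radius_gt0 r_ge0 gamma_gt0. Qed.

Let s2_gt0 : 0 < sigma2. Proof. exact: (sigma2_gt0 h0 dh h'0 q_gt0 r_gt0 gamma_gt0). Qed.

Definition influence_lca (a : prodE) : 'End(prodE) :=
  (\1_B a / gamma / sigma2) *: (offdiag_part (tensor dot a a) -
    2^-1 *: ((diag_part (tensor dot a a) \o G) + (G \o diag_part (tensor dot a a)))%VF).

Let V1 : diag_part V = \1%VF. Proof. exact: diag_part_covariance VE Xfin Vk. Qed.

Let near01 : \forall t \near (0 : R)^'+, 0 <= t <= 1.
Proof.
near=> t; apply/andP; split; first exact: ltW.
near: t; exact: nbhs_right_le.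
Unshelve. all: by end_near. Qed.

Lemma is_influence_lca a : is_influence dot T1 PX a (influence_lca a).
Proof.
have [e [d [oe Ve]]] := spectral (covariance_psd VE Xfin).1.
have d_gt0 := covariance_eigenvalue_gt0 VE Xfin oe Ve PV.
pose c : R := \1_B a / gamma.
pose w (t : R) : R := (1 - t) * (t * c) ^+ 2 + t * c * (1 - t * c) ^+ 2.
have c0 : 0 <= c by rewrite divr_ge0// ltW.
have covE : \forall t \near 0^'+, mcd_cov gamma B (contaminate PX a t) =
    ((1 - t) * sigma2) *: V + w t *: tensor dot a a.
  near=> t; have t01 : 0 <= t <= 1 by near: t.
  apply: (mcd_cov_mixture oe Ve d_gt0 h0 dh PV q_gt0 r_ge0 gamma_gt0).
  exact: (mixture_contaminate oe Ve d_gt0 h0 dh PV q_gt0 r_ge0 _ t01).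
have dV : t^-1 * ((1 - t) * sigma2 - sigma2) @[t --> 0^'+] --> - sigma2.
  have : (fun=> - sigma2) t @[t --> (0 : R)^'+] --> - sigma2 by exact: cvg_cst.
  apply: cvg_trans; apply: near_eq_cvg; near=> t.
  have t0 : t != 0 by rewrite gt_eqF.
  by field.
(* The shift of the mean enters [w] at second order only; the point mass alone gives the slope c. *)
have dw : t^-1 * (w t - 0) @[t --> 0^'+] --> c.
  have : (1 - t) * (t * c ^+ 2) + c * (1 - t * c) ^+ 2 @[t --> 0^'+] -->
      (1 - 0) * (0 * c ^+ 2) + c * (1 - 0 * c) ^+ 2.
    have ct (k : R) : t * k @[t --> 0^'+] --> 0 * k.
      by apply: cvgMl; exact: cvg_id_right0.
    apply: cvgD; apply: cvgM => //.
    - by apply: cvgB; [exact: cvg_cst|exact: cvg_id_right0].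
    - exact: cvg_cst.
    - rewrite expr2; under eq_fun do rewrite expr2.
      by apply: cvgM; apply: cvgB => //; exact: cvg_cst.
  rewrite !mul0r mulr0 add0r subr0 expr1n mulr1; apply: cvg_trans.
  apply: near_eq_cvg; near=> t; have t0 : t != 0 by rewrite gt_eqF.
  by rewrite /w; field.
have s0 : 0 < Num.sqrt sigma2 by rewrite sqrtr_gt0.
have ss : Num.sqrt sigma2 ^+ 2 = sigma2 by rewrite sqr_sqrtr ?ltW.
(* Stated for any linear [F], to be used with both the diagonal and the off-diagonal part;
   sqrt([sigma2]) plays the role of s. *)
have rd (F : 'End(prodE) -> 'End(prodE)) :
    (forall x y A B, F (x *: A + y *: B) = x *: F A + y *: F B) ->
    has_rderiv dot (fun t => F (mcd_cov gamma B (contaminate PX a t)))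
      (Num.sqrt sigma2 ^+ 2 *: F V)
      (- Num.sqrt sigma2 ^+ 2 *: F V + c *: F (tensor dot a a)).
  move=> Flin; rewrite ss.
  apply: (@near_has_rderiv _ _ dot _ (fun t => ((1 - t) * sigma2) *: F V +
      w t *: F (tensor dot a a))).
    by near=> t; rewrite -Flin; congr F; near: t.
  have := has_rderivD (has_rderivZ dot (F V) dV)
    (has_rderivZ dot (F (tensor dot a a)) dw).
  by rewrite scale0r addr0.
have dD := rd _ (@diag_part_lin _ _ _ ip); rewrite V1 in dD.
have pD : \forall t \near 0^'+, psd dot (diag_part (mcd_cov gamma B (contaminate PX a t))).
  near=> t; have /andP[t0 t1] : 0 <= t <= 1 by near: t.
  have -> : mcd_cov gamma B (contaminate PX a t) =
    ((1 - t) * sigma2) *: V + w t *: tensor dot a a by near: t.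
  apply/psd_diag_part/psd_lin; last exact: covariance_psd VE Xfin.
    by rewrite mulr_ge0 ?subr_ge0// ltW.
  by rewrite addr_ge0// mulr_ge0 ?sqr_ge0 ?subr_ge0// mulr_ge0.
have := has_rderiv_canonical_analysis s0 pD dD (rd _ (@offdiag_part_lin _ _ _ ip)).
rewrite [X in _ / X]ss => main.
suff TPX : T1 PX = G by rewrite /is_influence TPX; exact: main.
have lin0 (F : 'End(prodE) -> 'End(prodE)) :
    (forall x y A B, F (x *: A + y *: B) = x *: F A + y *: F B) ->
    F (sigma2 *: V) = sigma2 *: F V.
  by move=> /(_ sigma2 0 V V); rewrite !scale0r !addr0.
rewrite -[RHS](canonical_analysis_scalar dot _ s0) ss /mcd_lca.
rewrite (mcd_cov_elliptical oe Ve d_gt0 h0 dh PV q_gt0 r_ge0 gamma_gt0).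
by rewrite (lin0 _ (@diag_part_lin _ _ _ ip)) (lin0 _ (@offdiag_part_lin _ _ _ ip)) V1.
Unshelve. all: by end_near. Qed.

(** [influence] picks some limit; existence makes the pick a limit and uniqueness of one-sided
    derivatives identifies it. *)
Lemma influence_lcaE a : influence dot T1 PX a = influence_lca a.
Proof.
apply: has_rderiv_unique (is_influence_lca a).
by apply: (@xgetPex _ 0 [set A | is_influence dot T1 PX a A]); exists (influence_lca a); exact: is_influence_lca.
Qed.

Lemma opnorm_influence_lca a : (0 < K)%N -> opnorm dot (influence_lca a) <=
  sigma2^-1 / (2 * `|kappa0 q h' r|) * (K%:R * (K%:R - 1)) * (opnorm dot V + 1) *
  opnorm dot (psd_sqrt dot V) ^+ 2 * r ^+ 2.
Proof.
have [e [d [oe Ve]]] := spectral (covariance_psd VE Xfin).1.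
have d_gt0 := covariance_eigenvalue_gt0 VE Xfin oe Ve PV.
move=> K0; have [k0 kg] := kappa0_bound h0 dh h'0 q_gt0 r_gt0 gamma_gt0.
have k2 : 0 < 2 * `|kappa0 q h' r| by rewrite mulr_gt0.
have s2i : 0 <= sigma2^-1 by rewrite invr_ge0 ltW.
have K1 : 0 <= K%:R - 1 :> R by rewrite subr_ge0 ler1n.
have k2i : 0 <= (2 * `|kappa0 q h' r|)^-1 by rewrite invr_ge0 ltW.
have KK : 0 <= K%:R * (K%:R - 1) :> R by rewrite mulr_ge0.
have V10 : 0 <= opnorm dot V + 1 by rewrite addr_ge0 ?opnorm_ge0.
have [aB|aB] := pselect (B a); last first.
  rewrite /influence_lca indicE memNset// !mul0r scale0r opnorm0.
  by rewrite !mulr_ge0 ?exprn_ge0 ?opnorm_ge0.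
rewrite /influence_lca indicE mem_set//= mul1r.
apply: le_trans (opnormZ_le _ _ _) _.
rewrite ger0_norm; last by rewrite mulr_ge0// invr_ge0 ltW.
set x2 := enorm dot a ^+ 2.
(* Origin of the factor |V| + 1: the off-diagonal part of the tensor gives the 1, and the halved sum
   of the two products with g(V) gives |V|. *)
have bound : opnorm dot (offdiag_part (tensor dot a a) -
    2^-1 *: ((diag_part (tensor dot a a) \o G) + (G \o diag_part (tensor dot a a)))%VF)
    <= K%:R * (K%:R - 1) * (opnorm dot V + 1) * x2.
  have xx := opnorm_tensor a; have dxx := opnorm_diag_part_tensor a.
  have oG := opnorm_offdiag_part V.
  have y0 := opnorm_ge0 dot (diag_part (tensor dot a a)).
  have G0 := opnorm_ge0 dot G.
  have dG : opnorm dot (diag_part (tensor dot a a)) * opnorm dot G <=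
      x2 * (K%:R * (K%:R - 1) * opnorm dot V) by rewrite ler_pM.
  apply: le_trans (opnormD _ _ _) _; rewrite opnormN.
  have -> : K%:R * (K%:R - 1) * (opnorm dot V + 1) * x2 =
      K%:R * (K%:R - 1) * x2 + x2 * (K%:R * (K%:R - 1) * opnorm dot V) by ring.
  apply: lerD.
    by apply: le_trans (opnorm_offdiag_part _) _; rewrite ler_wpM2l.
  apply: le_trans (opnormZ_le _ _ _) _; rewrite ger0_norm ?invr_ge0//.
  move: dG; set y := x2 * _ => dG; rewrite ler_pdivrMl// mulr_natl mulr2n.
  apply: le_trans (opnormD _ _ _) _; apply: lerD; apply: le_trans (opnorm_comp _ _ _) _ => //.
  by rewrite mulrC.
have x2M : x2 <= opnorm dot (psd_sqrt dot V) ^+ 2 * r ^+ 2.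
  rewrite -exprMn; exact: (ellipsoid_enorm_sq oe Ve d_gt0 aB).
(* The chain 2 |kappa0| <= gamma [sigma2] <= gamma. *)
have gk : gamma^-1 <= (2 * `|kappa0 q h' r|)^-1.
  rewrite lef_pV2 ?posrE//; apply: le_trans kg _.
  rewrite -[leRHS]mulr1 ler_wpM2l ?(ltW gamma_gt0)//.
  exact: (sigma2_le1 VE Xfin oe Ve h0 dh PV q_gt0 r_ge0 gamma01).
have -> : sigma2^-1 / (2 * `|kappa0 q h' r|) * (K%:R * (K%:R - 1)) * (opnorm dot V + 1) *
    opnorm dot (psd_sqrt dot V) ^+ 2 * r ^+ 2 =
    ((2 * `|kappa0 q h' r|)^-1 * sigma2^-1) * (K%:R * (K%:R - 1) * (opnorm dot V + 1) *
    (opnorm dot (psd_sqrt dot V) ^+ 2 * r ^+ 2)).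
  by rewrite [X in _ = X * _]mulrC !mulrA.
apply: ler_pM; rewrite ?opnorm_ge0//.
- by rewrite mulr_ge0// invr_ge0 ltW.
- by rewrite ler_wpM2r.
- by apply: le_trans bound _; rewrite ler_wpM2l// mulr_ge0.
Qed.

End InfluenceFunction.

Lemma opnorm_dim0 (R : realType) (V : vectType R) (ip : {dot V for idfun}) (A : 'End(V)) :
  \dim {:V} = 0 -> opnorm ip A = 0.
Proof.
move=> V0; rewrite (_ : A = 0) ?opnorm0//; apply/lfunP => x.
have : A x \in {:V}%VS by exact: memvf.
have /eqP -> : {:V}%VS == 0%VS by rewrite -dimv_eq0 V0.
by rewrite memv0 zero_lfunE => /eqP.
Qed.

Unset Implicit Arguments.

Theorem proposition2 (R : realType) (K : nat) (hK : (2 <= K)%N)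
    (E : 'I_K -> vectType R) (ip : forall k, {dot (E k) for idfun})
    (d : measure_display) (Omega : measurableType d) (P : probability Omega R)
    (X : {mfun Omega >-> eprod ip}) (V : 'End(eprod ip))
    (h h' : R -> R) (gamma r : R) :
  let dot := eprod_dot (ip := ip) in
  let q := \dim {: eprod ip} in
  let PX := distribution P X in
  let T1 := mcd_lca gamma (ellipsoid V r) in
  V = vintegral P setT (fun w => tensor dot (X w) (X w)) ->
  (forall k, vintegral P setT (fun w => tau ip k (X w)) = 0) ->
  (forall k, (\int[P]_w ((enorm (ip k) (tau ip k (X w)) ^+ 2)%:E) < +oo)%E) ->
  (forall k, vintegral P setT
     (fun w => tensor (ip k) (tau ip k (X w)) (tau ip k (X w))) = \1%VF) ->
  (forall t, 0 <= t -> 0 <= h t) ->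
  has_derivative_on_nonneg h h' ->
  (forall t, 0 <= t -> h' t < 0) ->
  elliptical_density PX V h ->
  0 < gamma < 1 ->
  0 <= r ->
  radial_mass q h r = gamma ->
  (forall x, is_influence dot T1 PX x (influence dot T1 PX x)) /\
  (ereal_sup [set (opnorm dot (influence dot T1 PX x))%:E
             | x in [set: eprod ip]] <=
   ((sigma2 q h gamma r)^-1 / (2 * `|kappa0 q h' r|) *
    (K%:R * (K%:R - 1)) * (opnorm dot V + 1) *
    opnorm dot (psd_sqrt dot V) ^+ 2 * r ^+ 2)%:E)%E.
Proof.
move=> dot q PX T1 VE _ Xfin Vk h0 dh h'0 PV gamma01 r0 gammaE.
(* All factors may be zero spaces. Every operator norm is then 0, so both sides of the bound are 0;
   the radial computations require q > 0. *)
have [q0|q0] := posnP q.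
  split=> [x|].
    rewrite /is_influence; under eq_fun do rewrite opnorm_dim0//.
    exact: cvg_cst.
  apply: ge_ereal_sup => _ [x _ <-].
  by rewrite !opnorm_dim0// expr0n /= mulr0 mul0r.
move: gamma01 @T1; rewrite -gammaE => gamma01 T1.
split=> [x|].
  rewrite (influence_lcaE VE Xfin Vk h0 dh h'0 PV q0 r0 gamma01).
  exact: (is_influence_lca VE Xfin Vk h0 dh h'0 PV q0 r0 gamma01).
apply: ge_ereal_sup => _ [x _ <-].
rewrite (influence_lcaE VE Xfin Vk h0 dh h'0 PV q0 r0 gamma01) lee_fin.
exact: (opnorm_influence_lca VE Xfin h0 dh h'0 PV q0 r0 gamma01 x (ltnW hK)).
Qed.
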